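(* Let $\mathbb{F}$ be any field and $\Delta$ the split building of $\mathsf{G}_2(\mathbb{F})$. There is a unique conjugacy class $\mathscr{C}_1$ of collineations $\theta$ with $\mathrm{Type}(\theta)=\{2\}$ and a unique conjugacy class $\mathscr{C}_2$ of collineations with $\mathrm{Type}(\theta)=\{1\}$. The elements of $\mathscr{C}_1$ are exactly the long root elations. The elements of $\mathscr{C}_2$: (1) are short root elations (represented by $x_{\varphi'}(1)$) if $\mathrm{char}(\mathbb{F})=3$; (2) are homologies (represented by $h_{\omega_1}(z)$ with $z^2+z+1=0$) whose fixed structure is exactly a large full subhexagon, if $\mathrm{char}(\mathbb{F})\neq3$ and $z^2+z+1$ has a root in $\mathbb{F}$; (3) have fixed structure exactly a distance-$3$ ovoid (represented by $x_{\alpha_1}(1)s_1$) if $z^2+z+1$ is irreducible over $\mathbb{F}$.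
   Context: $\mathsf{G}_2$ with $\alpha_1$ short, $\alpha_2$ long; $\varphi'=2\alpha_1+\alpha_2$ the highest short root; $s_1=x_{\alpha_1}(1)x_{-\alpha_1}(-1)x_{\alpha_1}(1)$; $\omega_1$ fundamental coweight, $h_{\omega_1}(c)x_\alpha(a)h_{\omega_1}(c)^{-1}=x_\alpha(ac^{\langle\omega_1,\alpha\rangle})$. $\Delta$ is viewed as a generalised hexagon with points the cosets of $B\cup Bs_1B$ and lines the cosets of $B\cup Bs_2B$, incident iff they intersect. Type $1$ vertices are lines and type $2$ vertices are points in this convention (type $J$ simplices are cosets of $P_{S\setminus J}$). Collineation = type preserving automorphism; $\mathrm{Type}(\theta)$ = union of types of simplices mapped to opposite simplices. Root elation: conjugate to $x_\alpha(a)$, $a\neq0$, long/short according to $\alpha$; homology: conjugate to nontrivial torus element. A distance-$3$ ovoid is a set of mutually opposite points such that every point and line is at distance at most $3$ in the incidence graph from one of them. A subhexagon is full if every point on each of its lines lies in it, and large if every element of $\Delta$ is at distance at most $3$ from some element of it. *)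

(* Defs.v *)
(* The split building of G2(F), realised via the
   Chevalley group G2(F) inside GL_7(F) (7-dimensional module, explicit
   Chevalley basis), viewed as a generalised hexagon. *)
From HB Require Import structures.
From mathcomp Require Import all_boot all_order all_algebra.
From Stdlib Require List.
Set Implicit Arguments. Unset Strict Implicit. Unset Printing Implicit Defensive.
Import GRing.Theory.
Local Open Scope ring_scope.

(* positive roots of G2, alpha1 short, alpha2 long *)
Inductive posroot := R1 (* a1 *) | R2 (* a2 *) | R12 (* a1+a2 *)
  | R112 (* 2a1+a2 *) | R1112 (* 3a1+a2 *) | R11122 (* 3a1+2a2 *).
Inductive g2root := Pos of posroot | Neg of posroot.

Definition is_long (a : g2root) : bool :=
  match a with Pos r | Neg r =>
    match r with R2 | R1112 | R11122 => true | _ => false end end.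
Definition is_positive (a : g2root) : bool :=
  match a with Pos _ => true | Neg _ => false end.

Definition alpha1 := Pos R1.
Definition alpha2 := Pos R2.
Definition phi' := Pos R112.   (* highest short root 2a1+a2 *)

(* Basis v0..v6 of weight vectors of weights
   2a1+a2, a1+a2, a1, 0, -a1, -a1-a2, -2a1-a2.
   e_a = Chevalley basis element acting; e2_a = e_a^2/2 (integral). *)
Definition entry : Type := (nat * nat * int)%type.
Definition E (i j : nat) (v : int) : entry := (i, j, v).
Arguments E i%_N j%_N v%_R.

Definition eL (a : g2root) : seq entry :=
  match a with
  | Pos R1 => [:: E 0 1 (1); E 2 3 (1); E 3 4 (2); E 5 6 (1)]
  | Pos R2 => [:: E 1 2 (1); E 4 5 (1)]
  | Pos R12 => [:: E 0 2 (1); E 1 3 (-1); E 3 5 (2); E 4 6 (-1)]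
  | Pos R112 => [:: E 0 3 (-1); E 1 4 (1); E 2 5 (1); E 3 6 (-2)]
  | Pos R1112 => [:: E 0 4 (1); E 2 6 (-1)]
  | Pos R11122 => [:: E 0 5 (-1); E 1 6 (-1)]
  | Neg R1 => [:: E 1 0 (1); E 3 2 (2); E 4 3 (1); E 6 5 (1)]
  | Neg R2 => [:: E 2 1 (1); E 5 4 (1)]
  | Neg R12 => [:: E 2 0 (-1); E 3 1 (2); E 5 3 (-1); E 6 4 (1)]
  | Neg R112 => [:: E 3 0 (-2); E 4 1 (1); E 5 2 (1); E 6 3 (-1)]
  | Neg R1112 => [:: E 4 0 (-1); E 6 2 (1)]
  | Neg R11122 => [:: E 5 0 (-1); E 6 1 (-1)]
  end.

Definition e2L (a : g2root) : seq entry :=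
  match a with
  | Pos R1 => [:: E 2 4 (1)]
  | Pos R12 => [:: E 1 5 (-1)]
  | Pos R112 => [:: E 0 6 (1)]
  | Neg R1 => [:: E 4 2 (1)]
  | Neg R12 => [:: E 5 1 (-1)]
  | Neg R112 => [:: E 6 0 (1)]
  | _ => [::]
  end.

Section G2.
Variable F : fieldType.

Definition M7 := 'M[F]_7.

Definition mxL (l : seq entry) : M7 :=
  \matrix_(i < 7, j < 7)
    \sum_(t <- l | (t.1.1 == i :> nat) && (t.1.2 == j :> nat)) (t.2)%:~R.

(* root element x_a(t) = exp(t e_a) *)
Definition xr (a : g2root) (t : F) : M7 :=
  1%:M + t *: mxL (eL a) + (t ^+ 2) *: mxL (e2L a).

(* torus element h_{w1}(c) h_{w2}(d) : acts on weight aa1+ba2 by c^a d^b *)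
Definition torus (c d : F) : M7 :=
  diag_mx (\row_(i < 7)
    [:: c ^+ 2 * d; c * d; c; 1; c^-1; c^-1 * d^-1; c^-2 * d^-1]`_i).

Definition h_w1 (c : F) : M7 := torus c 1.

Definition s_of (a : g2root) (na : g2root) : M7 :=
  xr a 1 *m xr na (-1) *m xr a 1.
Definition s1 : M7 := s_of (Pos R1) (Neg R1).
Definition s2 : M7 := s_of (Pos R2) (Neg R2).

Definition genby (S : M7 -> Prop) (g : M7) : Prop :=
  exists s : seq M7,
    List.Forall (fun x => S x \/ exists y, S y /\ x = invmx y) s /\
    g = foldr mulmx 1%:M s.

Definition G2gens (g : M7) : Prop := exists a t, g = xr a t.
Definition inG (g : M7) : Prop := genby G2gens g.

Definition Bgens (g : M7) : Prop :=
  (exists a t, is_positive a /\ g = xr a t) \/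
  (exists c d, c != 0 /\ d != 0 /\ g = torus c d).
Definition inB := genby Bgens.
(* P1 = B u B s1 B,  P2 = B u B s2 B *)
Definition inP1 := genby (fun g => Bgens g \/ g = s1).
Definition inP2 := genby (fun g => Bgens g \/ g = s2).

Definition coset (H : M7 -> Prop) (g : M7) : M7 -> Prop :=
  fun x => exists h, H h /\ x = g *m h.

Definition isPoint (X : M7 -> Prop) := exists g, inG g /\ X = coset inP1 g.
Definition isLine (X : M7 -> Prop) := exists g, inG g /\ X = coset inP2 g.
Definition Point := {X : M7 -> Prop | isPoint X}.
Definition Line := {X : M7 -> Prop | isLine X}.

Definition incident (p : Point) (L : Line) : Prop :=
  exists x, proj1_sig p x /\ proj1_sig L x.

Inductive vtx := VP of Point | VL of Line.
Definition adj (u v : vtx) : Prop :=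
  match u, v with
  | VP p, VL L => incident p L
  | VL L, VP p => incident p L
  | _, _ => False
  end.

Fixpoint withinIn (X : vtx -> Prop) (n : nat) (u v : vtx) : Prop :=
  u = v \/ match n with
           | 0 => False
           | m.+1 => exists w, X w /\ adj u w /\ withinIn X m w v
           end.
Definition within := withinIn (fun _ => True).
Definition opposite (u v : vtx) : Prop := within 6 u v /\ ~ within 5 u v.

Record collineation := Coll {
  cpt : Point -> Point;
  cln : Line -> Line;
  cpt_bij : bijective cpt;
  cln_bij : bijective cln;
  c_inc : forall p L, incident p L <-> incident (cpt p) (cln L) }.

Definition conjugate (th1 th2 : collineation) : Prop :=
  exists phi : collineation,
    (forall p, cpt th1 (cpt phi p) = cpt phi (cpt th2 p)) /\
    (forall L, cln th1 (cln phi L) = cln phi (cln th2 L)).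

Definition induces (th : collineation) (g : M7) : Prop :=
  (forall p x, proj1_sig (cpt th p) x <-> exists y, proj1_sig p y /\ x = g *m y) /\
  (forall L x, proj1_sig (cln th L) x <-> exists y, proj1_sig L y /\ x = g *m y).

Definition conj_to (th : collineation) (g : M7) : Prop :=
  exists th0, induces th0 g /\ conjugate th th0.

Definition long_root_elation th :=
  exists a t, is_long a /\ t != 0 /\ conj_to th (xr a t).
Definition short_root_elation th :=
  exists a t, ~~ is_long a /\ t != 0 /\ conj_to th (xr a t).
Definition homology th :=
  exists c d, c != 0 /\ d != 0 /\ torus c d != 1%:M /\ conj_to th (torus c d).

(* types: type 1 vertices = lines, type 2 vertices = points *)
Inductive vtype := T1 | T2.
Inductive simplex := SP of Point | SL of Line | SF of Point & Line.
Definition is_simplex (s : simplex) : Prop :=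
  match s with SF p L => incident p L | _ => True end.
Definition has_type (s : simplex) (t : vtype) : Prop :=
  match s, t with
  | SP _, T2 => True | SL _, T1 => True | SF _ _, _ => True | _, _ => False
  end.
Definition simg (th : collineation) (s : simplex) : simplex :=
  match s with
  | SP p => SP (cpt th p) | SL L => SL (cln th L)
  | SF p L => SF (cpt th p) (cln th L)
  end.
Definition opp_simplex (s s' : simplex) : Prop :=
  match s, s' with
  | SP p, SP q => opposite (VP p) (VP q)
  | SL L, SL M => opposite (VL L) (VL M)
  | SF p L, SF q M => opposite (VP p) (VP q) /\ opposite (VL L) (VL M)
  | _, _ => False
  end.
Definition in_Type (th : collineation) (t : vtype) : Prop :=
  exists s, is_simplex s /\ has_type s t /\ opp_simplex s (simg th s).
Definition Type_is (th : collineation) (t : vtype) : Prop :=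
  forall u, in_Type th u <-> u = t.

Definition fixed (th : collineation) (v : vtx) : Prop :=
  match v with VP p => cpt th p = p | VL L => cln th L = L end.

Fixpoint chainP (x : vtx) (l : seq vtx) : Prop :=
  match l with [::] => True | y :: l' => adj x y /\ chainP y l' end.
Definition circuit (l : seq vtx) : Prop :=
  match l with [::] => False | x :: l' => chainP x l' /\ adj (last x l') x end.
Definition ngon_in (X : vtx -> Prop) (k : nat) (l : seq vtx) : Prop :=
  size l = (2 * k)%N /\ List.NoDup l /\ List.Forall X l /\ circuit l.

(* X is a (possibly weak) subhexagon: no ordinary k-gons for 2<=k<6 and
   any two elements lie in a common ordinary hexagon *)
Definition subhexagon (X : vtx -> Prop) : Prop :=
  (forall k l, (2 <= k < 6)%N -> ~ ngon_in X k l) /\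
  (forall u v, X u -> X v ->
     exists l, ngon_in X 6 l /\ List.In u l /\ List.In v l).
Definition full (X : vtx -> Prop) : Prop :=
  forall L p, X (VL L) -> incident p L -> X (VP p).
Definition large (X : vtx -> Prop) : Prop :=
  forall u, exists v, X v /\ within 3 u v.

Definition dist3_ovoid (O : Point -> Prop) : Prop :=
  (forall p q, O p -> O q -> p <> q -> opposite (VP p) (VP q)) /\
  (forall u, exists p, O p /\ within 3 u (VP p)).

End G2.

(* Main.v *)
(* Lines and points of the hexagon are 1- and 2-dimensional subspaces of the
   7-dimensional module, and opposition is the non-vanishing of an invariant
   symmetric form, respectively of its 2x2 Gram determinants.  If no point is
   mapped to an opposite one and a line L is opposite to its image, every path
   of length 6 from L to its image is reversed, so its middle point is fixed.
   Rigidity of the hexagon then forces the collineation to be induced by an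
   element x_{-a}(t) s_a h of the rank one subgroup of the short simple root a,
   and evaluating the Gram determinant at one further point leaves a single
   conjugacy class: trace -1 in SL2.  Dually, the long simple root and trace 2
   give the other class.  The three cases are the rational forms of
   z^2 + z + 1, the characteristic polynomial of the element of trace -1. *)
Require Import Defs.
From mathcomp Require Import all_boot all_order all_algebra.
From mathcomp Require Import ring zify.
From Stdlib Require List.
From Stdlib Require Import Classical FunctionalExtensionality PropExtensionality ProofIrrelevance.
Set Implicit Arguments. Unset Strict Implicit. Unset Printing Implicit Defensive.
Import GRing.Theory.
Local Open Scope ring_scope.

(** * Root and torus elements of G2 *)

(** The building is given only through cosets in a matrix group, so neither the hexagon axioms nor a
    Bruhat decomposition is at hand; both are extracted from explicit matrix relations. A root group
    fixes seven consecutive vertices of the standard 12-cycle and is transitive on the neighbours of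
    the last one other than the last but one. Hence every non-stammering path of length at most 7
    can be moved into the 12-cycle, where distances are read off from vectors. A collineation need
    not come from the group, since it may involve a field automorphism. Reversing a single path
    would not exclude this. All translates of a path under a root group orthogonal to the simple
    root are reversed, and their midpoints control all neighbours of one vertex. A collineation
    fixing the apartment acts on the parameters of the two simple root groups by two maps, tied
    together by the commutator of these groups; once one map is the identity, the other is
    multiplication by a constant. All computations have to hold in characteristics 2 and 3 as well,
    which decides how the form is normalised and which vertices are tested. *)

Section Matrices.
Variable F : fieldType.
Implicit Types (a : g2root) (t u c d : F).

Definition vec (x0 x1 x2 x3 x4 x5 x6 : F) : 'cV[F]_7 :=
  \col_(i < 7) [:: x0; x1; x2; x3; x4; x5; x6]`_i.

Lemma vecP (v : 'cV[F]_7) : exists x0 x1 x2 x3 x4 x5 x6,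
  v = vec x0 x1 x2 x3 x4 x5 x6.
Proof.
exists (v (inord 0) 0), (v (inord 1) 0), (v (inord 2) 0), (v (inord 3) 0).
exists (v (inord 4) 0), (v (inord 5) 0), (v (inord 6) 0).
apply/colP => i; rewrite mxE.
by case: i => [[|[|[|[|[|[|[|//]]]]]]] Hi] /=; congr (v _ _);
  apply: val_inj; rewrite /= inordK.
Qed.

(** Testing on a vector with indeterminate coordinates keeps products of root elements from being
    expanded as matrices: an identity becomes seven polynomial ones. *)
Lemma mx_ext (A B : 'M[F]_7) :
  (forall x0 x1 x2 x3 x4 x5 x6, A *m vec x0 x1 x2 x3 x4 x5 x6
                              = B *m vec x0 x1 x2 x3 x4 x5 x6) -> A = B.
Proof.
move=> H; apply/matrixP => i j.
have [x0 [x1 [x2 [x3 [x4 [x5 [x6 E]]]]]]] := vecP (delta_mx j 0).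
have := H x0 x1 x2 x3 x4 x5 x6; rewrite -E -!colE.
by move/matrixP/(_ i 0); rewrite !mxE.
Qed.

Lemma mulmx_vec (A : 'M[F]_7) x0 x1 x2 x3 x4 x5 x6 :
  A *m vec x0 x1 x2 x3 x4 x5 x6 = \col_i
  (A i 0 * x0 + A i 1 * x1 + A i 2%R * x2 + A i 3%R * x3
   + A i 4%R * x4 + A i 5%R * x5 + A i 6%R * x6).
Proof.
apply/colP => i; rewrite !mxE !big_ord_recl big_ord0 addr0 !addrA !mxE /=.
by do !congr (_ + _); congr (A _ _ * _); apply: val_inj.
Qed.

Lemma torus_vec c d x0 x1 x2 x3 x4 x5 x6 :
  torus c d *m vec x0 x1 x2 x3 x4 x5 x6 =
  vec (c ^+ 2 * d * x0) (c * d * x1) (c * x2) x3 (c^-1 * x4) (c^-1 * d^-1 * x5)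
      (c^-2 * d^-1 * x6).
Proof.
rewrite mul_diag_mx; apply/colP => i; rewrite !mxE.
by case: i => [[|[|[|[|[|[|[|//]]]]]]] Hi] //=; rewrite mul1r.
Qed.

(** Unlocking lets the big sum over the list of entries compute, which leaves polynomial
    identities. *)
Ltac xr_tac := rewrite mulmx_vec; apply/colP => -[[|[|[|[|[|[|[|//]]]]]]] ?];
  rewrite !mxE /= unlock /=; ring.

Lemma xr_R1 (t x0 x1 x2 x3 x4 x5 x6 : F) :
  xr (Pos R1) t *m vec x0 x1 x2 x3 x4 x5 x6 =
  vec (x0 + t * x1) x1 (x2 + t * x3 + t ^+ 2 * x4) (x3 + 2 * t * x4) x4 (x5 + t * x6) x6.
Proof. by xr_tac. Qed.
Lemma xr_R2 (t x0 x1 x2 x3 x4 x5 x6 : F) :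
  xr (Pos R2) t *m vec x0 x1 x2 x3 x4 x5 x6 =
  vec x0 (x1 + t * x2) x2 x3 (x4 + t * x5) x5 x6.
Proof. by xr_tac. Qed.
Lemma xr_R12 (t x0 x1 x2 x3 x4 x5 x6 : F) :
  xr (Pos R12) t *m vec x0 x1 x2 x3 x4 x5 x6 =
  vec (x0 + t * x2) (x1 - t * x3 - t ^+ 2 * x5) x2 (x3 + 2 * t * x5) (x4 - t * x6) x5 x6.
Proof. by xr_tac. Qed.
Lemma xr_R112 (t x0 x1 x2 x3 x4 x5 x6 : F) :
  xr (Pos R112) t *m vec x0 x1 x2 x3 x4 x5 x6 =
  vec (x0 - t * x3 + t ^+ 2 * x6) (x1 + t * x4) (x2 + t * x5) (x3 - 2 * t * x6) x4 x5 x6.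
Proof. by xr_tac. Qed.
Lemma xr_R1112 (t x0 x1 x2 x3 x4 x5 x6 : F) :
  xr (Pos R1112) t *m vec x0 x1 x2 x3 x4 x5 x6 =
  vec (x0 + t * x4) x1 (x2 - t * x6) x3 x4 x5 x6.
Proof. by xr_tac. Qed.
Lemma xr_R11122 (t x0 x1 x2 x3 x4 x5 x6 : F) :
  xr (Pos R11122) t *m vec x0 x1 x2 x3 x4 x5 x6 =
  vec (x0 - t * x5) (x1 - t * x6) x2 x3 x4 x5 x6.
Proof. by xr_tac. Qed.
Lemma xr_NR1 (t x0 x1 x2 x3 x4 x5 x6 : F) :
  xr (Neg R1) t *m vec x0 x1 x2 x3 x4 x5 x6 =
  vec x0 (x1 + t * x0) x2 (x3 + 2 * t * x2) (x4 + t * x3 + t ^+ 2 * x2) x5 (x6 + t * x5).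
Proof. by xr_tac. Qed.
Lemma xr_NR2 (t x0 x1 x2 x3 x4 x5 x6 : F) :
  xr (Neg R2) t *m vec x0 x1 x2 x3 x4 x5 x6 =
  vec x0 x1 (x2 + t * x1) x3 x4 (x5 + t * x4) x6.
Proof. by xr_tac. Qed.
Lemma xr_NR12 (t x0 x1 x2 x3 x4 x5 x6 : F) :
  xr (Neg R12) t *m vec x0 x1 x2 x3 x4 x5 x6 =
  vec x0 x1 (x2 - t * x0) (x3 + 2 * t * x1) x4 (x5 - t * x3 - t ^+ 2 * x1) (x6 + t * x4).
Proof. by xr_tac. Qed.
Lemma xr_NR112 (t x0 x1 x2 x3 x4 x5 x6 : F) :
  xr (Neg R112) t *m vec x0 x1 x2 x3 x4 x5 x6 =
  vec x0 x1 x2 (x3 - 2 * t * x0) (x4 + t * x1) (x5 + t * x2) (x6 - t * x3 + t ^+ 2 * x0).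
Proof. by xr_tac. Qed.
Lemma xr_NR1112 (t x0 x1 x2 x3 x4 x5 x6 : F) :
  xr (Neg R1112) t *m vec x0 x1 x2 x3 x4 x5 x6 =
  vec x0 x1 x2 x3 (x4 - t * x0) x5 (x6 + t * x2).
Proof. by xr_tac. Qed.
Lemma xr_NR11122 (t x0 x1 x2 x3 x4 x5 x6 : F) :
  xr (Neg R11122) t *m vec x0 x1 x2 x3 x4 x5 x6 =
  vec x0 x1 x2 x3 x4 (x5 - t * x0) (x6 - t * x1).
Proof. by xr_tac. Qed.

Definition xr_vec := (xr_R1, xr_R2, xr_R12, xr_R112, xr_R1112, xr_R11122,
  xr_NR1, xr_NR2, xr_NR12, xr_NR112, xr_NR1112, xr_NR11122, torus_vec).

End Matrices.

Ltac mat_tac := apply: mx_ext => x0 x1 x2 x3 x4 x5 x6; rewrite -?mulmxA ?xr_vec.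

(** * Relations between root elements, torus and Weyl elements *)

Section Identities.
Variable F : fieldType.
Implicit Types (a : g2root) (t u c d : F).

Lemma xrD a t u : xr a t *m xr a u = xr a (t + u).
Proof. by case: a => -[]; mat_tac; congr vec; ring. Qed.

Lemma xr0 a : xr a 0 = 1%:M :> 'M[F]_7.
Proof. by rewrite /xr scale0r expr0n scale0r !addr0. Qed.

(** The root as a character of the torus, whose coordinates [c] and [d] are the values at the two
    simple roots. *)
Definition chi a c d : F :=
  match a with
  | Pos R1 => c | Pos R2 => d | Pos R12 => c * d | Pos R112 => c ^+ 2 * d
  | Pos R1112 => c ^+ 3 * d | Pos R11122 => c ^+ 3 * d ^+ 2
  | Neg R1 => c^-1 | Neg R2 => d^-1 | Neg R12 => (c * d)^-1
  | Neg R112 => (c ^+ 2 * d)^-1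
  | Neg R1112 => (c ^+ 3 * d)^-1 | Neg R11122 => (c ^+ 3 * d ^+ 2)^-1
  end.

Lemma torus_xr a t c d : c != 0 -> d != 0 ->
  torus c d *m xr a t = xr a (chi a c d * t) *m torus c d.
Proof.
move=> c0 d0; case: a => -[]; mat_tac => /=; congr vec; field; rewrite ?c0 ?d0 //.
Qed.

Lemma torusM c d c' d' : torus c d *m torus c' d' = torus (c * c') (d * d').
Proof. by mat_tac; congr vec; rewrite ?exprMn ?invfM; ring. Qed.

Lemma torus11 : torus 1 1 = 1%:M :> 'M[F]_7.
Proof. by mat_tac; rewrite mul1mx; congr vec; rewrite ?expr1n ?invr1; ring. Qed.

(** The simple reflections on the roots; [sg1] and [sg2] below are the signs with which [s1] and
    [s2] permute the chosen Chevalley basis. *)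
Definition w1 a : g2root :=
  match a with
  | Pos R1 => Neg R1 | Pos R2 => Pos R1112 | Pos R12 => Pos R112
  | Pos R112 => Pos R12 | Pos R1112 => Pos R2 | Pos R11122 => Pos R11122
  | Neg R1 => Pos R1 | Neg R2 => Neg R1112 | Neg R12 => Neg R112
  | Neg R112 => Neg R12 | Neg R1112 => Neg R2 | Neg R11122 => Neg R11122
  end.
Definition w2 a : g2root :=
  match a with
  | Pos R1 => Pos R12 | Pos R2 => Neg R2 | Pos R12 => Pos R1
  | Pos R112 => Pos R112 | Pos R1112 => Pos R11122 | Pos R11122 => Pos R1112
  | Neg R1 => Neg R12 | Neg R2 => Pos R2 | Neg R12 => Neg R1
  | Neg R112 => Neg R112 | Neg R1112 => Neg R11122 | Neg R11122 => Neg R1112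
  end.
Definition sg1 a : F :=
  match a with
  | Pos R1 | Pos R12 | Pos R1112 | Neg R1 | Neg R2 | Neg R112 => -1
  | _ => 1
  end.
Definition sg2 a : F :=
  match a with
  | Pos R1 | Pos R2 | Pos R11122 | Neg R2 | Neg R12 | Neg R1112 => -1
  | _ => 1
  end.

Lemma s1_vec (x0 x1 x2 x3 x4 x5 x6 : F) : s1 F *m vec x0 x1 x2 x3 x4 x5 x6 =
  vec x1 (- x0) x4 (- x3) x2 x6 (- x5).
Proof. by rewrite /s1 /s_of -!mulmxA !xr_vec; congr vec; ring. Qed.

Lemma s2_vec (x0 x1 x2 x3 x4 x5 x6 : F) : s2 F *m vec x0 x1 x2 x3 x4 x5 x6 =
  vec x0 x2 (- x1) x3 x5 (- x4) x6.
Proof. by rewrite /s2 /s_of -!mulmxA !xr_vec; congr vec; ring. Qed.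

Definition svec := (xr_vec, s1_vec, s2_vec).

Lemma s1_xr a t : s1 F *m xr a t = xr (w1 a) (sg1 a * t) *m s1 F.
Proof.
by case: a => -[]; apply: mx_ext => x0 x1 x2 x3 x4 x5 x6;
  rewrite -(mulmxA (s1 F)) -(mulmxA (xr _ _)) /= !svec; congr vec; ring.
Qed.

Lemma s2_xr a t : s2 F *m xr a t = xr (w2 a) (sg2 a * t) *m s2 F.
Proof.
by case: a => -[]; apply: mx_ext => x0 x1 x2 x3 x4 x5 x6;
  rewrite -(mulmxA (s2 F)) -(mulmxA (xr _ _)) /= !svec; congr vec; ring.
Qed.

Lemma s1_torus c d : c != 0 -> d != 0 ->
  s1 F *m torus c d = torus c^-1 (c ^+ 3 * d) *m s1 F.
Proof.
by move=> c0 d0; mat_tac; rewrite ?svec; congr vec; rewrite /=; field; rewrite ?c0 ?d0 ?oner_eq0.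
Qed.

Lemma s2_torus c d : c != 0 -> d != 0 ->
  s2 F *m torus c d = torus (c * d) d^-1 *m s2 F.
Proof.
by move=> c0 d0; mat_tac; rewrite ?svec; congr vec; rewrite /=; field; rewrite ?c0 ?d0 ?oner_eq0.
Qed.

Lemma s1_sq : s1 F *m s1 F = torus 1 (-1).
Proof. by mat_tac; rewrite ?svec; congr vec; rewrite ?expr1n ?invrN ?invr1; ring. Qed.

Lemma s2_sq : s2 F *m s2 F = torus (-1) 1.
Proof. by mat_tac; rewrite ?svec; congr vec; rewrite ?sqrrN ?expr1n ?invrN ?invr1; ring. Qed.

(** The relation of SL2 that brings [s1 x(t) s1] back into [B s1 B]. It is what closes the list of
    neighbours in [nbr_pt1] under [s1]. *)
Lemma s1_rank1 t : t != 0 ->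
  s1 F *m xr alpha1 t *m s1 F =
  xr alpha1 (- t^-1) *m s1 F *m torus (t ^+ 2) (- t ^- 3) *m xr alpha1 (- t^-1).
Proof.
move=> t0; apply: mx_ext => x0 x1 x2 x3 x4 x5 x6.
rewrite -(mulmxA (s1 F *m xr _ _)) -(mulmxA (s1 F)).
rewrite -(mulmxA (xr _ _ *m s1 F *m torus _ _)) -(mulmxA (xr _ _ *m s1 F)) -(mulmxA (xr _ _)).
by rewrite !svec; congr vec; field; rewrite ?t0 ?oppr_eq0 ?oner_eq0.
Qed.

Lemma s2_rank1 t : t != 0 ->
  s2 F *m xr alpha2 t *m s2 F =
  xr alpha2 (- t^-1) *m s2 F *m torus (- t^-1) (t ^+ 2) *m xr alpha2 (- t^-1).
Proof.
move=> t0; apply: mx_ext => x0 x1 x2 x3 x4 x5 x6.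
rewrite -(mulmxA (s2 F *m xr _ _)) -(mulmxA (s2 F)).
rewrite -(mulmxA (xr _ _ *m s2 F *m torus _ _)) -(mulmxA (xr _ _ *m s2 F)) -(mulmxA (xr _ _)).
by rewrite !svec; congr vec; field; rewrite ?t0 ?oppr_eq0 ?oner_eq0.
Qed.

(** The exponents 2 and -3 are the pairings of [alpha1] and [alpha2] with the coroot of [alpha1];
    the relation puts the values of this coroot into the group generated by the root elements. *)
Lemma torus_coroot1 t : t != 0 ->
  xr (Pos R1) t *m xr (Neg R1) (- t^-1) *m xr (Pos R1) t =
  torus (t ^+ 2) (t ^- 3) *m s1 F.
Proof.
move=> t0; mat_tac; rewrite ?svec.
by congr vec; rewrite /=; field; rewrite ?t0 ?oppr_eq0 ?oner_eq0.
Qed.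

Lemma torus_coroot2 t : t != 0 ->
  xr (Pos R2) t *m xr (Neg R2) (- t^-1) *m xr (Pos R2) t =
  torus t^-1 (t ^+ 2) *m s2 F.
Proof.
move=> t0; mat_tac; rewrite ?svec.
by congr vec; rewrite /=; field; rewrite ?t0 ?oppr_eq0 ?oner_eq0.
Qed.

(** The commutator formulas from here to [comm_2_11122] pull the simple root element to the left,
    because the factors then left on the right all fix the vertex to which the product is
    applied. *)
Lemma comm_12 t u : xr (Pos R2) u *m xr (Pos R1) t =
  xr (Pos R1) t *m xr (Pos R2) u *m xr (Pos R12) (- (t * u)) *m
  xr (Pos R112) (t ^+ 2 * u) *m xr (Pos R1112) (- (t ^+ 3 * u)) *m
  xr (Pos R11122) (- (t ^+ 3 * u ^+ 2)).
Proof. by mat_tac; congr vec; ring. Qed.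

Lemma comm_1_12 t u : xr (Pos R12) u *m xr (Pos R1) t =
  xr (Pos R1) t *m xr (Pos R12) u *m xr (Pos R112) (- (2 * t * u)) *m
  xr (Pos R11122) (- (3 * t * u ^+ 2)) *m xr (Pos R1112) (3 * t ^+ 2 * u).
Proof. by mat_tac; congr vec; ring. Qed.

Lemma comm_1_112 t u : xr (Pos R112) u *m xr (Pos R1) t =
  xr (Pos R1) t *m xr (Pos R112) u *m xr (Pos R1112) (- (3 * t * u)).
Proof. by mat_tac; congr vec; ring. Qed.

Lemma comm_1_1112 t u : xr (Pos R1112) u *m xr (Pos R1) t =
  xr (Pos R1) t *m xr (Pos R1112) u.
Proof. by mat_tac; congr vec; ring. Qed.

Lemma comm_1_11122 t u : xr (Pos R11122) u *m xr (Pos R1) t =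
  xr (Pos R1) t *m xr (Pos R11122) u.
Proof. by mat_tac; congr vec; ring. Qed.

Lemma comm_2_1 t u : xr (Pos R1) u *m xr (Pos R2) t =
  xr (Pos R2) t *m xr (Pos R1) u *m xr (Pos R12) (t * u) *m
  xr (Pos R112) (- (t * u ^+ 2)) *m xr (Pos R1112) (t * u ^+ 3) *m
  xr (Pos R11122) (- (2 * t ^+ 2 * u ^+ 3)).
Proof. by mat_tac; congr vec; ring. Qed.

Lemma comm_2_12 t u : xr (Pos R12) u *m xr (Pos R2) t =
  xr (Pos R2) t *m xr (Pos R12) u.
Proof. by mat_tac; congr vec; ring. Qed.

Lemma comm_2_112 t u : xr (Pos R112) u *m xr (Pos R2) t =
  xr (Pos R2) t *m xr (Pos R112) u.
Proof. by mat_tac; congr vec; ring. Qed.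

Lemma comm_2_1112 t u : xr (Pos R1112) u *m xr (Pos R2) t =
  xr (Pos R2) t *m xr (Pos R1112) u *m xr (Pos R11122) (- (t * u)).
Proof. by mat_tac; congr vec; ring. Qed.

Lemma comm_2_11122 t u : xr (Pos R11122) u *m xr (Pos R2) t =
  xr (Pos R2) t *m xr (Pos R11122) u.
Proof. by mat_tac; congr vec; ring. Qed.

End Identities.

(** * The generated groups and their units *)

Section Groups.
Variable F : fieldType.
Notation M := 'M[F]_7.
Implicit Types (a : g2root) (t u c d : F) (S : M -> Prop).

Lemma genby1 S : genby S 1%:M.
Proof. by exists [::]; split; first exact: List.Forall_nil. Qed.

Lemma genbyM S g h : genby S g -> genby S h -> genby S (g *m h).
Proof.
move=> [s [Hs ->]] [s' [Hs' ->]]; exists (s ++ s'); split.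
  by apply/List.Forall_app.
elim: s {Hs} => [|x s IH] /=; first by rewrite mul1mx.
by rewrite -mulmxA IH.
Qed.

Lemma genby_gen S g : S g -> genby S g.
Proof.
move=> Sg; exists [:: g]; split; last by rewrite /= mulmx1.
by apply: List.Forall_cons; [left | exact: List.Forall_nil].
Qed.

Lemma genby_genV S g : S g -> genby S (invmx g).
Proof.
move=> Sg; exists [:: invmx g]; split; last by rewrite /= mulmx1.
by apply: List.Forall_cons; [right; exists g | exact: List.Forall_nil].
Qed.

Lemma genby_ind S (P : M -> Prop) : P 1%:M ->
  (forall y h, S y -> P h -> P (y *m h)) ->
  (forall y h, S y -> P h -> P (invmx y *m h)) ->
  forall g, genby S g -> P g.
Proof.
move=> P1 PM PV g [s [Hs ->]]; elim: Hs => [|x l H _ IH] //=.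
by case: H => [Sx|[y [Sy ->]]]; [apply: PM | apply: PV].
Qed.

Lemma xrK a t : xr a t *m xr a (- t) = 1%:M.
Proof. by rewrite xrD subrr xr0. Qed.

Lemma xr_unit a t : xr a t \in unitmx.
Proof. by have /mulmx1_unit[] := xrK a t. Qed.

Lemma invmx_xr a t : invmx (xr a t) = xr a (- t).
Proof. by rewrite -[RHS](mulKmx (xr_unit a t)) xrK mulmx1. Qed.

Lemma torusK c d : c != 0 -> d != 0 -> torus c d *m torus c^-1 d^-1 = 1%:M.
Proof. by move=> c0 d0; rewrite torusM !divff // torus11. Qed.

Lemma torus_unit c d : c != 0 -> d != 0 -> torus c d \in unitmx.
Proof. by move=> c0 d0; have /mulmx1_unit[] := torusK c0 d0. Qed.

Lemma invmx_torus c d : c != 0 -> d != 0 -> invmx (torus c d) = torus c^-1 d^-1.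
Proof.
by move=> c0 d0; rewrite -[RHS](mulKmx (torus_unit c0 d0)) torusK // mulmx1.
Qed.

Lemma s1_unit : s1 F \in unitmx.
Proof. by rewrite /s1 /s_of !unitmx_mul !xr_unit. Qed.

Lemma s2_unit : s2 F \in unitmx.
Proof. by rewrite /s2 /s_of !unitmx_mul !xr_unit. Qed.

Lemma genby_unit S g : (forall y, S y -> y \in unitmx) -> genby S g -> g \in unitmx.
Proof.
move=> U; move: g; apply: genby_ind; first exact: unitmx1.
  by move=> y h Sy Uh; rewrite unitmx_mul U.
by move=> y h Sy Uh; rewrite unitmx_mul unitmx_inv U.
Qed.

Lemma invmxM (g h : M) : g \in unitmx -> h \in unitmx ->
  invmx (g *m h) = invmx h *m invmx g.
Proof.
move=> Ug Uh; have U : g *m h \in unitmx by rewrite unitmx_mul Ug.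
apply: (can_inj (mulKmx U)).
by rewrite mulmxV // -mulmxA (mulmxA h) mulmxV // mul1mx mulmxV.
Qed.

Lemma genbyV S g : (forall y, S y -> y \in unitmx) -> genby S g -> genby S (invmx g).
Proof.
move=> U Gg; have [] // : g \in unitmx /\ genby S (invmx g).
move: g Gg; apply: genby_ind.
- by rewrite invmx1; split; [exact: unitmx1 | exact: genby1].
- move=> y h Sy [Uh Vh]; have Uy := U y Sy.
  split; first by rewrite unitmx_mul Uy.
  by rewrite invmxM //; apply: genbyM => //; apply: genby_genV.
- move=> y h Sy [Uh Vh]; have Uy : invmx y \in unitmx by rewrite unitmx_inv U.
  split; first by rewrite unitmx_mul Uy.
  by rewrite invmxM // invmxK; apply: genbyM => //; apply: genby_gen.
Qed.

Lemma genby_sub S S' g : (forall y, S y -> genby S' y) ->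
  (forall y, S y -> genby S' (invmx y)) -> genby S g -> genby S' g.
Proof.
move=> H H'; move: g; apply: genby_ind; first exact: genby1.
  by move=> y h Sy; apply: genbyM; apply: H.
by move=> y h Sy; apply: genbyM; apply: H'.
Qed.

Lemma inG_xr a t : inG (xr a t).
Proof. by apply: genby_gen; exists a, t. Qed.

Lemma G2gens_unit (y : M) : G2gens y -> y \in unitmx.
Proof. by move=> [a [t ->]]; apply: xr_unit. Qed.

Lemma inGM (g h : M) : inG g -> inG h -> inG (g *m h).
Proof. exact: genbyM. Qed.

Lemma inGV (g : M) : inG g -> inG (invmx g).
Proof. exact: genbyV G2gens_unit. Qed.

Lemma inG_unit (g : M) : inG g -> g \in unitmx.
Proof. exact: genby_unit G2gens_unit. Qed.

Lemma inG_s1 : inG (s1 F).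
Proof. by rewrite /s1 /s_of; do !apply: inGM; apply: inG_xr. Qed.

Lemma inG_s2 : inG (s2 F).
Proof. by rewrite /s2 /s_of; do !apply: inGM; apply: inG_xr. Qed.

Lemma inG_coroot1 t : t != 0 -> inG (torus (t ^+ 2) (t ^- 3)).
Proof.
move=> t0; have := torus_coroot1 t0.
move/(congr1 (mulmxr (invmx (s1 F)))); rewrite /= mulmxK ?s1_unit // => <-.
by do !apply: inGM; [exact: inG_xr..|apply: inGV; exact: inG_s1].
Qed.

Lemma inG_coroot2 t : t != 0 -> inG (torus t^-1 (t ^+ 2)).
Proof.
move=> t0; have := torus_coroot2 t0.
move/(congr1 (mulmxr (invmx (s2 F)))); rewrite /= mulmxK ?s2_unit // => <-.
by do !apply: inGM; [exact: inG_xr..|apply: inGV; exact: inG_s2].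
Qed.

(* The simple coroots of G2 form a basis of the cocharacter lattice. *)
Lemma inG_torus c d : c != 0 -> d != 0 -> inG (torus c d).
Proof.
move=> c0 d0.
have -> : torus c d = torus ((c ^+ 2 * d) ^+ 2) ((c ^+ 2 * d) ^- 3) *m
                      torus (c ^+ 3 * d ^+ 2)^-1 ((c ^+ 3 * d ^+ 2) ^+ 2).
  by rewrite torusM; congr torus; field; rewrite ?c0 ?d0 ?oner_eq0.
apply: inGM; [apply: inG_coroot1 | apply: inG_coroot2];
  by rewrite mulf_neq0 // expf_neq0.
Qed.

Lemma Bgens_unit (y : M) : Bgens y -> y \in unitmx.
Proof.
by move=> [[a [t [_ ->]]]|[c [d [c0 [d0 ->]]]]]; rewrite ?xr_unit ?torus_unit.
Qed.

Lemma Bgens_inG (y : M) : Bgens y -> inG y.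
Proof.
move=> [[a [t [_ ->]]]|[c [d [c0 [d0 ->]]]]]; first exact: inG_xr.
exact: inG_torus.
Qed.

Lemma inP1_inG (g : M) : inP1 g -> inG g.
Proof.
have H (y : M) : Bgens y \/ y = s1 F -> inG y.
  by case=> [/Bgens_inG //|->]; exact: inG_s1.
by apply: genby_sub => y /H // /inGV.
Qed.

Lemma inP2_inG (g : M) : inP2 g -> inG g.
Proof.
have H (y : M) : Bgens y \/ y = s2 F -> inG y.
  by case=> [/Bgens_inG //|->]; exact: inG_s2.
by apply: genby_sub => y /H // /inGV.
Qed.

Lemma P1gens_unit (y : M) : Bgens y \/ y = s1 F -> y \in unitmx.
Proof. by case=> [/Bgens_unit //|->]; exact: s1_unit. Qed.

Lemma P2gens_unit (y : M) : Bgens y \/ y = s2 F -> y \in unitmx.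
Proof. by case=> [/Bgens_unit //|->]; exact: s2_unit. Qed.

Lemma inP1_pos r t : inP1 (xr (Pos r) t : M).
Proof. by apply: genby_gen; left; left; exists (Pos r), t. Qed.

Lemma inP2_pos r t : inP2 (xr (Pos r) t : M).
Proof. by apply: genby_gen; left; left; exists (Pos r), t. Qed.

Lemma inP1_torus c d : c != 0 -> d != 0 -> inP1 (torus c d).
Proof. by move=> c0 d0; apply: genby_gen; left; right; exists c, d. Qed.

Lemma inP2_torus c d : c != 0 -> d != 0 -> inP2 (torus c d).
Proof. by move=> c0 d0; apply: genby_gen; left; right; exists c, d. Qed.

Lemma inP1_s1 : inP1 (s1 F). Proof. by apply: genby_gen; right. Qed.
Lemma inP2_s2 : inP2 (s2 F). Proof. by apply: genby_gen; right. Qed.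

Lemma inP1_neg t : inP1 (xr (Neg R1) t : M).
Proof.
have E : s1 F *m xr (Pos R1) (- t) = xr (Neg R1) t *m s1 F.
  by rewrite s1_xr /= mulN1r opprK.
have -> : xr (Neg R1) t = s1 F *m xr (Pos R1) (- t) *m invmx (s1 F).
  by rewrite E mulmxK // s1_unit.
apply: genbyM; first apply: genbyM; [exact: inP1_s1|exact: inP1_pos|].
exact: genbyV P1gens_unit inP1_s1.
Qed.

Lemma inP2_neg t : inP2 (xr (Neg R2) t : M).
Proof.
have E : s2 F *m xr (Pos R2) (- t) = xr (Neg R2) t *m s2 F.
  by rewrite s2_xr /= mulN1r opprK.
have -> : xr (Neg R2) t = s2 F *m xr (Pos R2) (- t) *m invmx (s2 F).
  by rewrite E mulmxK // s2_unit.
apply: genbyM; first apply: genbyM; [exact: inP2_s2|exact: inP2_pos|].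
exact: genbyV P2gens_unit inP2_s2.
Qed.

End Groups.

(** * The action on the hexagon *)

Section Action.
Variable F : fieldType.
Notation M := 'M[F]_7.
Implicit Types (a : g2root) (t c d : F) (u v w : vtx F).

(** Membership travels with the matrix, so that cosets and actions are total functions; by proof
    irrelevance, equality depends on the matrix alone. *)
Record G2F := MkG { gv :> M; gvG : inG gv }.

Lemma gext (g h : G2F) : gv g = gv h -> g = h.
Proof.
by case: g h => [g Hg] [h Hh] /= E; subst h; rewrite (proof_irrelevance _ Hg Hh).
Qed.

Definition gone : G2F := MkG (genby1 _ : inG 1%:M).
Definition gmul (g h : G2F) : G2F := MkG (inGM (gvG g) (gvG h)).
Definition ginv (g : G2F) : G2F := MkG (inGV (gvG g)).
Definition X a t : G2F := MkG (inG_xr a t).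
Definition H c d (c0 : c != 0) (d0 : d != 0) : G2F := MkG (inG_torus c0 d0).
Definition S1 : G2F := MkG (inG_s1 F).
Definition S2 : G2F := MkG (inG_s2 F).
Local Infix "·" := gmul (at level 40, left associativity).

Lemma gmulA (g h k : G2F) : g · (h · k) = g · h · k.
Proof. by apply: gext; rewrite /= mulmxA. Qed.
Lemma gmul1 (g : G2F) : g · gone = g.
Proof. by apply: gext; rewrite /= mulmx1. Qed.
Lemma gone_mul (g : G2F) : gone · g = g.
Proof. by apply: gext; rewrite /= mul1mx. Qed.
Lemma gmulV (g : G2F) : g · ginv g = gone.
Proof. by apply: gext; rewrite /= mulmxV // inG_unit //; apply: gvG. Qed.
Lemma gmulVg (g : G2F) : ginv g · g = gone.
Proof. by apply: gext; rewrite /= mulVmx // inG_unit //; apply: gvG. Qed.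

Definition inP1g (k : G2F) := inP1 (gv k).
Definition inP2g (k : G2F) := inP2 (gv k).

Definition pt (g : G2F) : vtx F :=
  VP (exist _ (coset (@inP1 F) g) (ex_intro _ (gv g) (conj (gvG g) erefl))).
Definition ln (g : G2F) : vtx F :=
  VL (exist _ (coset (@inP2 F) g) (ex_intro _ (gv g) (conj (gvG g) erefl))).

Lemma sub_ext (T : Type) (P : T -> Prop) (x y : {z | P z}) :
  proj1_sig x = proj1_sig y -> x = y.
Proof.
case: x y => [x Px] [y Py] /= E; subst y.
by rewrite (proof_irrelevance _ Px Py).
Qed.

Lemma set_ext (T : Type) (A B : T -> Prop) : (forall x, A x <-> B x) -> A = B.
Proof.
by move=> E; apply: functional_extensionality => x; apply: propositional_extensionality.
Qed.

Lemma vtx_rep (u : vtx F) : exists g, u = pt g \/ u = ln g.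
Proof.
case: u => -[Y [g [Gg EY]]].
  exists (MkG Gg); left; rewrite /pt; congr VP; exact: sub_ext.
by exists (MkG Gg); right; rewrite /ln; congr VL; apply: sub_ext.
Qed.

Lemma coset_eq (H : M -> Prop) (g h : M) :
  H 1%:M -> (forall x y, H x -> H y -> H (x *m y)) ->
  (forall x, H x -> x \in unitmx /\ H (invmx x)) ->
  (coset H g = coset H h <-> exists k, H k /\ h = g *m k).
Proof.
move=> H1 HM HV; split.
  move=> E; have : coset H h h by exists 1%:M; rewrite mulmx1.
  by rewrite -E => -[k [Hk ->]]; exists k.
move=> [k [Hk ->]]; apply: set_ext => x; split=> -[l [Hl ->]].
  have [Uk Vk] := HV k Hk; exists (invmx k *m l); split; first exact: HM.
  by rewrite -mulmxA mulKVmx.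
by exists (k *m l); split; [exact: HM | rewrite mulmxA].
Qed.

Lemma ptE (g h : G2F) : pt g = pt h <-> inP1g (ginv g · h).
Proof.
have -> : pt g = pt h <-> coset (@inP1 F) g = coset (@inP1 F) h.
  split=> [[//]|E]; congr VP; exact: sub_ext.
rewrite coset_eq; last 1 first.
- move=> x Px; split; first by apply: genby_unit Px; exact: P1gens_unit.
  by apply: genbyV Px; exact: P1gens_unit.
- split=> [[k [Pk E]]|Pk].
    by rewrite /inP1g /= E mulKmx // inG_unit //; exact: gvG.
  exists (ginv g · h); split=> //=.
  by rewrite mulKVmx // inG_unit //; exact: gvG.
- exact: genby1.
- by move=> x y; exact: genbyM.
Qed.

Lemma lnE (g h : G2F) : ln g = ln h <-> inP2g (ginv g · h).
Proof.
have -> : ln g = ln h <-> coset (@inP2 F) g = coset (@inP2 F) h.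
  split=> [[//]|E]; congr VL; exact: sub_ext.
rewrite coset_eq; last 1 first.
- move=> x Px; split; first by apply: genby_unit Px; exact: P2gens_unit.
  by apply: genbyV Px; exact: P2gens_unit.
- split=> [[k [Pk E]]|Pk].
    by rewrite /inP2g /= E mulKmx // inG_unit //; exact: gvG.
  exists (ginv g · h); split=> //=.
  by rewrite mulKVmx // inG_unit //; exact: gvG.
- exact: genby1.
- by move=> x y; exact: genbyM.
Qed.

Lemma pt_mul (g k : G2F) : inP1g k -> pt (g · k) = pt g.
Proof. by move=> Pk; apply/esym/ptE; rewrite gmulA gmulVg gone_mul. Qed.

Lemma ln_mul (g k : G2F) : inP2g k -> ln (g · k) = ln g.
Proof. by move=> Pk; apply/esym/lnE; rewrite gmulA gmulVg gone_mul. Qed.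

Definition img (g : M) (Y : M -> Prop) : M -> Prop :=
  fun x => exists y, Y y /\ x = g *m y.

Lemma img_coset (H : M -> Prop) (g h : M) : img g (coset H h) = coset H (g *m h).
Proof.
apply: set_ext => x; split=> [[y [[k [Hk ->]] ->]]|[k [Hk ->]]].
  by exists k; rewrite mulmxA.
by exists (h *m k); split; [exists k | rewrite mulmxA].
Qed.

Lemma img_img (g h : M) Y : img g (img h Y) = img (g *m h) Y.
Proof.
apply: set_ext => x; split=> [[y [[z [Yz ->]] ->]]|[y [Yy ->]]].
  by exists z; rewrite mulmxA.
by exists (h *m y); split; [exists y | rewrite mulmxA].
Qed.

Lemma img1 Y : img 1%:M Y = Y.
Proof.
apply: set_ext => x; split=> [[y [Yy ->]]|Yx]; first by rewrite mul1mx.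
by exists x; rewrite mul1mx.
Qed.

Lemma img_point (g : G2F) (p : Point F) : isPoint (img g (proj1_sig p)).
Proof.
case: p => [Y [h [Gh E]]] /=; exists (g *m h); split; last by rewrite E img_coset.
by apply: inGM => //; exact: gvG.
Qed.

Lemma img_line (g : G2F) (L : Line F) : isLine (img g (proj1_sig L)).
Proof.
case: L => [Y [h [Gh E]]] /=; exists (g *m h); split; last by rewrite E img_coset.
by apply: inGM => //; exact: gvG.
Qed.

Definition actP (g : G2F) (p : Point F) : Point F := exist _ _ (img_point g p).
Definition actL (g : G2F) (L : Line F) : Line F := exist _ _ (img_line g L).

Lemma actPK g : cancel (actP g) (actP (ginv g)).
Proof.
move=> p; apply: sub_ext => /=; rewrite img_img mulVmx ?img1 //.
by apply: inG_unit; exact: gvG.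
Qed.
Lemma actPVK g : cancel (actP (ginv g)) (actP g).
Proof.
move=> p; apply: sub_ext => /=; rewrite img_img mulmxV ?img1 //.
by apply: inG_unit; exact: gvG.
Qed.
Lemma actLK g : cancel (actL g) (actL (ginv g)).
Proof.
move=> p; apply: sub_ext => /=; rewrite img_img mulVmx ?img1 //.
by apply: inG_unit; exact: gvG.
Qed.
Lemma actLVK g : cancel (actL (ginv g)) (actL g).
Proof.
move=> p; apply: sub_ext => /=; rewrite img_img mulmxV ?img1 //.
by apply: inG_unit; exact: gvG.
Qed.

Lemma act_inc g p L : incident p L -> incident (actP g p) (actL g L).
Proof. by move=> [x [px Lx]]; exists (g *m x); split; exists x. Qed.

Lemma act_incE g p L : incident p L <-> incident (actP g p) (actL g L).
Proof.
split; first exact: act_inc.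
by move/(act_inc (ginv g)); rewrite actPK actLK.
Qed.

Definition act (g : G2F) : collineation F :=
  Coll (Bijective (actPK g) (actPVK g)) (Bijective (actLK g) (actLVK g)) (act_incE g).

Definition cact (th : collineation F) (u : vtx F) : vtx F :=
  match u with VP p => VP (cpt th p) | VL L => VL (cln th L) end.

Definition av (g : G2F) := cact (act g).

Lemma av_pt g h : av g (pt h) = pt (g · h).
Proof. by rewrite /av /= /pt; congr VP; apply: sub_ext; exact: img_coset. Qed.

Lemma av_ln g h : av g (ln h) = ln (g · h).
Proof. by rewrite /av /= /ln; congr VL; apply: sub_ext; exact: img_coset. Qed.

Lemma avM g h u : av g (av h u) = av (g · h) u.
Proof. by case: u => p; rewrite /av /=; [congr VP|congr VL]; apply: sub_ext; exact: img_img. Qed.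

Lemma av1 u : av gone u = u.
Proof. by case: u => p; rewrite /av /=; [congr VP|congr VL]; apply: sub_ext; exact: img1. Qed.

Lemma avK g u : av (ginv g) (av g u) = u.
Proof. by rewrite avM gmulVg av1. Qed.
Lemma avVK g u : av g (av (ginv g) u) = u.
Proof. by rewrite avM gmulV av1. Qed.

Lemma adj_cact th u v : adj (cact th u) (cact th v) <-> adj u v.
Proof. by case: u v => [p|L] [q|N] //=; rewrite -c_inc. Qed.

Lemma cact_inj th : injective (cact th).
Proof.
case=> [p|L] [q|N] //= [E].
  by congr VP; exact: bij_inj (cpt_bij th) _ _ E.
by congr VL; exact: bij_inj (cln_bij th) _ _ E.
Qed.

Lemma av_inj g : injective (av g). Proof. exact: cact_inj. Qed.

Lemma adj_av g u v : adj (av g u) (av g v) <-> adj u v.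
Proof. exact: adj_cact. Qed.

Lemma adj_sym (u v : vtx F) : adj u v <-> adj v u.
Proof. by case: u v => [p|L] [q|N]. Qed.

Lemma adj_pt_ln g h :
  adj (pt g) (ln h) <-> exists k l, inP1g k /\ inP2g l /\ g · k = h · l.
Proof.
split=> [[x [[k [Pk Ek]] [l [Pl El]]]]|[k [l [Pk [Pl E]]]]].
  exists (MkG (inP1_inG Pk)), (MkG (inP2_inG Pl)); split; first exact: Pk.
  by split; [exact: Pl | apply: gext; rewrite /= -Ek -El].
exists (g · k); split; first by exists k.
by rewrite E; exists l.
Qed.

Lemma adj1 : adj (ln gone) (pt gone).
Proof.
apply/adj_sym/adj_pt_ln; exists gone, gone; split; first exact: genby1.
by split; first exact: genby1.
Qed.

End Action.
Arguments av : simpl never.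
Arguments pt : simpl never.
Arguments ln : simpl never.
Arguments gone {F}.
Arguments S1 {F}.
Arguments S2 {F}.
Notation "g · h" := (gmul g h) (at level 40, left associativity).

Lemma gvX (F : fieldType) a (t : F) : gv (X a t) = xr a t.
Proof. by []. Qed.
Lemma gvMv (F : fieldType) (g h : G2F F) (x : 'cV[F]_7) : gv (g · h) *m x = g *m (h *m x).
Proof. by rewrite mulmxA. Qed.

(** * The standard apartment and paths *)

Section Apartment.
Variable F : fieldType.
Implicit Types (a : g2root) (t c d : F) (u v w : vtx F) (g h k l : G2F F).

Lemma w1K a : w1 (w1 a) = a. Proof. by case: a => -[]. Qed.
Lemma w2K a : w2 (w2 a) = a. Proof. by case: a => -[]. Qed.
Lemma sg1K a : sg1 F a * sg1 F a = 1. Proof. by case: a => -[] /=; ring. Qed.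
Lemma sg2K a : sg2 F a * sg2 F a = 1. Proof. by case: a => -[] /=; ring. Qed.

Lemma S1X a t : S1 · X a t = X (w1 a) (sg1 F a * t) · S1.
Proof. by apply: gext; rewrite /= s1_xr. Qed.
Lemma S2X a t : S2 · X a t = X (w2 a) (sg2 F a * t) · S2.
Proof. by apply: gext; rewrite /= s2_xr. Qed.

Lemma XS1 a t : X a t · S1 = S1 · X (w1 a) (sg1 F (w1 a) * t).
Proof. by rewrite S1X w1K mulrA sg1K mul1r. Qed.
Lemma XS2 a t : X a t · S2 = S2 · X (w2 a) (sg2 F (w2 a) * t).
Proof. by rewrite S2X w2K mulrA sg2K mul1r. Qed.

Lemma XD a t t' : X a t · X a t' = X a (t + t').
Proof. by apply: gext; rewrite /= xrD. Qed.
Lemma X0 a : X a 0 = gone :> G2F F.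
Proof. by apply: gext; rewrite /= xr0. Qed.
Lemma ginvX a t : ginv (X a t) = X a (- t).
Proof. by apply: gext; rewrite /= invmx_xr. Qed.

Lemma HX a t c d (c0 : c != 0) (d0 : d != 0) :
  H c0 d0 · X a t = X a (chi a c d * t) · H c0 d0.
Proof. by apply: gext; rewrite /= torus_xr. Qed.

Lemma N1_neq0 : -1 != 0 :> F. Proof. by rewrite oppr_eq0 oner_eq0. Qed.

Lemma S1S1 : S1 · S1 = H (oner_neq0 F) N1_neq0.
Proof. by apply: gext; exact: s1_sq. Qed.
Lemma S2S2 : S2 · S2 = H N1_neq0 (oner_neq0 F).
Proof. by apply: gext; exact: s2_sq. Qed.

Lemma HS1 c d (c0 : c != 0) (d0 : d != 0) :
  exists c' d' (c0' : c' != 0) (d0' : d' != 0), H c0 d0 · S1 = S1 · H c0' d0'.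
Proof.
have e0 : c ^+ 3 * d != 0 by rewrite mulf_neq0 ?expf_neq0.
have c1 : c^-1 != 0 by rewrite invr_eq0.
exists c^-1, (c ^+ 3 * d), c1, e0; apply: gext; rewrite /= s1_torus ?invr_eq0 // invrK.
by congr (torus _ _ *m _); field; rewrite ?c0.
Qed.
Lemma HS2 c d (c0 : c != 0) (d0 : d != 0) :
  exists c' d' (c0' : c' != 0) (d0' : d' != 0), H c0 d0 · S2 = S2 · H c0' d0'.
Proof.
have e0 : c * d != 0 by rewrite mulf_neq0.
have d1 : d^-1 != 0 by rewrite invr_eq0.
exists (c * d), d^-1, e0, d1; apply: gext; rewrite /= s2_torus ?invr_eq0 // invrK.
by congr (torus _ _ *m _); field; rewrite ?d0.
Qed.

Lemma P1X r t : inP1g (X (Pos r) t : G2F F). Proof. exact: inP1_pos. Qed.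
Lemma P2X r t : inP2g (X (Pos r) t : G2F F). Proof. exact: inP2_pos. Qed.
Lemma P1N t : inP1g (X (Neg R1) t : G2F F). Proof. exact: inP1_neg. Qed.
Lemma P2N t : inP2g (X (Neg R2) t : G2F F). Proof. exact: inP2_neg. Qed.
Lemma P1H c d (c0 : c != 0) (d0 : d != 0) : inP1g (H c0 d0).
Proof. exact: inP1_torus. Qed.
Lemma P2H c d (c0 : c != 0) (d0 : d != 0) : inP2g (H c0 d0).
Proof. exact: inP2_torus. Qed.
Lemma P1S1 : inP1g (S1 : G2F F). Proof. exact: inP1_s1. Qed.
Lemma P2S2 : inP2g (S2 : G2F F). Proof. exact: inP2_s2. Qed.

Lemma avX_pt1 r t : av (X (Pos r) t) (pt gone) = pt (gone : G2F F).
Proof. by rewrite av_pt gmul1 -[X _ _]gone_mul pt_mul //; exact: P1X. Qed.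
Lemma avX_ln1 r t : av (X (Pos r) t) (ln gone) = ln (gone : G2F F).
Proof. by rewrite av_ln gmul1 -[X _ _]gone_mul ln_mul //; exact: P2X. Qed.

Lemma B_stab (Q : vtx F -> Prop) :
  (forall r t w, Q w -> Q (av (X (Pos r) t) w)) ->
  (forall c d (c0 : c != 0) (d0 : d != 0) w, Q w -> Q (av (H c0 d0) w)) ->
  forall g, Bgens (gv g) -> forall w, Q w -> Q (av g w) /\ Q (av (ginv g) w).
Proof.
move=> QX QH g [[a [t [+ E]]]|[c [d [c0 [d0 E]]]]] w Qw.
  case: a E => // r E _.
  by rewrite (_ : g = X (Pos r) t) ?ginvX; [split; exact: QX | exact: gext].
rewrite (_ : g = H c0 d0); last exact: gext.
have c1 : c^-1 != 0 by rewrite invr_eq0.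
have d1 : d^-1 != 0 by rewrite invr_eq0.
rewrite (_ : ginv _ = H c1 d1); first by split; exact: QH.
by apply: gext; rewrite /= invmx_torus.
Qed.

Lemma ginvS1 : ginv S1 = S1 · H (oner_neq0 F) N1_neq0.
Proof.
apply: gext; rewrite /= -[RHS](mulKmx (s1_unit F)).
by rewrite (mulmxA (s1 F)) s1_sq torusM mulr1 mulrNN mulr1 torus11 mulmx1.
Qed.
Lemma ginvS2 : ginv S2 = S2 · H N1_neq0 (oner_neq0 F).
Proof.
apply: gext; rewrite /= -[RHS](mulKmx (s2_unit F)).
by rewrite (mulmxA (s2 F)) s2_sq torusM mulr1 mulrNN mulr1 torus11 mulmx1.
Qed.

(** Induction on a word of generators. Each suffix must itself lie in the group in order to act on
    vertices, hence the premise on the letters. *)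
Lemma P_stab (S : M7 F -> Prop) (Q : vtx F -> Prop) :
  (forall y, S y -> inG y) ->
  (forall g, S (gv g) -> forall w, Q w -> Q (av g w) /\ Q (av (ginv g) w)) ->
  forall g, genby S (gv g) -> forall w, Q w -> Q (av g w).
Proof.
move=> SG HS [g Gg] /= Pg; move: g Pg Gg.
refine (@genby_ind F S (fun g : M7 F => forall (Gg : inG g) w, Q w -> Q (av (MkG Gg) w)) _ _ _).
- by move=> Gg w Qw; rewrite (_ : MkG Gg = gone) ?av1 //; exact: gext.
- move=> y h Sy IH Gg w Qw.
  have Gy := SG _ Sy; have Gh : inG h.
    by rewrite -[h](mulKmx (inG_unit Gy)); apply: inGM => //; exact: inGV.
  rewrite (_ : MkG Gg = MkG Gy · MkG Gh); last exact: gext.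
  by rewrite -avM; apply: (proj1 (HS (MkG Gy) Sy _ (IH Gh _ Qw))).
- move=> y h Sy IH Gg w Qw.
  have Gy := SG _ Sy; have Gh : inG h.
    by rewrite -[h](mulKVmx (inG_unit Gy)); apply: inGM.
  rewrite (_ : MkG Gg = ginv (MkG Gy) · MkG Gh); last exact: gext.
  by rewrite -avM; apply: (proj2 (HS (MkG Gy) Sy _ (IH Gh _ Qw))).
Qed.

(** The inverse of [S1] is [S1] times a torus element, so that no separate premise about the inverse
    is called for. *)
Lemma P1_stab (Q : vtx F -> Prop) :
  (forall r t w, Q w -> Q (av (X (Pos r) t) w)) ->
  (forall c d (c0 : c != 0) (d0 : d != 0) w, Q w -> Q (av (H c0 d0) w)) ->
  (forall w, Q w -> Q (av S1 w)) ->
  forall g, inP1g g -> forall w, Q w -> Q (av g w).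
Proof.
move=> QX QH QS; apply: P_stab => [y [/Bgens_inG //|->]|g [Bg|E] w Qw].
- exact: inG_s1.
- exact: (B_stab QX QH Bg).
- rewrite (_ : g = S1); last exact: gext.
  by rewrite ginvS1 -avM; split; apply: QS => //; apply: QH.
Qed.

Lemma P2_stab (Q : vtx F -> Prop) :
  (forall r t w, Q w -> Q (av (X (Pos r) t) w)) ->
  (forall c d (c0 : c != 0) (d0 : d != 0) w, Q w -> Q (av (H c0 d0) w)) ->
  (forall w, Q w -> Q (av S2 w)) ->
  forall g, inP2g g -> forall w, Q w -> Q (av g w).
Proof.
move=> QX QH QS; apply: P_stab => [y [/Bgens_inG //|->]|g [Bg|E] w Qw].
- exact: inG_s2.
- exact: (B_stab QX QH Bg).
- rewrite (_ : g = S2); last exact: gext.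
  by rewrite ginvS2 -avM; split; apply: QS => //; apply: QH.
Qed.

Lemma avX_ptS2 r t : r <> R2 -> av (X (Pos r) t) (pt S2) = pt (S2 : G2F F).
Proof.
by move=> r2; rewrite av_pt XS2 pt_mul //; case: r r2 => //= _; exact: P1X.
Qed.
Lemma avX_lnS1 r t : r <> R1 -> av (X (Pos r) t) (ln S1) = ln (S1 : G2F F).
Proof.
by move=> r1; rewrite av_ln XS1 ln_mul //; case: r r1 => //= _; exact: P2X.
Qed.

(** The unipotent radical of [P2] acts trivially on the points of the base line: after the
    commutator formula, each factor to the right of [X alpha2 t'] belongs to a positive root other
    than [alpha2] and fixes [pt S2]. *)
Lemma avX_ptS2' r t t' : r <> R2 ->
  av (X (Pos r) t) (av (X alpha2 t') (pt S2)) = av (X alpha2 t') (pt S2).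
Proof.
move=> r2; rewrite avM; case: r r2 => //= _.
- rewrite (_ : _ · _ = X alpha2 t' · X (Pos R1) t · X (Pos R12) (t' * t)
    · X (Pos R112) (- (t' * t ^+ 2)) · X (Pos R1112) (t' * t ^+ 3)
    · X (Pos R11122) (- (2 * t' ^+ 2 * t ^+ 3)));
    last by apply: gext; exact: comm_2_1.
  by move: (X alpha2 t') => Y; rewrite -?avM ?avX_ptS2.
- rewrite (_ : _ · _ = X alpha2 t' · X (Pos R12) t);
    last by apply: gext; exact: comm_2_12.
  by move: (X alpha2 t') => Y; rewrite -?avM ?avX_ptS2.
- rewrite (_ : _ · _ = X alpha2 t' · X (Pos R112) t);
    last by apply: gext; exact: comm_2_112.
  by move: (X alpha2 t') => Y; rewrite -?avM ?avX_ptS2.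
- rewrite (_ : _ · _ = X alpha2 t' · X (Pos R1112) t · X (Pos R11122) (- (t' * t)));
    last by apply: gext; exact: comm_2_1112.
  by move: (X alpha2 t') => Y; rewrite -?avM ?avX_ptS2.
- rewrite (_ : _ · _ = X alpha2 t' · X (Pos R11122) t);
    last by apply: gext; exact: comm_2_11122.
  by move: (X alpha2 t') => Y; rewrite -?avM ?avX_ptS2.
Qed.

Lemma avX_lnS1' r t t' : r <> R1 ->
  av (X (Pos r) t) (av (X alpha1 t') (ln S1)) = av (X alpha1 t') (ln S1).
Proof.
move=> r1; rewrite avM; case: r r1 => //= _.
- rewrite (_ : _ · _ = X alpha1 t' · X (Pos R2) t · X (Pos R12) (- (t' * t))
    · X (Pos R112) (t' ^+ 2 * t) · X (Pos R1112) (- (t' ^+ 3 * t))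
    · X (Pos R11122) (- (t' ^+ 3 * t ^+ 2)));
    last by apply: gext; exact: comm_12.
  by move: (X alpha1 t') => Y; rewrite -?avM ?avX_lnS1.
- rewrite (_ : _ · _ = X alpha1 t' · X (Pos R12) t · X (Pos R112) (- (2 * t' * t))
    · X (Pos R11122) (- (3 * t' * t ^+ 2)) · X (Pos R1112) (3 * t' ^+ 2 * t));
    last by apply: gext; exact: comm_1_12.
  by move: (X alpha1 t') => Y; rewrite -?avM ?avX_lnS1.
- rewrite (_ : _ · _ = X alpha1 t' · X (Pos R112) t · X (Pos R1112) (- (3 * t' * t)));
    last by apply: gext; exact: comm_1_112.
  by move: (X alpha1 t') => Y; rewrite -?avM ?avX_lnS1.
- rewrite (_ : _ · _ = X alpha1 t' · X (Pos R1112) t);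
    last by apply: gext; exact: comm_1_1112.
  by move: (X alpha1 t') => Y; rewrite -?avM ?avX_lnS1.
- rewrite (_ : _ · _ = X alpha1 t' · X (Pos R11122) t);
    last by apply: gext; exact: comm_1_11122.
  by move: (X alpha1 t') => Y; rewrite -?avM ?avX_lnS1.
Qed.

Lemma avH_pt1 c d (c0 : c != 0) (d0 : d != 0) : av (H c0 d0) (pt gone) = pt gone.
Proof. by rewrite av_pt gmul1 -[H _ _]gone_mul pt_mul //; exact: P1H. Qed.
Lemma avH_ln1 c d (c0 : c != 0) (d0 : d != 0) : av (H c0 d0) (ln gone) = ln gone.
Proof. by rewrite av_ln gmul1 -[H _ _]gone_mul ln_mul //; exact: P2H. Qed.
Lemma avH_ptS2 c d (c0 : c != 0) (d0 : d != 0) : av (H c0 d0) (pt S2) = pt S2.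
Proof.
have [c' [d' [c0' [d0' E]]]] := HS2 c0 d0.
by rewrite av_pt E pt_mul //; exact: P1H.
Qed.
Lemma avH_lnS1 c d (c0 : c != 0) (d0 : d != 0) : av (H c0 d0) (ln S1) = ln S1.
Proof.
have [c' [d' [c0' [d0' E]]]] := HS1 c0 d0.
by rewrite av_ln E ln_mul //; exact: P2H.
Qed.

(** The decomposition of [P2] into [B] and [B s2 B], read on points: the listed set contains the
    base point and is stable under [P2], which is transitive on the points of the base line. *)
Lemma nbr_ln1 w : adj (ln gone) w ->
  w = pt gone \/ exists t, w = av (X alpha2 t) (pt S2).
Proof.
have [g [->|->]] := vtx_rep w; last by [].
move=> /adj_sym/adj_pt_ln[k [l [Pk [Pl E]]]].
rewrite -(pt_mul _ Pk) E.
pose Q w := w = pt gone \/ exists t, w = av (X alpha2 t) (pt S2).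
suff: Q (av l (pt gone)) by rewrite av_pt gone_mul gmul1.
apply: P2_stab Pl _ _; last by left.
- move=> r t v [->|[t' ->]]; first by left; exact: avX_pt1.
  right; have [->|r2] : r = R2 \/ r <> R2 by case: (r); auto; right.
    by exists (t + t'); rewrite avM XD.
  by exists t'; exact: avX_ptS2'.
- move=> c d c0 d0 v [->|[t ->]]; first by left; exact: avH_pt1.
  by right; eexists; rewrite avM HX -avM avH_ptS2.
- move=> v [->|[t ->]]; first by right; exists 0; rewrite X0 av1 av_pt gmul1.
  have [->|t0] := eqVneq t 0.
    by left; rewrite X0 av1 av_pt S2S2 -[H _ _]gmul1 -av_pt avH_pt1.
  (* On the projective line of these points, [S2] sends the parameter [t] to its negative
     inverse. *)
  right; exists (- t^-1); have t2 : t ^+ 2 != 0 by rewrite expf_neq0.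
  have tV : - t^-1 != 0 by rewrite oppr_eq0 invr_eq0.
  rewrite !av_pt gmulA (_ : S2 · _ · _ = X alpha2 (- t^-1) · S2 · H tV t2 · X alpha2 (- t^-1)).
    by rewrite 2?pt_mul //; [exact: P1H | exact: P1X].
  by apply: gext; exact: s2_rank1.
Qed.

Lemma nbr_pt1 w : adj (pt gone) w ->
  w = ln gone \/ exists t, w = av (X alpha1 t) (ln S1).
Proof.
have [g [->|->]] := vtx_rep w; first by [].
move=> /adj_pt_ln[k [l [Pk [Pl E]]]].
rewrite -(ln_mul _ Pl) -E.
pose Q w := w = ln gone \/ exists t, w = av (X alpha1 t) (ln S1).
suff: Q (av k (ln gone)) by rewrite av_ln gone_mul gmul1.
apply: P1_stab Pk _ _; last by left.
- move=> r t v [->|[t' ->]]; first by left; exact: avX_ln1.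
  right; have [->|r1] : r = R1 \/ r <> R1 by case: (r); auto; right.
    by exists (t + t'); rewrite avM XD.
  by exists t'; exact: avX_lnS1'.
- move=> c d c0 d0 v [->|[t ->]]; first by left; exact: avH_ln1.
  by right; eexists; rewrite avM HX -avM avH_lnS1.
- move=> v [->|[t ->]]; first by right; exists 0; rewrite X0 av1 av_ln gmul1.
  have [->|t0] := eqVneq t 0.
    by left; rewrite X0 av1 av_ln S1S1 -[H _ _]gmul1 -av_ln avH_ln1.
  right; exists (- t^-1); have t2 : t ^+ 2 != 0 by rewrite expf_neq0.
  have tV : - t ^- 3 != 0 by rewrite oppr_eq0 invr_eq0 expf_neq0.
  rewrite !av_ln gmulA (_ : S1 · _ · _ = X alpha1 (- t^-1) · S1 · H t2 tV · X alpha1 (- t^-1)).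
    by rewrite 2?ln_mul //; [exact: P2H | exact: P2X].
  by apply: gext; exact: s1_rank1.
Qed.

End Apartment.

(** * Root groups along the apartment and transport of paths *)

Section Paths.
Variable F : fieldType.
Implicit Types (a : g2root) (t c d : F) (u v w : vtx F) (g h k l : G2F F).

(** A Coxeter element. Its order is the Coxeter number 6, and it turns the apartment by two
    places. *)
Definition rot : G2F F := S1 · S2.
Definition rotn j : G2F F := iter j (gmul rot) gone.
(* The standard apartment, a 12-cycle with the lines at the even places. *)
Definition ap i : vtx F := av (rotn i./2) (if odd i then pt gone else ln gone).

Lemma ap0 : ap 0 = ln gone. Proof. exact: av1. Qed.
Lemma ap1 : ap 1 = pt gone. Proof. exact: av1. Qed.
Lemma apSS i : ap i.+2 = av rot (ap i).
Proof. by rewrite /ap /= negbK avM. Qed.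

Lemma rot6 : rotn 6 = gone.
Proof.
apply: gext; apply: mx_ext => x0 x1 x2 x3 x4 x5 x6.
have E j (v : 'cV[F]_7) : gv (rotn j.+1) *m v = s1 F *m (s2 F *m (gv (rotn j) *m v)).
  by rewrite /= -!mulmxA.
by rewrite !E /= !mul1mx !(s1_vec, s2_vec); congr vec; ring.
Qed.

Lemma ap12 i : ap (i + 12) = ap i.
Proof.
rewrite addnC; do 6!rewrite addSn addSn apSS.
by rewrite add0n; move: (ap i) => v; rewrite !avM -[in RHS](av1 v) -rot6 /= gmul1 !gmulA.
Qed.

Lemma rotX a t : exists t', X a t · rot = rot · X (w2 (w1 a)) t'.
Proof.
rewrite /rot gmulA XS1 -gmulA XS2.
by eexists; rewrite gmulA.
Qed.
Lemma Xrot a t : exists t', rot · X a t = X (w1 (w2 a)) t' · rot.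
Proof.
rewrite /rot -gmulA S2X gmulA S1X.
by eexists; rewrite gmulA.
Qed.

(** Tests whether the root group of [a] lies in the parabolic of [ap i], by turning back with the
    Coxeter element to the base line or base point. For each root the test succeeds on a
    half-apartment of seven vertices. *)
Fixpoint fixap a i : bool :=
  match i with
  | 0 => is_positive a || (if a is Neg R2 then true else false)
  | 1 => is_positive a || (if a is Neg R1 then true else false)
  | i'.+2 => fixap (w2 (w1 a)) i'
  end.

Lemma fixapP a i t : fixap a i -> av (X a t) (ap i) = ap i.
Proof.
elim/ltn_ind: i a t => -[|[|i]] IH a t /=.
- rewrite ap0; case: a => // r; first by rewrite avX_ln1.
  by case: r => // _; rewrite av_ln gmul1 -[X _ _]gone_mul ln_mul //; exact: P2N.
- rewrite ap1; case: a => // r; first by rewrite avX_pt1.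
  by case: r => // _; rewrite av_pt gmul1 -[X _ _]gone_mul pt_mul //; exact: P1N.
- by move=> fa; have [t' E] := rotX a t; rewrite apSS avM E -avM IH.
Qed.

(* [gf i] moves the neighbours of [ap i] other than its predecessor;
   [gb i] those other than its successor. *)
Fixpoint gf i : g2root :=
  match i with 0 => Neg R2 | 1 => Pos R1 | i'.+2 => w1 (w2 (gf i')) end.
Fixpoint gb i : g2root :=
  match i with 0 => Pos R2 | 1 => Neg R1 | i'.+2 => w1 (w2 (gb i')) end.

Lemma ap11 : ap 11 = pt S2.
Proof.
apply: (@av_inj _ rot); rewrite -apSS (ap12 1) ap1 av_pt /rot -gmulA S2S2.
rewrite pt_mul; last exact: P1H.
by rewrite -[S1]gone_mul pt_mul //; exact: P1S1.
Qed.

Lemma ap2 : ap 2 = ln S1.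
Proof. by rewrite apSS ap0 av_ln gmul1 ln_mul //; exact: P2S2. Qed.

Lemma nbrb i w : adj (ap i) w ->
  w = ap i.+1 \/ exists t, w = av (X (gb i) t) (ap (i + 11)).
Proof.
elim/ltn_ind: i w => -[|[|i]] IH w.
- by rewrite ap0 ap1 add0n ap11; exact: nbr_ln1.
(* [nbr_pt1] singles out [ap 0] among the neighbours of the base point. Exchanging [ap 0] and [ap 2]
   by [S1] singles out [ap 2] instead. *)
- have S1ap2 : av S1 (ap 2) = ln gone.
    by rewrite ap2 av_ln S1S1 -[H _ _]gmul1 -av_ln avH_ln1.
  have S1pt : av S1 (pt gone) = pt (gone : G2F F).
    by rewrite av_pt gmul1 -[S1]gone_mul pt_mul //; exact: P1S1.
  rewrite ap1 (ap12 0) ap0 => A.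
  have : adj (pt gone) (av S1 w) by rewrite -S1pt adj_av.
  case/nbr_pt1 => [E|[t E]]; [left|right].
    by apply: (@av_inj _ S1); rewrite S1ap2.
  exists (sg1 F (Neg R1) * t); apply: (@av_inj _ S1); rewrite E avM S1X mulrA sg1K mul1r.
  by rewrite -avM [av S1 _]av_ln gmul1.
- rewrite apSS => A.
  have : adj (ap i) (av (ginv rot) w) by rewrite -(adj_av rot) avVK.
  case/IH => // [|[t]] /(congr1 (av rot)); rewrite avVK => ->; [left|right].
    by rewrite -apSS.
  by have [t' E] := Xrot (gb i) t; exists t'; rewrite avM E -avM -apSS.
Qed.

Lemma nbrf i w : adj (ap i) w ->
  w = ap (i + 11) \/ exists t, w = av (X (gf i) t) (ap i.+1).
Proof.
elim/ltn_ind: i w => -[|[|i]] IH w.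
- have S2ap11 : av S2 (pt S2) = pt (gone : G2F F).
    by rewrite av_pt S2S2 -[H _ _]gmul1 -av_pt avH_pt1.
  have S2ln : av S2 (ln gone) = ln (gone : G2F F).
    by rewrite av_ln gmul1 -[S2]gone_mul ln_mul //; exact: P2S2.
  rewrite ap1 ap0 add0n ap11 => A.
  have : adj (ln gone) (av S2 w) by rewrite -S2ln adj_av.
  case/nbr_ln1 => [E|[t E]]; [left|right].
    by apply: (@av_inj _ S2); rewrite S2ap11.
  exists (sg2 F (Neg R2) * t); apply: (@av_inj _ S2); rewrite E avM S2X mulrA sg2K mul1r.
  by rewrite -avM [av S2 _]av_pt gmul1.
- by rewrite ap1 (ap12 0) ap0 ap2; exact: nbr_pt1.
- rewrite apSS => A.
  have : adj (ap i) (av (ginv rot) w) by rewrite -(adj_av rot) avVK.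
  case/IH => // [|[t]] /(congr1 (av rot)); rewrite avVK => ->; [left|right].
    by rewrite -apSS.
  by have [t' E] := Xrot (gf i) t; exists t'; rewrite avM E -avM -apSS.
Qed.

Lemma adj_ap i : adj (ap i) (ap i.+1).
Proof.
elim/ltn_ind: i => -[|[|i]] IH.
- by rewrite ap0 ap1; exact: adj1.
- rewrite ap1 ap2 -[pt gone](@pt_mul F gone S1); last exact: P1S1.
  by rewrite gone_mul -[S1]gmul1 -av_pt -av_ln adj_av; apply/adj_sym; exact: adj1.
- by rewrite !apSS adj_av; exact: IH.
Qed.

Definition nspath (p : nat -> vtx F) n :=
  (forall i, (i < n)%N -> adj (p i) (p i.+1)) /\
  (forall i, (i.+1 < n)%N -> p i <> p i.+2).

Lemma nspath_le p m n : (m <= n)%N -> nspath p n -> nspath p m.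
Proof.
by move=> mn [A B]; split=> i im; [apply: A | apply: B]; exact: leq_trans im mn.
Qed.

(** The root group of [gf n] fixes [ap 0] to [ap n] and moves the continuations of the path
    transitively. The bound 7 is reached when the fixed vertices fill a whole half-apartment. *)
Lemma transit_ln p n h : nspath p n -> (n <= 7)%N -> p 0 = ln h ->
  exists g, forall i, (i <= n)%N -> p i = av g (ap i).
Proof.
move=> + + p0; elim: n => [|n IH] np n7.
  by exists h => -[|//] _; rewrite ap0 av_ln gmul1.
have [g Eg] := IH (nspath_le (leqnSn n) np) (ltnW n7).
case: np => A B; have := A n (ltnSn n).
rewrite (Eg n) // -(adj_av (ginv g)) avK => /nbrf; set w := av (ginv g) _.
have Ew : p n.+1 = av g w by rewrite avVK.
have FX t i : (i <= n)%N -> av (X (gf n) t) (ap i) = ap i.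
  move=> ni; apply: fixapP; move: ni n7; clear.
  by do 7?[case: n => [|n]]; do 7?[case: i => [|i]].
have fwd t : w = av (X (gf n) t) (ap n.+1) ->
    exists g, forall i, (i <= n.+1)%N -> p i = av g (ap i).
  move=> E; exists (g · X (gf n) t) => i; rewrite leq_eqVlt => /orP[/eqP ->|ni].
    by rewrite -avM -E.
  by rewrite -avM FX // Eg.
case=> [E|[t]]; last exact: fwd.
(* The neighbour missed by the root group is the predecessor, excluded on a non-stammering path. The
   first step has no predecessor: there [S2], which exchanges [ap 1] and [ap 11], replaces the root
   element. *)
clearbody w; clear IH FX fwd; case: n => [|n] in n7 A B Eg Ew E *.
  exists (g · S2) => -[|[|//]] _; rewrite -avM.
    by rewrite ap0 av_ln gmul1 -[S2]gone_mul ln_mul -?ap0 ?Eg //; exact: P2S2.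
  by rewrite ap1 av_pt gmul1 -ap11 Ew E.
case: (B n); first by [].
by rewrite Eg // Ew E addSnnS ap12.
Qed.

(** The apartment is walked downwards with [gb]. Counting down from 13, another index of the base
    point, keeps the truncated subtraction away from 0. *)
Lemma transit_pt p n h : nspath p n -> (n <= 7)%N -> p 0 = pt h ->
  exists g, forall i, (i <= n)%N -> p i = av g (ap (13 - i)).
Proof.
move=> + + p0; elim: n => [|n IH] np n7.
  by exists h => -[|//] _; rewrite subn0 (ap12 1) ap1 av_pt gmul1.
have [g Eg] := IH (nspath_le (leqnSn n) np) (ltnW n7).
case: np => A B; have := A n (ltnSn n).
rewrite (Eg n) // -(adj_av (ginv g)) avK => /nbrb; set w := av (ginv g) _.
have Ew : p n.+1 = av g w by rewrite avVK.
have -> : (13 - n + 11 = 13 - n.+1 + 12)%N.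
  by lia.
rewrite ap12.
have FX t i : (i <= n)%N -> av (X (gb (13 - n)) t) (ap (13 - i)) = ap (13 - i).
  move=> ni; apply: fixapP; move: ni n7; clear.
  by do 7?[case: n => [|n]]; do 7?[case: i => [|i]].
have fwd t : w = av (X (gb (13 - n)) t) (ap (13 - n.+1)) ->
    exists g, forall i, (i <= n.+1)%N -> p i = av g (ap (13 - i)).
  move=> E; exists (g · X (gb (13 - n)) t) => i; rewrite leq_eqVlt => /orP[/eqP ->|ni].
    by rewrite -avM -E.
  by rewrite -avM FX // Eg.
case=> [E|[t]]; last exact: fwd.
clearbody w; clear IH FX fwd; case: n => [|n] in n7 A B Eg Ew E *.
  have S1pt : av S1 (pt gone) = pt (gone : G2F F).
    by rewrite av_pt gmul1 -[S1]gone_mul pt_mul //; exact: P1S1.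
  exists (g · S1) => -[|[|//]] _; rewrite -avM.
    by rewrite (ap12 1) ap1 S1pt (Eg 0%N) // (ap12 1) ap1.
  by rewrite (ap12 0) ap0 av_ln gmul1 -ap2 Ew E (ap12 2).
case: (B n); first by [].
rewrite Eg // Ew E; congr (av g (ap _)); lia.
Qed.

End Paths.

(** * Flags of the 7-dimensional module *)

Section Flags.
Variable F : fieldType.
Implicit Types (t a b c d : F) (u v w : vtx F) (g h k l : G2F F).
Implicit Types (V : 'cV[F]_7 -> Prop).

(* As subspaces, [ln g] is spanned by [g *m e0] and [pt g] by [g *m e0] and
   [g *m e1]. *)
Definition e0 : 'cV[F]_7 := vec 1 0 0 0 0 0 0.
Definition e1 : 'cV[F]_7 := vec 0 1 0 0 0 0 0.

Lemma vec_inj (x0 x1 x2 x3 x4 x5 x6 y0 y1 y2 y3 y4 y5 y6 : F) :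
  vec x0 x1 x2 x3 x4 x5 x6 = vec y0 y1 y2 y3 y4 y5 y6 ->
  [/\ x0 = y0, x1 = y1, x2 = y2 & x3 = y3] /\ [/\ x4 = y4, x5 = y5 & x6 = y6].
Proof.
move=> E; split; split.
all: [> move/colP/(_ (inord 0)): E | move/colP/(_ (inord 1)): E
  | move/colP/(_ (inord 2)): E | move/colP/(_ (inord 3)): E | move/colP/(_ (inord 4)): E
  | move/colP/(_ (inord 5)): E | move/colP/(_ (inord 6)): E].
all: by rewrite !mxE inordK.
Qed.

Lemma vec_lin c d (x0 x1 x2 x3 x4 x5 x6 y0 y1 y2 y3 y4 y5 y6 : F) :
  c *: vec x0 x1 x2 x3 x4 x5 x6 + d *: vec y0 y1 y2 y3 y4 y5 y6 =
  vec (c * x0 + d * y0) (c * x1 + d * y1) (c * x2 + d * y2) (c * x3 + d * y3)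
      (c * x4 + d * y4) (c * x5 + d * y5) (c * x6 + d * y6).
Proof.
by apply/colP => i; rewrite !mxE; case: i => [[|[|[|[|[|[|[|//]]]]]]] Hi].
Qed.

Definition lin V := forall c d x y, V x -> V y -> V (c *: x + d *: y).

Lemma gen_stabV (S : M7 F -> Prop) V :
  (forall m : M7 F, S m -> forall x, V x -> V (m *m x) /\ V (invmx m *m x)) ->
  forall k, genby S k -> forall x, V x -> V (k *m x).
Proof.
move=> HS k; apply: (genby_ind (P := fun k : M7 F => forall x, V x -> V (k *m x))).
- by move=> x; rewrite mul1mx.
- by move=> m h Sm IH x Vx; rewrite -mulmxA; case: (HS m Sm _ (IH _ Vx)).
- by move=> m h Sm IH x Vx; rewrite -mulmxA; case: (HS m Sm _ (IH _ Vx)).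
Qed.

Section Stab.
Variable V : 'cV[F]_7 -> Prop.
Hypothesis VX : forall r t x, V x -> V (xr (Pos r) t *m x).
Hypothesis VH : forall c d x, c != 0 -> d != 0 -> V x -> V (torus c d *m x).

Lemma B_stabV (m : M7 F) : Bgens m -> forall x, V x -> V (m *m x) /\ V (invmx m *m x).
Proof.
case=> [[a [t [+ ->]]]|[c [d [c0 [d0 ->]]]]] => [|x Vx].
  by case: a => // r _ x Vx; rewrite invmx_xr; split; apply: VX.
by rewrite invmx_torus //; split; apply: VH; rewrite ?invr_eq0.
Qed.

Lemma P1_stabV : (forall x, V x -> V (s1 F *m x)) ->
  forall k, inP1 k -> forall x, V x -> V (k *m x).
Proof.
move=> VS; apply: gen_stabV => m [|-> x Vx]; first exact: B_stabV.
have /(congr1 (@gv F))/= -> := ginvS1 F.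
rewrite -(mulmxA (s1 F)); split; apply: VS => //; apply: VH => //; first exact: oner_neq0.
exact: N1_neq0.
Qed.

Lemma P2_stabV : (forall x, V x -> V (s2 F *m x)) ->
  forall k, inP2 k -> forall x, V x -> V (k *m x).
Proof.
move=> VS; apply: gen_stabV => m [|-> x Vx]; first exact: B_stabV.
have /(congr1 (@gv F))/= -> := ginvS2 F.
rewrite -(mulmxA (s2 F)); split; apply: VS => //; apply: VH => //; last exact: oner_neq0.
exact: N1_neq0.
Qed.
End Stab.

(** [V0], [V1] and [V2], of dimension 1, 3 and 6, are stabilised by [P2] and [V01] by [P1]. Among
    the lines of the apartment the first three contain those at distance at most 0, 2 and 4 from the
    base line; [V1] and [V2] contain the points at distance at most 1 and 3. *)
Definition V0 x := exists x0 : F, x = vec x0 0 0 0 0 0 0.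
Definition V01 x := exists x0 x1 : F, x = vec x0 x1 0 0 0 0 0.
Definition V1 x := exists x0 x1 x2 : F, x = vec x0 x1 x2 0 0 0 0.
Definition V2 x := exists x0 x1 x2 x3 x4 x5 : F, x = vec x0 x1 x2 x3 x4 x5 0.

Ltac Vtac := rewrite ?(xr_vec, s1_vec, s2_vec); do ?eexists;
  congr vec; first [reflexivity | ring].

Lemma P2_V0 k : inP2g k -> forall x, V0 x -> V0 (k *m x).
Proof.
apply: P2_stabV => [r t _ [x0 ->]|c d _ _ _ [x0 ->]|_ [x0 ->]].
- by case: r; Vtac.
- by Vtac.
- by Vtac.
Qed.

Lemma P1_V01 k : inP1g k -> forall x, V01 x -> V01 (k *m x).
Proof.
apply: P1_stabV => [r t _ [x0 [x1 ->]]|c d _ _ _ [x0 [x1 ->]]|_ [x0 [x1 ->]]].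
- by case: r; Vtac.
- by Vtac.
- by Vtac.
Qed.

Lemma P2_V1 k : inP2g k -> forall x, V1 x -> V1 (k *m x).
Proof.
apply: P2_stabV => [r t _ [x0 [x1 [x2 ->]]]|c d _ _ _ [x0 [x1 [x2 ->]]]|_ [x0 [x1 [x2 ->]]]].
- by case: r; Vtac.
- by Vtac.
- by Vtac.
Qed.

Lemma P2_V2 k : inP2g k -> forall x, V2 x -> V2 (k *m x).
Proof.
apply: P2_stabV => [r t _|c d _ _ _|_] [x0 [x1 [x2 [x3 [x4 [x5 ->]]]]]].
- by case: r; Vtac.
- by Vtac.
- by Vtac.
Qed.

Lemma vec_lin1 c (x0 x1 x2 x3 x4 x5 x6 : F) :
  c *: vec x0 x1 x2 x3 x4 x5 x6 =
  vec (c * x0) (c * x1) (c * x2) (c * x3) (c * x4) (c * x5) (c * x6).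
Proof.
by apply/colP => i; rewrite !mxE; case: i => [[|[|[|[|[|[|[|//]]]]]]] Hi].
Qed.

Lemma P2_e0 k : inP2g k -> exists2 c, c != 0 & k *m e0 = c *: e0.
Proof.
move=> Pk; have [|c E] := P2_V0 Pk (x := e0); first by exists 1.
exists c; last by rewrite E /e0 vec_lin1; congr vec; ring.
apply/eqP => c0; have := mulKmx (inG_unit (gvG k)) e0.
rewrite E c0 (_ : vec 0 0 0 0 0 0 0 = 0); last first.
  by apply/colP => i; rewrite !mxE; case: i => [[|[|[|[|[|[|[|//]]]]]]] Hi].
rewrite mulmx0 => /colP/(_ 0); rewrite !mxE /= => /eqP.
by rewrite eq_sym oner_eq0.
Qed.

Lemma P1_e01 k : inP1g k -> exists a b c d,
  k *m e0 = a *: e0 + b *: e1 /\ k *m e1 = c *: e0 + d *: e1.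
Proof.
move=> Pk; have [|a [b Ea]] := P1_V01 Pk (x := e0); first by exists 1, 0.
have [|c [d E']] := P1_V01 Pk (x := e1); first by exists 0, 1.
by exists a, b, c, d; rewrite Ea E' /e0 /e1 !vec_lin; split; congr vec; ring.
Qed.

Lemma ln_rep g h : ln g = ln h -> exists2 c, c != 0 & h *m e0 = c *: (g *m e0).
Proof.
move/lnE/P2_e0 => [c c0 /= E]; exists c => //.
by rewrite -(mulKVmx (inG_unit (gvG g)) h) -mulmxA E -scalemxAr.
Qed.

Lemma pt_rep g h : pt g = pt h -> exists a b c d,
  h *m e0 = a *: (g *m e0) + b *: (g *m e1) /\
  h *m e1 = c *: (g *m e0) + d *: (g *m e1).
Proof.
move/ptE/P1_e01 => [a [b [c [d /= [E E']]]]]; exists a, b, c, d.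
rewrite -(mulKVmx (inG_unit (gvG g)) h) -mulmxA E -mulmxA E'.
by rewrite !mulmxDr -!scalemxAr.
Qed.

(** Phrased with some representative of [u]; for a linear [V] the choice does not matter, as
    [inV_ln] and [inV_pt] record. *)
Definition inV V u := exists g, (u = ln g /\ V (g *m e0)) \/
  (u = pt g /\ V (g *m e0) /\ V (g *m e1)).

Lemma inV_ln V g : lin V -> inV V (ln g) <-> V (g *m e0).
Proof.
move=> LV; split=> [[h [[/esym/ln_rep[c _ ->] Vh]|[//]]]|Vg]; last by exists g; left.
by rewrite -[_ *: _]addr0 -[0](scale0r (h *m e0)); apply: LV.
Qed.

Lemma inV_pt V g : lin V -> inV V (pt g) <-> V (g *m e0) /\ V (g *m e1).
Proof.
move=> LV; split=> [[h [[//]|[/esym/pt_rep[a [b [c [d [-> ->]]]]] [V0 V1]]]]|Vg].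
  by split; apply: LV.
by exists g; right.
Qed.

Lemma inV_av V g u : (forall x, V x -> V (g *m x)) -> inV V u -> inV V (av g u).
Proof.
move=> Vg [h [[-> Vh]|[-> [Vh Vh']]]]; exists (g · h); [left|right].
  by rewrite av_ln /= -mulmxA; split=> //; apply: Vg.
by rewrite av_pt /= -!mulmxA; split=> //; split; apply: Vg.
Qed.

Lemma lin_V0 : lin V0.
Proof. by move=> c d _ _ [x0 ->] [y0 ->]; rewrite vec_lin; Vtac. Qed.
Lemma lin_V1 : lin V1.
Proof. by move=> c d _ _ [x0 [x1 [x2 ->]]] [y0 [y1 [y2 ->]]]; rewrite vec_lin; Vtac. Qed.
Lemma lin_V2 : lin V2.
Proof.
move=> c d _ _ [x0 [x1 [x2 [x3 [x4 [x5 ->]]]]]] [y0 [y1 [y2 [y3 [y4 [y5 ->]]]]]].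
by rewrite vec_lin; Vtac.
Qed.

Lemma rot_vec (x0 x1 x2 x3 x4 x5 x6 : F) :
  rot F *m vec x0 x1 x2 x3 x4 x5 x6 = vec x2 (- x0) x5 (- x3) (- x1) x6 x4.
Proof. by rewrite /= -mulmxA s2_vec s1_vec; congr vec; ring. Qed.

Lemma rotnS_mul j (x : 'cV[F]_7) : rotn F j.+1 *m x = rot F *m (rotn F j *m x).
Proof. by rewrite [rotn F j.+1]/= [LHS]/= mulmxA. Qed.

Lemma rotn0_mul (x : 'cV[F]_7) : rotn F 0 *m x = x.
Proof. exact: mul1mx. Qed.

End Flags.
Arguments ap : simpl never.
Arguments rotn : simpl never.

(** * The invariant form and the octonion product *)

Section Form.
Variable F : fieldType.
Implicit Types (t a b c d : F) (g h k l : G2F F).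
Implicit Types (x y z w : 'cV[F]_7).

(* The other root elements are conjugates of these under [s1] and [s2]. *)
Lemma inG_ind4 (P : M7 F -> Prop) : P 1%:M ->
  (forall (i : nat) t (m : M7 F), i \in [:: 0; 1; 2; 3]%N -> P m ->
     P (xr (nth alpha1 [:: Pos R1; Pos R2; Neg R1; Neg R2] i) t *m m)) ->
  forall m, inG m -> P m.
Proof.
move=> P1 PX.
pose K (y : M7 F) := forall m, P m -> P (y *m m).
have KM m n : K m -> K n -> K (m *m n) by move=> Km Kn p Pp; rewrite -mulmxA; auto.
have K1 t : K (xr (Pos R1) t) by move=> m; exact: (PX 0%N _ _ isT).
have K2 t : K (xr (Pos R2) t) by move=> m; exact: (PX 1%N _ _ isT).
have K1' t : K (xr (Neg R1) t) by move=> m; exact: (PX 2%N _ _ isT).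
have K2' t : K (xr (Neg R2) t) by move=> m; exact: (PX 3%N _ _ isT).
have Ks1 : K (s1 F) by exact: KM (KM _ _ (K1 _) (K1' _)) (K1 _).
have Ks2 : K (s2 F) by exact: KM (KM _ _ (K2 _) (K2' _)) (K2 _).
have KV1 : K (invmx (s1 F)).
  rewrite /s1 /s_of !invmxM ?unitmx_mul ?xr_unit // !invmx_xr.
  exact: KM (K1 _) (KM _ _ (K1' _) (K1 _)).
have KV2 : K (invmx (s2 F)).
  rewrite /s2 /s_of !invmxM ?unitmx_mul ?xr_unit // !invmx_xr.
  exact: KM (K2 _) (KM _ _ (K2' _) (K2 _)).
have Kw1 r : (forall t, K (xr r t)) -> forall t, K (xr (w1 r) t).
  move=> Kr t; rewrite -[xr _ t](mulmxK (s1_unit F)).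
  rewrite (_ : xr (w1 r) t *m s1 F = s1 F *m xr r (sg1 F r * t)).
    exact: KM (KM _ _ Ks1 (Kr _)) KV1.
  by rewrite s1_xr mulrA sg1K mul1r.
have Kw2 r : (forall t, K (xr r t)) -> forall t, K (xr (w2 r) t).
  move=> Kr t; rewrite -[xr _ t](mulmxK (s2_unit F)).
  rewrite (_ : xr (w2 r) t *m s2 F = s2 F *m xr r (sg2 F r * t)).
    exact: KM (KM _ _ Ks2 (Kr _)) KV2.
  by rewrite s2_xr mulrA sg2K mul1r.
have KX r t : K (xr r t).
  case: r => -[] //.
  - exact: (Kw2 (Pos R1)).
  - exact/(Kw1 (Pos R12))/(Kw2 (Pos R1)).
  - exact: (Kw1 (Pos R2)).
  - exact/(Kw2 (Pos R1112))/(Kw1 (Pos R2)).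
  - exact: (Kw2 (Neg R1)).
  - exact/(Kw1 (Neg R12))/(Kw2 (Neg R1)).
  - exact: (Kw1 (Neg R2)).
  - exact/(Kw2 (Neg R1112))/(Kw1 (Neg R2)).
apply: genby_ind => // [_ m [r [t ->]]|_ m [r [t ->]]]; first exact: KX.
by rewrite invmx_xr; exact: KX.
Qed.

Definition cc i (x : 'cV[F]_7) : F := x (inord i) 0.

Lemma ccE i (x0 x1 x2 x3 x4 x5 x6 : F) : (i < 7)%N ->
  cc i (vec x0 x1 x2 x3 x4 x5 x6) = [:: x0; x1; x2; x3; x4; x5; x6]`_i.
Proof. by move=> i7; rewrite /cc mxE inordK. Qed.

Definition cc_vec (x0 x1 x2 x3 x4 x5 x6 : F) :=
  (@ccE 0 x0 x1 x2 x3 x4 x5 x6 isT, @ccE 1 x0 x1 x2 x3 x4 x5 x6 isT,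
   @ccE 2 x0 x1 x2 x3 x4 x5 x6 isT, @ccE 3 x0 x1 x2 x3 x4 x5 x6 isT,
   @ccE 4 x0 x1 x2 x3 x4 x5 x6 isT, @ccE 5 x0 x1 x2 x3 x4 x5 x6 isT,
   @ccE 6 x0 x1 x2 x3 x4 x5 x6 isT).

Lemma cc_lin i a b x y : cc i (a *: x + b *: y) = a * cc i x + b * cc i y.
Proof. by rewrite /cc !mxE. Qed.
Lemma ccZ i a x : cc i (a *: x) = a * cc i x.
Proof. by rewrite /cc !mxE. Qed.

(* In characteristic 2 the module has no invariant quadratic form; it receives
   the 7-dimensional orthogonal module through [dbl], whose image contains the
   orbit of [e0], and there the last term of [beta] vanishes. *)
Definition dbl x := vec (cc 0 x) (cc 1 x) (cc 2 x) (2 * cc 3 x) (cc 4 x) (cc 5 x) (cc 6 x).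

Definition beta x y : F := cc 0 x * cc 6 y + cc 6 x * cc 0 y - cc 1 x * cc 5 y
  - cc 5 x * cc 1 y + cc 2 x * cc 4 y + cc 4 x * cc 2 y - cc 3 x * cc 3 y / 2.

(** The polar form of the quadratic form x0 x6 - x1 x5 + x2 x4 - x3^2 on the orthogonal module, free
    of denominators. *)
Definition betaL x y : F := cc 0 x * cc 6 y + cc 6 x * cc 0 y - cc 1 x * cc 5 y
  - cc 5 x * cc 1 y + cc 2 x * cc 4 y + cc 4 x * cc 2 y - 2 * cc 3 x * cc 3 y.

Lemma beta_dbl x y : beta (dbl x) (dbl y) = betaL x y.
Proof.
rewrite /beta /betaL /dbl !cc_vec /=; congr (_ - _).
(* In characteristic 2 the doubled coordinates vanish, and with them both terms. *)
have [two0|two0] := eqVneq (2 : F) 0; last by field.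
by rewrite two0 !mul0r.
Qed.

Lemma beta_linl a b x y z : beta (a *: x + b *: y) z = a * beta x z + b * beta y z.
Proof. by rewrite /beta !cc_lin; ring. Qed.
Lemma beta_linr a b x y z : beta z (a *: x + b *: y) = a * beta z x + b * beta z y.
Proof. by rewrite /beta !cc_lin; ring. Qed.

(* The components of the product of two trace-zero split octonions. *)
Definition prd0 x y : F := cc 3 x * cc 6 y - cc 6 x * cc 3 y - cc 4 x * cc 5 y + cc 5 x * cc 4 y.
Definition prd1 x y : F := cc 3 x * cc 5 y - cc 5 x * cc 3 y - cc 2 x * cc 6 y + cc 6 x * cc 2 y.
Definition prd2 x y : F := - cc 3 x * cc 4 y + cc 4 x * cc 3 y - cc 6 x * cc 1 y + cc 1 x * cc 6 y.
Definition prd3 x y : F := cc 6 x * cc 0 y - cc 0 x * cc 6 y + cc 5 x * cc 1 y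
  - cc 1 x * cc 5 y - cc 4 x * cc 2 y + cc 2 x * cc 4 y.
Definition prd4 x y : F := - cc 2 x * cc 3 y + cc 3 x * cc 2 y - cc 5 x * cc 0 y + cc 0 x * cc 5 y.
Definition prd5 x y : F := cc 1 x * cc 3 y - cc 3 x * cc 1 y - cc 0 x * cc 4 y + cc 4 x * cc 0 y.
Definition prd6 x y : F := cc 0 x * cc 3 y - cc 3 x * cc 0 y - cc 1 x * cc 2 y + cc 2 x * cc 1 y.
Definition prd7 x y : F := cc 6 x * cc 0 y - cc 1 x * cc 5 y + cc 2 x * cc 4 y - cc 3 x * cc 3 y.
Definition prod0 x y :=
  [/\ prd0 x y = 0, prd1 x y = 0, prd2 x y = 0 & prd3 x y = 0] /\
  [/\ prd4 x y = 0, prd5 x y = 0, prd6 x y = 0 & prd7 x y = 0].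

(** The lifts through [dbl] of the root elements of the simple roots and their negatives: passing to
    the halved middle coordinate moves the factor 2 from its row to its column. *)
Definition lR1 t x := vec (cc 0 x + t * cc 1 x) (cc 1 x)
  (cc 2 x + 2 * t * cc 3 x + t ^+ 2 * cc 4 x) (cc 3 x + t * cc 4 x) (cc 4 x)
  (cc 5 x + t * cc 6 x) (cc 6 x).
Definition lNR1 t x := vec (cc 0 x) (cc 1 x + t * cc 0 x) (cc 2 x)
  (cc 3 x + t * cc 2 x) (cc 4 x + 2 * t * cc 3 x + t ^+ 2 * cc 2 x) (cc 5 x)
  (cc 6 x + t * cc 5 x).
Definition lR2 t x := vec (cc 0 x) (cc 1 x + t * cc 2 x) (cc 2 x)
  (cc 3 x) (cc 4 x + t * cc 5 x) (cc 5 x) (cc 6 x).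
Definition lNR2 t x := vec (cc 0 x) (cc 1 x) (cc 2 x + t * cc 1 x)
  (cc 3 x) (cc 4 x) (cc 5 x + t * cc 4 x) (cc 6 x).

Ltac pz P E := transitivity E;
  [rewrite /prd0 /prd1 /prd2 /prd3 /prd4 /prd5 /prd6 /prd7 /lR1 /lNR1 /lR2 /lNR2
     !cc_vec /=; ring
  | rewrite ?P; ring].

(** The root element acts linearly on the eight components of the product; the expression given to
    [pz] is the matching row of that action, so a zero product stays zero. *)
Lemma prod0_R1 t x y : prod0 x y -> prod0 (lR1 t x) (lR1 t y).
Proof.
move=> [[P0 P1 P2 P3] [P4 P5 P6 P7]]; pose P := (P0, P1, P2, P3, P4, P5, P6, P7).
split; split.
- pz P (prd0 x y).
- pz P (prd1 x y - t * prd0 x y).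
- pz P (prd2 x y).
- pz P (prd3 x y - 2 * t * prd2 x y).
- pz P (prd4 x y - t * prd3 x y + t ^+ 2 * prd2 x y).
- pz P (prd5 x y).
- pz P (prd6 x y - t * prd5 x y).
- pz P (prd7 x y - t * prd2 x y).
Qed.
Lemma prod0_NR1 t x y : prod0 x y -> prod0 (lNR1 t x) (lNR1 t y).
Proof.
move=> [[P0 P1 P2 P3] [P4 P5 P6 P7]]; pose P := (P0, P1, P2, P3, P4, P5, P6, P7).
split; split.
- pz P (prd0 x y - t * prd1 x y).
- pz P (prd1 x y).
- pz P (prd2 x y - t * prd3 x y + t ^+ 2 * prd4 x y).
- pz P (prd3 x y - 2 * t * prd4 x y).
- pz P (prd4 x y).
- pz P (prd5 x y - t * prd6 x y).
- pz P (prd6 x y).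
- pz P (prd7 x y - t * prd4 x y).
Qed.
Lemma prod0_R2 t x y : prod0 x y -> prod0 (lR2 t x) (lR2 t y).
Proof.
move=> [[P0 P1 P2 P3] [P4 P5 P6 P7]]; pose P := (P0, P1, P2, P3, P4, P5, P6, P7).
split; split.
- pz P (prd0 x y).
- pz P (prd1 x y).
- pz P (prd2 x y - t * prd1 x y).
- pz P (prd3 x y).
- pz P (prd4 x y).
- pz P (prd5 x y - t * prd4 x y).
- pz P (prd6 x y).
- pz P (prd7 x y).
Qed.
Lemma prod0_NR2 t x y : prod0 x y -> prod0 (lNR2 t x) (lNR2 t y).
Proof.
move=> [[P0 P1 P2 P3] [P4 P5 P6 P7]]; pose P := (P0, P1, P2, P3, P4, P5, P6, P7).
split; split.
- pz P (prd0 x y).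
- pz P (prd1 x y - t * prd2 x y).
- pz P (prd2 x y).
- pz P (prd3 x y).
- pz P (prd4 x y - t * prd5 x y).
- pz P (prd5 x y).
- pz P (prd6 x y).
- pz P (prd7 x y).
Qed.

(** In characteristic 2 [dbl] forgets the middle coordinate, so the form and the product are
    transported on the source of [dbl]. There [L] is merely some map above [m], and such maps
    compose along words of generators. *)
Definition lifts (m : M7 F) (L : 'cV[F]_7 -> 'cV[F]_7) :=
  [/\ forall x, m *m dbl x = dbl (L x), forall x y, betaL (L x) (L y) = betaL x y
    & forall x y, prod0 x y -> prod0 (L x) (L y)].

Lemma lifts_xr i t : i \in [:: 0; 1; 2; 3]%N ->
  lifts (xr (nth alpha1 [:: Pos R1; Pos R2; Neg R1; Neg R2] i) t)
        (nth lR1 [:: lR1; lR2; lNR1; lNR2] i t).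
Proof.
rewrite !inE => /or4P[] /eqP-> /=; split.
12: exact: prod0_NR2.
9: exact: prod0_NR1.
6: exact: prod0_R2.
3: exact: prod0_R1.
all: move=> x; try move=> y.
all: rewrite /dbl /lR1 /lR2 /lNR1 /lNR2 ?xr_vec /betaL !cc_vec /=; try congr vec; ring.
Qed.

Lemma lift_G m : inG m -> exists L, lifts m L.
Proof.
apply: (inG_ind4 (P := fun m => exists L, lifts m L)).
  by exists id; split=> // x; rewrite mul1mx.
move=> i t n /(lifts_xr t) [Lm Lb Lp] [L [Em Eb Ep]].
exists (nth lR1 [:: lR1; lR2; lNR1; lNR2] i t \o L); split=> [x|x y|x y Pxy] /=;
  first by rewrite -mulmxA Em Lm.
  by rewrite Lb.
by apply: Lp; apply: Ep.
Qed.

End Form.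

(** * Distances measured from a line *)

Section Distance.
Variable F : fieldType.
Implicit Types (t a b c d : F) (u v w : vtx F) (g h : G2F F) (p q : nat -> vtx F).
Implicit Types (x y z : 'cV[F]_7).

Lemma ap_ln i : ~~ odd i -> ap F i = ln (rotn F i./2).
Proof. by rewrite /ap => /negbTE ->; rewrite av_ln gmul1. Qed.
Lemma ap_pt i : odd i -> ap F i = pt (rotn F i./2).
Proof. by rewrite /ap => ->; rewrite av_pt gmul1. Qed.

Lemma rot_e0 : [/\ rotn F 0 *m e0 F = vec 1 0 0 0 0 0 0,
  rotn F 1 *m e0 F = vec 0 (-1) 0 0 0 0 0, rotn F 2 *m e0 F = vec 0 0 0 0 1 0 0,
  rotn F 3 *m e0 F = vec 0 0 0 0 0 0 1 & rotn F 4 *m e0 F = vec 0 0 0 0 0 1 0] /\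
  rotn F 5 *m e0 F = vec 0 0 1 0 0 0 0.
Proof. by rewrite !rotnS_mul rotn0_mul /e0 !rot_vec; do !split; congr vec; ring. Qed.

Lemma rot_e1 : [/\ rotn F 0 *m e1 F = vec 0 1 0 0 0 0 0,
  rotn F 1 *m e1 F = vec 0 0 0 0 (-1) 0 0, rotn F 2 *m e1 F = vec 0 0 0 0 0 0 (-1),
  rotn F 3 *m e1 F = vec 0 0 0 0 0 (-1) 0 & rotn F 4 *m e1 F = vec 0 0 (-1) 0 0 0 0] /\
  rotn F 5 *m e1 F = vec (-1) 0 0 0 0 0 0.
Proof. by rewrite !rotnS_mul rotn0_mul /e1 !rot_vec; do !split; congr vec; ring. Qed.

Lemma rot_vecs :
  ((rotn F 0 *m e0 F = vec 1 0 0 0 0 0 0) * (rotn F 1 *m e0 F = vec 0 (-1) 0 0 0 0 0) *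
   (rotn F 2 *m e0 F = vec 0 0 0 0 1 0 0) * (rotn F 3 *m e0 F = vec 0 0 0 0 0 0 1) *
   (rotn F 4 *m e0 F = vec 0 0 0 0 0 1 0) * (rotn F 5 *m e0 F = vec 0 0 1 0 0 0 0)) *
  ((rotn F 0 *m e1 F = vec 0 1 0 0 0 0 0) * (rotn F 1 *m e1 F = vec 0 0 0 0 (-1) 0 0) *
   (rotn F 2 *m e1 F = vec 0 0 0 0 0 0 (-1)) * (rotn F 3 *m e1 F = vec 0 0 0 0 0 (-1) 0) *
   (rotn F 4 *m e1 F = vec 0 0 (-1) 0 0 0 0) * (rotn F 5 *m e1 F = vec (-1) 0 0 0 0 0 0)).
Proof. by case: rot_e0 => -[? ? ? ? ?] ?; case: rot_e1 => -[? ? ? ? ?] ?. Qed.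

(** Minimality is not demanded: for [n] at most 6 the length of a non-stammering path between two
    vertices turns out to be unique ([dist_uniq]), which makes this the distance. *)
Definition dist n u v := exists p, [/\ nspath p n, p 0%N = u & p n = v].

Lemma nspath_cons p n w : nspath p n -> adj w (p 0%N) -> (n = 0%N \/ w <> p 1%N) ->
  nspath (fun i => if i is i'.+1 then p i' else w) n.+1.
Proof.
move=> [A B] wp w1; split=> -[|i] //.
- by move=> Hi; apply: A.
- by move=> n1; case: w1 => // n0; rewrite n0 in n1.
- by move=> Hi; apply: B.
Qed.

Lemma nspath_snoc p n w : nspath p n -> adj (p n) w -> (n = 0%N \/ w <> p n.-1) ->
  nspath (fun i => if i == n.+1 then w else p i) n.+1.
Proof.
move=> [A B] wp w1; split=> i Hi.
- have [->|ni] := eqVneq i n; first by rewrite eqxx ltn_eqF.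
  have -> : (i == n.+1) = false by lia.
  have -> : (i.+1 == n.+1) = false by lia.
  by apply: A; lia.
- have -> : (i == n.+1) = false by lia.
  case: eqP => [E|E]; last by apply: B; lia.
  have -> : i = n.-1 by lia.
  by case: w1 => [|w1 /esym //]; lia.
Qed.

Lemma nspath_rev p n : nspath p n -> nspath (fun i => p (n - i)%N) n.
Proof.
move=> [A B]; split=> i Hi.
  have -> : (n - i = (n - i.+1).+1)%N by lia.
  by apply/adj_sym; apply: A; lia.
have -> : (n - i = (n - i.+2).+2)%N by lia.
by move/esym; apply: B; lia.
Qed.

Lemma nspath_shift p n m : nspath p (n + m) -> nspath (fun i => p (m + i)%N) n.
Proof.
by move=> [A B]; split=> i Hi; rewrite !addnS; [apply: A | apply: B]; lia.
Qed.

Lemma dist_sym n u v : dist n u v -> dist n v u.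
Proof.
move=> [p [np <- <-]]; exists (fun i => p (n - i)%N).
by split; [exact: nspath_rev | rewrite subn0 | rewrite subnn].
Qed.

Lemma dist0 u v : dist 0 u v -> u = v.
Proof. by move=> [p [_ <- <-]]. Qed.

Lemma dist_refl u : dist 0 u u.
Proof. by exists (fun=> u); split=> //; split. Qed.

Lemma cact_nspath th p n : nspath p n -> nspath (fun i => cact th (p i)) n.
Proof.
move=> [A B]; split=> i Hi; first by apply/adj_cact; exact: A.
by move/cact_inj; exact: B.
Qed.

Lemma dist_cact th n u v : dist n u v -> dist n (cact th u) (cact th v).
Proof. by move=> [p [np <- <-]]; exists (fun i => cact th (p i)); split=> //; exact: cact_nspath. Qed.

Definition isP u := if u is VP _ then true else false.

Lemma isP_adj u v : adj u v -> isP v = ~~ isP u.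
Proof. by case: u v => [?|?] [?|?]. Qed.

Lemma isP_cact th u : isP (cact th u) = isP u. Proof. by case: u. Qed.

Lemma isP_dist n u v : dist n u v -> isP v = odd n (+) isP u.
Proof.
move=> [p [[A _] <- <-]]; elim: n A => [|n IH] A //=.
rewrite (isP_adj (A n _)) // IH => [|i Hi]; first by case: (odd n); case: isP.
by apply: A; exact: ltnW.
Qed.

Lemma isP_ap i : isP (ap F i) = odd i.
Proof. by rewrite /ap /av isP_cact; case: odd. Qed.

Lemma isPln g : isP (ln g) = false. Proof. by []. Qed.
Lemma isPpt g : isP (pt g) = true. Proof. by []. Qed.

Lemma lnP u : isP u = false -> exists g, u = ln g.
Proof. by have [g [->|->]] := vtx_rep u => // _; exists g. Qed.
Lemma ptP u : isP u -> exists g, u = pt g.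
Proof. by have [g [->|->]] := vtx_rep u => // _; exists g. Qed.

Ltac solveV := rewrite /= ?rot_vecs; do ?eexists; first [reflexivity | congr vec; ring].
Ltac refuteV := unfold V0, V1, V2 in *;
  repeat match goal with H : _ /\ _ |- _ => destruct H | H : ex _ |- _ => destruct H end;
  repeat match goal with H : vec _ _ _ _ _ _ _ = _ |- _ =>
    move/vec_inj: H => [[? ? ? ?] [? ? ?]] end;
  match goal with
  | H : 1 = 0 |- _ => by move/eqP: H; rewrite oner_eq0
  | H : -1 = 0 |- _ => by move/eqP: H; rewrite oppr_eq0 oner_eq0
  end.

(** One of the subspaces [V0], [V1], [V2] contains [ap j] but not [ap k], and [P2] preserves
    containment in it. *)
Lemma ap_sep j k : (j < k)%N -> (k <= 6)%N -> odd j = odd k ->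
  forall g, inP2g g -> av g (ap F j) <> ap F k.
Proof.
move=> jk k6 ojk g Pg.
suff [V [LV VP [Vj Vk]]] : exists V : 'cV[F]_7 -> Prop, [/\ lin V,
    forall g, inP2g g -> forall x, V x -> V (g *m x)
    & inV V (ap F j) /\ ~ inV V (ap F k)].
  by move=> E; apply: Vk; rewrite -E; apply: inV_av => //; exact: VP.
have H0 : (j == 0%N) -> ~~ odd k -> exists V : 'cV[F]_7 -> Prop, [/\ lin V,
    forall g, inP2g g -> forall x, V x -> V (g *m x)
    & inV V (ap F j) /\ ~ inV V (ap F k)].
{ move=> /eqP j0 ok; exists (@V0 F); split; [exact: lin_V0 | exact: P2_V0 |].
  move: jk k6 ok; rewrite j0; case: k {ojk} => [|[|[|[|[|[|[|k]]]]]]] //= _ _ _.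
  all: rewrite !ap_ln // !inV_ln; try exact: lin_V0.
  all: split; [solveV | rewrite /= ?rot_vecs => ?; refuteV]. }
case: j H0 jk ojk => [|[|[|[|[|[|j]]]]]] H0 jk ojk; last by lia.
- by apply: H0 => //; rewrite -ojk.
{ exists (@V1 F); split; [exact: lin_V1 | exact: P2_V1 |].
  move: jk k6 ojk; case: k {H0} => [|[|[|[|[|[|[|k]]]]]]] //= _ _ _.
  all: rewrite !ap_pt // !inV_pt; try exact: lin_V1.
  all: split; [split; solveV | rewrite /= ?rot_vecs => -[? ?]; refuteV]. }
{ exists (@V1 F); split; [exact: lin_V1 | exact: P2_V1 |].
  move: jk k6 ojk; case: k {H0} => [|[|[|[|[|[|[|k]]]]]]] //= _ _ _.
  all: rewrite !ap_ln // !inV_ln; try exact: lin_V1.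
  all: split; [solveV | rewrite /= ?rot_vecs => ?; refuteV]. }
{ exists (@V2 F); split; [exact: lin_V2 | exact: P2_V2 |].
  move: jk k6 ojk; case: k {H0} => [|[|[|[|[|[|[|k]]]]]]] //= _ _ _.
  all: rewrite !ap_pt // !inV_pt; try exact: lin_V2.
  all: split; [split; solveV | rewrite /= ?rot_vecs => -[? ?]; refuteV]. }
{ exists (@V2 F); split; [exact: lin_V2 | exact: P2_V2 |].
  move: jk k6 ojk; case: k {H0} => [|[|[|[|[|[|[|k]]]]]]] //= _ _ _.
  all: rewrite !ap_ln // !inV_ln; try exact: lin_V2.
  all: split; [solveV | rewrite /= ?rot_vecs => ?; refuteV]. }
- by move: jk k6 ojk; case: k {H0} => [|[|[|[|[|[|[|k]]]]]]].
Qed.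

(** Both paths are moved from the apartment by group elements that agree on the first line, hence
    differ by an element of [P2]; this element would carry [ap j] to [ap k]. *)
Lemma dist_ln_lt u v j k : isP u = false -> dist j u v -> dist k u v ->
  (j < k)%N -> (k <= 6)%N -> False.
Proof.
move=> /lnP[h ->] Dj Dk jk k6.
have ojk : odd j = odd k.
  by move: (isP_dist Dj); rewrite (isP_dist Dk) isPln !addbF.
case: Dj Dk => p [np p0 pj] [q [nq q0 qk]].
have [g Eg] := transit_ln np (leq_trans (ltnW jk) (leq_trans k6 (isT : 6 <= 7)%N)) p0.
have [g' Eg'] := transit_ln nq (leq_trans k6 (isT : 6 <= 7)%N) q0.
apply: (ap_sep jk k6 ojk (g := ginv g' · g)).
  have /lnE // : ln g' = ln g.
  by rewrite -[g]gmul1 -[g']gmul1 -!av_ln -!ap0 -Eg // -Eg' // p0.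
by rewrite -avM -Eg // pj -qk Eg' // avK.
Qed.

End Distance.

(** * Opposition, thickness and diameter *)

Section Opposition.
Variable F : fieldType.
Implicit Types (t a b c d : F) (u v w : vtx F) (g h : G2F F) (p q : nat -> vtx F).
Implicit Types (x y z : 'cV[F]_7).

Lemma dbl_e0 : e0 F = dbl (e0 F).
Proof. by rewrite /dbl /e0 !cc_vec /= mulr0. Qed.
Lemma dbl_e1 : e1 F = dbl (e1 F).
Proof. by rewrite /dbl /e1 !cc_vec /= mulr0. Qed.

Lemma beta_G g x y : beta (g *m dbl x) (g *m dbl y) = beta (dbl x) (dbl y).
Proof. by have [L [Lm Lb _]] := lift_G (gvG g); rewrite !Lm !beta_dbl Lb. Qed.

Lemma dbl_G g x : exists y, g *m dbl x = dbl y.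
Proof. by have [L [Lm _ _]] := lift_G (gvG g); exists (L x). Qed.

Definition gram x y x' y' : F := beta x x' * beta y y' - beta x y' * beta y x'.

Lemma gram_G g x y x' y' : gram (g *m dbl x) (g *m dbl y) (g *m dbl x') (g *m dbl y') =
  gram (dbl x) (dbl y) (dbl x') (dbl y').
Proof. by rewrite /gram !beta_G. Qed.

Lemma gram_lin a b c d a' b' c' d' x y x' y' :
  gram (a *: x + b *: y) (c *: x + d *: y) (a' *: x' + b' *: y') (c' *: x' + d' *: y') =
  (a * d - b * c) * (a' * d' - b' * c') * gram x y x' y'.
Proof. by rewrite /gram !beta_linl !beta_linr; ring. Qed.

Lemma betaZ a b x y : beta (a *: x) (b *: y) = a * b * beta x y.
Proof. by rewrite /beta !ccZ; ring. Qed.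

Lemma beta_rep g h g' h' : ln g = ln g' -> ln h = ln h' ->
  beta (g *m e0 F) (h *m e0 F) = 0 -> beta (g' *m e0 F) (h' *m e0 F) = 0.
Proof.
by move=> /ln_rep[c _ ->] /ln_rep[d _ ->] E; rewrite betaZ E mulr0.
Qed.

Lemma gram_rep g h g' h' : pt g = pt g' -> pt h = pt h' ->
  gram (g *m e0 F) (g *m e1 F) (h *m e0 F) (h *m e1 F) = 0 ->
  gram (g' *m e0 F) (g' *m e1 F) (h' *m e0 F) (h' *m e1 F) = 0.
Proof.
move=> /pt_rep[a [b [c [d [-> ->]]]]] /pt_rep[a' [b' [c' [d' [-> ->]]]]] E.
by rewrite gram_lin E mulr0.
Qed.

Ltac betatac := rewrite /gram /beta /e0 /e1 !cc_vec /=; ring.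

(** Transitivity reduces the claim to the base line and [ap j], and the form pairs a nonzero weight
    vector only with that of the opposite weight, found at [ap 6]. *)
Lemma dist_ln_beta g h j : dist j (ln g) (ln h) -> (j <= 6)%N ->
  beta (g *m e0 F) (h *m e0 F) = 0 <-> (j < 6)%N.
Proof.
move=> D j6; have ej : ~~ odd j by move: (isP_dist D); rewrite !isPln addbF => <-.
case: D => p [np p0 pj].
have [k Ek] := transit_ln np (leq_trans j6 (isT : 6 <= 7)%N) p0.
have Eg : ln g = ln k by rewrite -p0 Ek // ap0 av_ln gmul1.
have Eh : ln h = ln (k · rotn F j./2) by rewrite -pj Ek // ap_ln // av_ln.
have -> : beta (g *m e0 F) (h *m e0 F) = 0 <-> beta (e0 F) (rotn F j./2 *m e0 F) = 0.
  have <- : beta (k *m e0 F) ((k · rotn F j./2) *m e0 F) = beta (e0 F) (rotn F j./2 *m e0 F).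
    have [y Ey] := dbl_G (rotn F j./2) (e0 F).
    by rewrite /= -mulmxA dbl_e0 Ey beta_G.
  by split; apply: beta_rep.
move: j6 ej; clear; case: j => [|[|[|[|[|[|[|j]]]]]]] //= _ _; rewrite rot_vecs.
all: split=> // E; try (by betatac).
suff /eqP : 1 = 0 :> F by rewrite oner_eq0.
by rewrite -E; betatac.
Qed.

Lemma dist_pt_gram g h j : dist j (pt g) (pt h) -> (j <= 6)%N ->
  gram (g *m e0 F) (g *m e1 F) (h *m e0 F) (h *m e1 F) = 0 <-> (j < 6)%N.
Proof.
move=> D j6; have ej : ~~ odd j.
  by move: (isP_dist D); rewrite !isPpt addbT; case: odd.
case: D => p [np p0 pj].
have [k Ek] := transit_pt np (leq_trans j6 (isT : 6 <= 7)%N) p0.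
have oj : odd (13 - j) by lia.
have Eg : pt g = pt k by rewrite -p0 Ek // subn0 (ap12 F 1) ap1 av_pt gmul1.
have Eh : pt h = pt (k · rotn F (13 - j)./2) by rewrite -pj Ek // ap_pt // av_pt.
set r := rotn F (13 - j)./2.
have -> : gram (g *m e0 F) (g *m e1 F) (h *m e0 F) (h *m e1 F) = 0 <->
    gram (e0 F) (e1 F) (r *m e0 F) (r *m e1 F) = 0.
  have <- : gram (k *m e0 F) (k *m e1 F) ((k · r) *m e0 F) ((k · r) *m e1 F) =
      gram (e0 F) (e1 F) (r *m e0 F) (r *m e1 F).
    have [y Ey] := dbl_G r (e0 F); have [y' Ey'] := dbl_G r (e1 F).
    by rewrite /= -!mulmxA dbl_e0 dbl_e1 Ey Ey' gram_G.
  by split; apply: gram_rep.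
(* At [j = 0] the vertex is [ap 13], reached by six turns, which are the identity. *)
have r0 : rotn F (13 - 0)./2 = gone by exact: rot6.
rewrite /r; move: j6 ej r0; clear; case: j => [|[|[|[|[|[|[|j]]]]]]] // _ _ r0.
all: rewrite ?r0 /= ?mul1mx ?rot_vecs.
all: split=> // E; try (by betatac).
suff /eqP : 1 = 0 :> F by rewrite oner_eq0.
by rewrite -E; betatac.
Qed.

(** Two of them lie in the apartment and the third is moved out of it by a root element of parameter
    1, so that three exist even over the field with two elements. *)
Lemma nbr3 i : exists v1 v2 v3, [/\ adj (ap F i) v1, adj (ap F i) v2, adj (ap F i) v3
  & [/\ v1 <> v2, v1 <> v3 & v2 <> v3]].
Proof.
elim/ltn_ind: i => -[|[|i]] IH; last first.
- have [v1 [v2 [v3 [A1 A2 A3 [N1 N2 N3]]]]] := IH i (leqnSn _).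
  exists (av (rot F) v1), (av (rot F) v2), (av (rot F) v3); rewrite apSS.
  by split; try exact/adj_av; split=> /av_inj.
- exists (ap F 0), (ap F 2), (av (X alpha1 1) (ap F 2)).
  have A2 : adj (ap F 1) (ap F 2) by exact: adj_ap.
  split=> //; first by apply/adj_sym; exact: adj_ap.
    by rewrite -(@fixapP F alpha1 1 1 isT) adj_av.
  pose V (x : 'cV[F]_7) := cc 1 x = 0; pose W (x : 'cV[F]_7) := cc 0 x = 0.
  have LV : lin V by move=> a b x y; rewrite /V cc_lin => -> ->; ring.
  have LW : lin W by move=> a b x y; rewrite /W cc_lin => -> ->; ring.
  have E0 : inV V (ap F 0) by rewrite ap_ln // inV_ln // /V rot_vecs !cc_vec.
  have E2 : ~ inV V (ap F 2).
    rewrite ap_ln // inV_ln // /V rot_vecs !cc_vec /= => /eqP.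
    by rewrite oppr_eq0 oner_eq0.
  have E2' : inV W (ap F 2) by rewrite ap_ln // inV_ln // /W rot_vecs !cc_vec.
  split=> [E|E|E].
  + by apply: E2; rewrite -E.
  + have : inV V (av (X alpha1 1) (ap F 2)) by rewrite -E.
    rewrite ap_ln // av_ln inV_ln // /V !(gvMv (X _ _)) gvX rot_vecs xr_R1 !cc_vec /= => /eqP.
    by rewrite oppr_eq0 oner_eq0.
  + have : inV W (av (X alpha1 1) (ap F 2)) by rewrite -E.
    rewrite ap_ln // av_ln inV_ln // /W !(gvMv (X _ _)) gvX rot_vecs xr_R1 !cc_vec /= => /eqP.
    by rewrite add0r mulrN1 oppr_eq0 oner_eq0.
- exists (ap F 1), (ap F 11), (av (X alpha2 1) (ap F 11)).
  have A1 : ap F 1 = pt (rotn F 0) by exact: ap_pt.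
  have A11 : ap F 11 = pt (rotn F 5) by exact: ap_pt.
  have A2 : adj (ap F 0) (ap F 11) by rewrite -(ap12 F 0); apply/adj_sym; exact: adj_ap.
  split=> //; first exact: adj_ap.
    by rewrite -(@fixapP F alpha2 0 1 isT) adj_av.
  pose V (x : 'cV[F]_7) := cc 2 x = 0; pose W (x : 'cV[F]_7) := cc 1 x = 0.
  have LV : lin V by move=> a b x y; rewrite /V cc_lin => -> ->; ring.
  have LW : lin W by move=> a b x y; rewrite /W cc_lin => -> ->; ring.
  have E0 : inV V (ap F 1) by rewrite A1 inV_pt // /V !rot_vecs !cc_vec.
  have E2 : ~ inV V (ap F 11).
    rewrite A11 inV_pt // /V !rot_vecs !cc_vec /= => -[/eqP].
    by rewrite oner_eq0.
  have E2' : inV W (ap F 11) by rewrite A11 inV_pt // /W !rot_vecs !cc_vec.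
  split=> [E|E|E].
  + by apply: E2; rewrite -E.
  + have : inV V (av (X alpha2 1) (ap F 11)) by rewrite -E.
    rewrite A11 av_pt inV_pt // /V !(gvMv (X _ _)) gvX !rot_vecs !xr_R2 !cc_vec /= => -[/eqP].
    by rewrite oner_eq0.
  + have : inV W (av (X alpha2 1) (ap F 11)) by rewrite -E.
    rewrite A11 av_pt inV_pt // /W !(gvMv (X _ _)) gvX !rot_vecs !xr_R2 !cc_vec /= => -[/eqP].
    by rewrite add0r mulr1 oner_eq0.
Qed.

Lemma thick u v w : exists u', [/\ adj u u', u' <> v & u' <> w].
Proof.
have [i [g ->]] : exists i g, u = av g (ap F i).
  have [g [->|->]] := vtx_rep u.
    by exists 1%N, g; rewrite ap1 av_pt gmul1.
  by exists 0%N, g; rewrite ap0 av_ln gmul1.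
have [v1 [v2 [v3 [A1 A2 A3 [N1 N2 N3]]]]] := nbr3 i.
have C r : r <> av (ginv g) v -> r <> av (ginv g) w -> adj (ap F i) r ->
    exists u', [/\ adj (av g (ap F i)) u', u' <> v & u' <> w].
  move=> rv rw Ar; exists (av g r).
  split; [exact/adj_av | move=> E; apply: rv; rewrite -E avK //
    | move=> E; apply: rw; rewrite -E avK //].
have [E1|E1] := classic (v1 = av (ginv g) v).
  have [E2|E2] := classic (v2 = av (ginv g) w).
    by apply: (C v3) => //; congruence.
  by apply: (C v2) => //; congruence.
have [E2|E2] := classic (v1 = av (ginv g) w); last exact: (C v1).
have [E3|E3] := classic (v2 = av (ginv g) v).
  by apply: (C v3) => //; congruence.
by apply: (C v2) => //; congruence.
Qed.

Lemma dist_cons n u v w p : nspath p n -> p 0%N = u -> p n = v -> adj w u ->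
  (n = 0%N \/ w <> p 1%N) -> dist n.+1 w v.
Proof.
move=> np p0 pn wu w1; exists (fun i => if i is i'.+1 then p i' else w).
by split=> //; apply: nspath_cons; rewrite ?p0.
Qed.

(** After [dist_ln_lt] only two points remain. Below 6 both paths are lengthened at [u] by a
    neighbour that avoids their second vertices, and then start at a line; at length 6 the Gram
    determinant decides. *)
Lemma dist_lt u v j k : dist j u v -> dist k u v -> (j < k)%N -> (k <= 6)%N -> False.
Proof.
move=> Dj Dk jk k6.
have [Pu|Pu] := boolP (isP u); last by apply: (dist_ln_lt _ Dj Dk) => //; exact/negbTE.
have [Pv|Pv] := boolP (isP v); last first.
  by apply: (dist_ln_lt _ (dist_sym Dj) (dist_sym Dk)) => //; exact/negbTE.
have ej : ~~ odd j by move: (isP_dist Dj); rewrite Pu Pv addbT; case: odd.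
have ek : ~~ odd k by move: (isP_dist Dk); rewrite Pu Pv addbT; case: odd.
have [k6'|k6'] := ltnP k 6; last first.
  have Ek : k = 6 by lia.
  move: Dj Dk; have [g ->] := ptP Pu; have [h ->] := ptP Pv => Dj Dk.
  have := (proj2 (dist_pt_gram Dj (ltnW (leq_trans jk k6)))) (leq_trans jk k6).
  by move/(proj1 (dist_pt_gram Dk k6)); lia.
case: Dj Dk => p [np p0 pj] [q [nq q0 qk]].
have [w [uw wp wq]] := thick u (p 1%N) (q 1%N).
have Dj : dist j.+1 w v by apply: (dist_cons np p0 pj); [exact/adj_sym | right].
have Dk : dist k.+1 w v by apply: (dist_cons nq q0 qk); [exact/adj_sym | right].
apply: (dist_ln_lt _ Dj Dk) => //.
by move: (isP_adj uw); rewrite Pu.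
Qed.

Lemma dist_uniq u v j k : dist j u v -> dist k u v -> (j <= 6)%N -> (k <= 6)%N -> j = k.
Proof.
move=> Dj Dk j6 k6; case: (ltngtP j k) => // jk; exfalso.
  exact: dist_lt Dj Dk jk k6.
exact: dist_lt Dk Dj jk j6.
Qed.

(** Different first steps would put [q 1] at two distances from the end that differ by 2 and are
    both at most 6. *)
Lemma path_uniq n p q : nspath p n -> nspath q n -> (n <= 5)%N -> p 0%N = q 0%N ->
  p n = q n -> forall i, (i <= n)%N -> p i = q i.
Proof.
elim: n p q => [|n IH] p q np nq n5 E0 En i; first by rewrite leqn0 => /eqP->.
have E1 : p 1%N = q 1%N.
  apply: NNPP => N1.
  have Dq : dist n (q 1%N) (p n.+1).
    exists (fun i => q (1 + i)%N); split=> //.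
    by apply: nspath_shift; rewrite addn1.
  have Dp : dist n.+2 (q 1%N) (p n.+1).
    apply: (dist_cons np erefl erefl); last by right=> /esym.
    by apply/adj_sym; rewrite E0; apply: (proj1 nq).
  by have := dist_uniq Dq Dp; lia.
case: i => [|i] Hi //.
apply: (IH (fun i => p (1 + i)%N) (fun i => q (1 + i)%N)) => //.
- by apply: nspath_shift; rewrite addn1.
- by apply: nspath_shift; rewrite addn1.
- exact: ltnW.
Qed.

Lemma ap_neq2 i : ap F i <> ap F i.+2.
Proof.
elim/ltn_ind: i => -[|[|i]] IH; last by rewrite !apSS => /av_inj; rewrite -apSS; exact: IH.
- by have := @ap_sep F 0 2 isT isT erefl gone; rewrite av1; apply; exact: genby1.
- by have := @ap_sep F 1 3 isT isT erefl gone; rewrite av1; apply; exact: genby1.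
Qed.

Lemma ap_nspath m n : nspath (fun i => ap F (m + i)%N) n.
Proof.
by split=> i _; rewrite !addnS; [exact: adj_ap | exact: ap_neq2].
Qed.

Lemma dist_ap m n : dist n (ap F (m + 0)%N) (ap F (m + n)%N).
Proof. by exists (fun i => ap F (m + i)%N); split=> //; exact: ap_nspath. Qed.

(** The group is generated by four root groups, each of which fixes the base line or the base point,
    so translates of the base line stay connected to it. *)
Lemma connected_base (R : vtx F -> Prop) : (forall u v, R u -> adj u v -> R v) ->
  R (ln gone) -> forall u, R u.
Proof.
move=> RA R1.
have Rln m : inG m -> forall (Gm : inG m) (R : vtx F -> Prop),
    (forall u v, R u -> adj u v -> R v) -> R (ln gone) -> R (ln (MkG Gm)).
  move: m; apply: (inG_ind4 (P := fun m => forall (Gm : inG m) (R : vtx F -> Prop),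
    (forall u v, R u -> adj u v -> R v) -> R (ln gone) -> R (ln (MkG Gm)))).
    by move=> Gm S SA S1; rewrite (_ : MkG Gm = gone) //; exact: gext.
  move=> i t m i4 IH Gm S SA S1; set r := nth _ _ _ in Gm *.
  have Gm' : inG m.
    by rewrite -[m](mulKmx (xr_unit r t)); apply: inGM => //; apply: inGV; exact: inG_xr.
  rewrite (_ : MkG Gm = X r t · MkG Gm') -?av_ln; last exact: gext.
  (* The hypothesis is used for the translate of [S] by the first letter of the word; this is why
     the relation is quantified inside the induction. *)
  apply: (IH Gm' (fun u => S (av (X r t) u))) => [u v Su uv|].
    by apply: SA Su _; exact/adj_av.
  have [f0|f1] : fixap r 0 \/ fixap r 1.
    by move: i4; rewrite /r !inE => /or4P[] /eqP->; auto.
    by rewrite -ap0 fixapP // ap0.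
  apply: (SA (ap F 1)); last by rewrite -ap0 -(fixapP t f1) adj_av; apply/adj_sym; exact: adj_ap.
  by apply: (SA (ap F 0)); [rewrite ap0 | exact: adj_ap].
move=> u; have [g [->|->]] := vtx_rep u; last by case: g => m Gm; exact: Rln.
apply: (RA (ln g)); first by case: g => m Gm; exact: Rln.
by rewrite -[g]gmul1 -av_ln -av_pt adj_av; exact: adj1.
Qed.

(** A path that has grown to length 7 lies in a 12-cycle, and the way round the other side has
    length 5. *)
Lemma dist_ex u v : exists2 k, (k <= 6)%N & dist k u v.
Proof.
pose R u v := exists2 k, (k <= 6)%N & dist k u v.
have RA w : forall u v, R w u -> adj u v -> R w v.
  move=> u' v' [k k6 [p [np p0 pk]]] uv.
  have [[k0 E]|N] := classic ((0 < k)%N /\ v' = p k.-1).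
    exists k.-1; first by lia.
    by exists p; split=> //; apply: nspath_le np; lia.
  have np' : nspath (fun i => if i == k.+1 then v' else p i) k.+1.
    apply: nspath_snoc => //; first by rewrite pk.
    case: k N {k6 np pk} => [|k] N; [by left | right=> E; exact: N].
  have [k5|k5] := ltnP k 6.
    exists k.+1 => //; exists (fun i => if i == k.+1 then v' else p i).
    by rewrite eqxx; split.
  have Ek : k = 6 by lia.
  rewrite Ek in np'; exists 5 => //.
  pose p' i := if i == 7 then v' else p i.
  have [h [E|E]] := vtx_rep w.
    have [g Eg] := transit_pt (p := p') np' isT (etrans p0 E).
    have -> : w = av g (ap F (1 + 0)%N) by rewrite -(ap12 F 1) -(Eg 0%N isT).
    have -> : v' = av g (ap F (1 + 5)%N) by rewrite -(Eg 7%N isT).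
    exact/dist_cact/dist_ap.
  have [g Eg] := transit_ln (p := p') np' isT (etrans p0 E).
  have -> : w = av g (ap F (7 + 5)%N) by rewrite (ap12 F 0) -(Eg 0%N isT).
  have -> : v' = av g (ap F (7 + 0)%N) by rewrite -(Eg 7%N isT).
  exact/dist_cact/dist_sym/dist_ap.
have Rln w : R (ln gone) w.
  by apply: (connected_base (R := R (ln gone))); [exact: RA | exists 0%N => //; exact: dist_refl].
have Rsym w w' : R w w' -> R w' w by move=> [k k6 /dist_sym D]; exists k.
apply: (connected_base (R := R u)); first exact: RA.
by apply: Rsym; exact: Rln.
Qed.

End Opposition.

(** * Collineations without opposite images of one type *)

Section Domestic.
Variable F : fieldType.
Implicit Types (u v w x y : vtx F) (p q : nat -> vtx F) (th : collineation F).

Lemma dist_list6 v0 v1 v2 v3 v4 v5 v6 : adj v0 v1 -> adj v1 v2 -> adj v2 v3 ->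
  adj v3 v4 -> adj v4 v5 -> adj v5 v6 ->
  v0 <> v2 -> v1 <> v3 -> v2 <> v4 -> v3 <> v5 -> v4 <> v6 -> dist 6 v0 v6.
Proof.
move=> *; exists (nth v0 [:: v0; v1; v2; v3; v4; v5; v6]).
by split=> //; split=> [[|[|[|[|[|[|i]]]]]]|[|[|[|[|[|i]]]]]].
Qed.

Lemma within_dist n u v : (n <= 6)%N -> within n u v <-> exists2 k, (k <= n)%N & dist k u v.
Proof.
elim: n u => [|n IH] u n6.
  split=> [[->|//]|[k]]; first by exists 0%N => //; exact: dist_refl.
  by rewrite leqn0 => /eqP-> /dist0; left.
split=> [[->|[w [_ [uw /IH[|k kn [p [np p0 pk]]]]]]]|].
- by exists 0%N => //; exact: dist_refl.
- exact: ltnW.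
- have [[k0 E]|N] := classic ((0 < k)%N /\ u = p 1%N).
    exists k.-1; first by lia.
    case: k k0 kn np pk => // k _ kn np pk; exists (fun i => p (1 + i)%N).
    by split=> //; apply: nspath_shift; rewrite addn1.
  exists k.+1 => //; apply: (dist_cons np p0 pk uw).
  by case: k N {kn np pk} => [|k] N; [left | right=> E; apply: N].
- move=> [[|k] kn [p [np p0 pk]]]; first by left; rewrite -p0.
  right; exists (p 1%N); split=> //; split; first by rewrite -p0; exact: (proj1 np).
  apply/IH; first exact: ltnW.
  exists k => //; exists (fun i => p (1 + i)%N).
  by split=> //; apply: nspath_shift; rewrite addn1.
Qed.

Lemma oppositeE u v : opposite u v <-> dist 6 u v.
Proof.
split=> [[_ N]|D].
  have [k k6 D] := dist_ex u v.
  have [k5|k5] := ltnP 5 k; first by rewrite (_ : 6%N = k) //; lia.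
  by case: N; apply/within_dist => //; exists k.
split; first by apply/within_dist => //; exists 6.
by move/(within_dist _ _ (isT : 5 <= 6)%N) => [k k5 /(dist_uniq D)]; lia.
Qed.

Definition vtype_of (b : bool) := if b then T2 else T1.

Lemma in_TypeE th b :
  in_Type th (vtype_of b) <-> exists2 u, isP u = b & dist 6 u (cact th u).
Proof.
split=> [[[p|L|p L] [_ [tb]]]|[[p|L] <- D]].
- by case: b tb => // _ /oppositeE D; exists (VP p).
- by case: b tb => // _ /oppositeE D; exists (VL L).
- move=> [/oppositeE Dp /oppositeE DL]; case: b tb => _; [by exists (VP p)|by exists (VL L)].
- by exists (SP p); split=> //; split=> //; exact/oppositeE.
- by exists (SL L); split=> //; split=> //; exact/oppositeE.
Qed.

(** The boolean is [true] for points and [false] for lines, so that both types are treated by one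
    argument. *)
Definition domestic b th := forall u, isP u = b -> ~ dist 6 u (cact th u).

Lemma Type_isE th b : Type_is th (vtype_of b) <->
  (exists2 u, isP u = b & dist 6 u (cact th u)) /\ domestic (~~ b) th.
Proof.
split=> [Tth|[Db Dnb] t].
  split; first exact/in_TypeE/Tth.
  move=> u ub D; have /Tth : in_Type th (vtype_of (~~ b)) by apply/in_TypeE; exists u.
  by case: (b).
have [b' ->] : exists b', t = vtype_of b' by case: t; [exists false | exists true].
rewrite in_TypeE; have [<-|bb] := eqVneq b b'; first by [].
split=> [[u ub D]|E]; last by move: bb; case: (b) (b') E => -[].
by case: (Dnb u) => //; move: bb; rewrite ub; case: (b) (b') => -[].
Qed.

Section Geometry.
Variables (th : collineation F) (b : bool).
Hypothesis dom : domestic b th.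
Let f := cact th.

Lemma fadj u v : adj (f u) (f v) <-> adj u v. Proof. exact: adj_cact. Qed.
Lemma finj : injective f. Proof. exact: cact_inj. Qed.

(** If either conclusion failed, thickness would supply a non-stammering path of length 6 from a
    vertex of sort [b] to its image. *)
Lemma dom_mid4 a x2 x3 x4 : isP a = b -> adj a x2 -> adj x2 x3 -> adj x3 x4 ->
  adj x4 (f a) -> a <> x3 -> x2 <> x4 -> x3 <> f a -> f x2 = x4 /\ f x3 = x3.
Proof.
move=> ab a2 A23 A34 A4a n1 n2 n3.
have E : f x2 = x4.
  apply: NNPP => N; have [a' [A2a' na' n3']] := thick x2 a x3.
  apply: (@dom a'); first by rewrite (isP_adj A2a') (isP_adj a2) negbK.
  apply: (@dist_list6 a' x2 x3 x4 (f a) (f x2) (f a')) => //.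
  - exact/adj_sym.
  - exact/fadj.
  - exact/fadj.
  - by move=> /esym.
  - by move/finj => /esym.
split=> //; apply: NNPP => N.
have [b' [A3b' nb2 nb4]] := thick x3 x2 x4.
have [a' [Aba' na3 _]] := thick b' x3 x3.
apply: (@dom a').
  by rewrite (isP_adj Aba') (isP_adj A3b') (isP_adj A23) (isP_adj a2) !negbK.
apply: (@dist_list6 a' b' x3 x4 (f x3) (f b') (f a')) => //.
- exact/adj_sym.
- exact/adj_sym.
- by rewrite -E; exact/fadj.
- exact/fadj.
- exact/fadj.
- by move=> /esym.
- by rewrite -E => /finj /esym.
- by move/finj => /esym.
Qed.

(** The walk from [p 1] along [p] to [p 6] and on to [f (p 1)] has length 6 between a vertex of sort
    [b] and its image, so it must stammer, at its last step. The inner four steps then fall under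
    [dom_mid4]. *)
Lemma dom_path u p : isP u = ~~ b -> nspath p 6%N -> p 0%N = u -> p 6%N = f u ->
  [/\ f (p 1%N) = p 5%N, f (p 2%N) = p 4%N & f (p 3%N) = p 3%N].
Proof.
move=> ub [A N] p0 p6.
have P1 : isP (p 1%N) = b by rewrite (isP_adj (A 0%N isT)) p0 ub negbK.
have E1 : f (p 1%N) = p 5%N.
  apply: NNPP => N1; apply: (@dom (p 1%N)) => //.
  apply: (@dist_list6 _ (p 2%N) (p 3%N) (p 4%N) (p 5%N) (p 6%N)); try exact: A; try exact: N.
    by rewrite p6 -p0; apply/fadj; exact: A.
  by move/esym.
have [] := @dom_mid4 (p 1%N) (p 2%N) (p 3%N) (p 4%N); rewrite ?E1 //; try exact: A; try exact: N.
Qed.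

(** If [w] moved, a vertex [y] two steps beyond [w] would be joined to its image by a path of length
    6 with [u] in the middle. For [b] true this is the fullness of the fixed subhexagon. *)
Lemma dom_full u : isP u = ~~ b -> f u = u -> forall w, adj u w -> f w = w.
Proof.
move=> ub fu w uw; apply: NNPP => N.
have [x [wx xu _]] := thick w u u; have [y [xy yw _]] := thick x w w.
apply: (@dom y).
  by rewrite (isP_adj xy) (isP_adj wx) (isP_adj uw) ub !negbK.
apply: (@dist_list6 y x w u (f w) (f x) (f y)) => //; try exact/fadj.
- exact/adj_sym.
- exact/adj_sym.
- exact/adj_sym.
- by rewrite -fu; exact/fadj.
- by move/esym.
- by rewrite -{1}fu => /finj /esym.
- by move/finj/esym.
Qed.

Lemma dom_near u : isP u = b ->
  [\/ f u = u, exists2 x, adj u x & f x = x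
    | exists2 x, isP x = b /\ dist 2 u x & f x = x].
Proof.
move=> ub; have [k k6 [p [[A N] p0 pk]]] := dist_ex u (f u).
have ek : ~~ odd k.
  have /isP_dist : dist k u (f u) by exists p.
  by rewrite /f isP_cact ub; case: (odd k) (b) => -[].
case: k k6 ek A N pk => [|[|[|[|[|[|[|k]]]]]]] // _ _ A N pk.
- by constructor 1; rewrite -pk p0.
- constructor 2; exists (p 1%N); first by rewrite -p0; exact: A.
  apply: NNPP => N1.
  have Nu : p 0%N <> p 2%N by exact: (N 0%N isT).
  have A01 := A 0%N isT; have A12 := A 1%N isT; rewrite p0 pk in A01 A12 Nu.
  (* If [p 1] moved, then [a'], [p 1], [f u], [f (p 1)], [f a'] would be a path to which [dom_mid4]
     applies; it would fix [f u] and hence [u]. *)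
  have [a' [A1a' na' na2]] := thick (p 1%N) u (f u).
  have A1f : adj (f u) (f (p 1%N)) by exact/fadj.
  have [] := @dom_mid4 a' (p 1%N) (f u) (f (p 1%N)) => //.
  + by rewrite (isP_adj A1a') (isP_adj A01) negbK.
  + exact/adj_sym.
  + exact/fadj.
  + by move/esym.
  + by move/finj/esym.
  + by move=> _ /finj /esym.
- constructor 3; exists (p 2%N).
    have D : dist 2 u (p 2%N) by exists p; split=> //; split=> i Hi; [apply: A | apply: N]; lia.
    by split=> //; rewrite (isP_dist D) ub.
  have [] := @dom_mid4 u (p 1%N) (p 2%N) (p 3%N) => //; rewrite -?pk -?p0; try exact: A; try exact: N.
- by case: (dom ub); exists p; split.
Qed.

Lemma dom_large u : exists2 v, f v = v & within 3 u v.
Proof.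
have near u' : isP u' = b -> exists2 v, f v = v & exists2 k, (k <= 2)%N & dist k u' v.
  move=> /dom_near[E|[x ux E]|[x [_ D] E]].
  - by exists u' => //; exists 0%N => //; exact: dist_refl.
  - exists x => //; exists 1%N => //.
    by exists (fun i => if i is 0 then u' else x); split=> //; split=> -[].
  - by exists x => //; exists 2%N.
have [ub|ub] := eqVneq (isP u) b.
  have [v fv [k k2 D]] := near u ub.
  by exists v => //; apply/within_dist => //; exists k => //; exact: leq_trans k2 _.
have [w [uw _ _]] := thick u u u.
have [|v fv [k k2 D]] := near w.
  by rewrite (isP_adj uw); move: ub; case: (isP u) (b) => -[].
exists v => //; right; exists w; split=> //; split=> //.
by apply/(proj2 (within_dist w v (isT : 2 <= 6)%N)); exists k.
Qed.

Lemma fix_path n p : nspath p n -> (n <= 5)%N -> f (p 0%N) = p 0%N -> f (p n) = p n ->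
  forall i, (i <= n)%N -> f (p i) = p i.
Proof.
by move=> np n5 E0 En; apply: path_uniq => //; exact: cact_nspath.
Qed.

Section NoFixed.
Hypothesis nofix : forall u, isP u = ~~ b -> f u <> u.

(** At distance less than 6 the joining path is unique, hence fixed, and its second vertex would be
    a fixed one of the other sort. *)
Lemma ovoid_opp u v : isP u = b -> isP v = b -> f u = u -> f v = v -> u <> v -> dist 6 u v.
Proof.
move=> ub vb fu fv uv; have [k k6 D] := dist_ex u v.
have ek : ~~ odd k by move: (isP_dist D); rewrite ub vb; case: (odd k) (b) => -[].
have [k5|k5] := ltnP 5 k; first by rewrite (_ : 6%N = k) //; lia.
case: k k6 ek k5 D => [|k] k6 ek k5 [p [np p0 pk]]; first by case: uv; rewrite -p0.
case: (@nofix (p 1%N)).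
  by rewrite (isP_adj (proj1 np 0%N isT)) p0 ub.
by apply: (fix_path np k5); rewrite ?p0 ?pk.
Qed.

Lemma ovoid_near u : exists v, [/\ isP v = b, f v = v & within 3 u v].
Proof.
have near u' : isP u' = b ->
    exists v, [/\ isP v = b, f v = v & exists2 k, (k <= 2)%N & dist k u' v].
  move=> ub; case/dom_near: (ub) => [E|[x ux E]|[x [xb D] E]].
  - by exists u'; split=> //; exists 0%N => //; exact: dist_refl.
  - by case: (@nofix x) => //; rewrite (isP_adj ux) ub.
  - by exists x; split=> //; exists 2%N.
have [ub|ub] := eqVneq (isP u) b.
  have [v [vb fv [k k2 D]]] := near u ub.
  by exists v; split=> //; apply/within_dist => //; exists k => //; exact: leq_trans k2 _.
have [w [uw _ _]] := thick u u u.
have [|v [vb fv [k k2 D]]] := near w.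
  by rewrite (isP_adj uw); move: ub; case: (isP u) (b) => -[].
exists v; split=> //; right; exists w; split=> //; split=> //.
by apply/(proj2 (within_dist w v (isT : 2 <= 6)%N)); exists k.
Qed.
End NoFixed.
End Geometry.
End Domestic.

(** * The fixed structure as a subhexagon *)

Section Subhexagon.
Variable F : fieldType.
Implicit Types (u v w x y : vtx F) (p q : nat -> vtx F) (th : collineation F).

Lemma nspath_cat p m q n : nspath p m -> nspath q n -> p m = q 0%N ->
  (m = 0%N \/ n = 0%N \/ p m.-1 <> q 1%N) ->
  nspath (fun i => if (i <= m)%N then p i else q (i - m)%N) (m + n).
Proof.
move=> [A B] [A' B'] E N.
have Q i : (m <= i)%N -> (if (i <= m)%N then p i else q (i - m)%N) = q (i - m)%N.
  by move=> mi; case: leqP => // im; rewrite (_ : i = m) ?subnn //; lia.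
split=> i Hi /=.
  have [im|im] := ltnP i m; first by rewrite (ltnW im); exact: A.
  by rewrite !Q ?(leqW im) // subSn //; apply: A'; lia.
have [im|im] := ltnP i.+1 m.
  by rewrite (ltnW (ltnW im)); apply: B.
have [im'|im'] := ltnP i m; last first.
  by rewrite Q // (_ : (i.+2 - m = (i - m).+2)%N); [apply: B'|]; lia.
have Em : m = i.+1 by lia.
rewrite (ltnW im').
have -> : (i.+2 - m = 1)%N by lia.
have -> : i = m.-1 by lia.
by case: N => [|[|//]]; lia.
Qed.

Lemma ap_inj i j : (i < j)%N -> (j < 12)%N -> ap F i <> ap F j.
Proof.
move=> ij j12 E; have [d6|d6] := leqP (j - i) 6.
  have := dist_ap F i (j - i); rewrite addn0 subnKC; last exact: ltnW.
  by rewrite -E => D; have := dist_uniq D (dist_refl _); lia.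
have := dist_ap F j (12 - (j - i)); rewrite addn0 (_ : (j + _ = i + 12)%N); last by lia.
by rewrite ap12 E => D; have := dist_uniq D (dist_refl _); lia.
Qed.

Lemma chainP_nth d l x i : chainP x l -> (i < size l)%N ->
  adj (nth d (x :: l) i) (nth d (x :: l) i.+1).
Proof.
by elim: l x i => [|y l IH] x [|i] //= [Axy Al] Hi //; exact: (IH y i).
Qed.

(** Antipodal vertices of such a polygon would be joined by two different paths of length [k], at
    most 5. *)
Lemma no_small_ngon (Y : vtx F -> Prop) k l : (2 <= k < 6)%N -> ~ ngon_in Y k l.
Proof.
move=> /andP[k2 k6] [sl [Ul [_ Cl]]].
case: l sl Ul Cl => [|x l] //= sl Ul [Al Ax].
pose p := nth x (x :: l).
have Pinj i j : (i < 2 * k)%N -> (j < 2 * k)%N -> p i = p j -> i = j.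
  have nthE m : (m < 2 * k)%N -> p m = List.nth m (x :: l) x.
    by move=> _; rewrite /p; elim: (x :: l) m => [|y s IH] [|m] //=.
  have lenE : length (x :: l) = (2 * k)%N by rewrite -sl; elim: (l) => //= ? ? ->.
  move=> Hi Hj; rewrite !nthE // => E.
  by apply: (proj1 (List.NoDup_nth (x :: l) x) Ul) => //; rewrite lenE; apply/ltP.
have PA i : (i.+1 < 2 * k)%N -> adj (p i) (p i.+1).
  by rewrite -sl ltnS; exact: chainP_nth.
have Plast : adj (p (2 * k).-1) (p 0%N).
  by rewrite -sl /p /= nth_last.
have np : nspath p k.
  split=> i Hi; first by apply: PA; lia.
  by move/Pinj; lia.
have nq : nspath (fun i => if i is 0 then p 0%N else p (2 * k - i)%N) k.
  split=> -[|i] Hi.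
  - by apply/adj_sym; rewrite subn1.
  - by apply/adj_sym; rewrite (_ : (2 * k - i.+1 = (2 * k - i.+2).+1)%N); [apply: PA|]; lia.
  - by move/Pinj; lia.
  - by move/Pinj; lia.
have Ek : p k = (if k is 0 then p 0%N else p (2 * k - k)%N).
  by case: (k) k2 => // k' _; congr p; lia.
have k1 : (1 <= k)%N by exact: ltnW.
by have /Pinj := path_uniq np nq (k6 : k <= 5)%N erefl Ek k1; lia.
Qed.

Section Fix.
Variables th phi : collineation F.
Let f := cact th.
Let e i := cact phi (ap F i).
Hypothesis fe : forall i, f (e i) = e i.

Lemma e_nspath m n : nspath (fun i => e (m + i)%N) n.
Proof. exact/cact_nspath/ap_nspath. Qed.

Lemma e_nspath_rev m n : (n <= m)%N -> nspath (fun i => e (m - i)%N) n.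
Proof.
move=> nm; have [A B] := nspath_rev (e_nspath (m - n) n).
split=> i Hi.
  by have := A i Hi; rewrite !(_ : forall j, (j <= n)%N -> (m - n + (n - j) = m - j)%N) //; lia.
have := B i Hi; rewrite !(_ : forall j, (j <= n)%N -> (m - n + (n - j) = m - j)%N) //; lia.
Qed.

(** A shortest path to [e 12] is continued along the fixed apartment, in a direction that does not
    turn back, to length 6. Starting from 12 leaves room on both sides, and a positive index has a
    genuine predecessor for [fix_two]. *)
Lemma fix_opp u : exists i, (0 < i)%N /\ dist 6 u (e i).
Proof.
have [k k6 [p [np p0 pk]]] := dist_ex u (e 12%N).
have E6 : (k + (6 - k) = 6)%N by lia.
have [E|N] := classic (k <> 0%N /\ p k.-1 = e 13%N); last first.
  exists (12 + (6 - k))%N; split=> //.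
  exists (fun i => if (i <= k)%N then p i else e (12 + (i - k))%N); split.
  - have := nspath_cat np (e_nspath 12 (6 - k)); rewrite addn0 E6; apply=> //.
    by case: (k) N => [|k'] N; [left | right; right=> E; apply: N].
  - exact: p0.
  - case: leqP => // k6'; have Ek : k = 6%N by lia.
    by rewrite Ek in pk *; rewrite pk.
exists (12 - (6 - k))%N; split; first by lia.
exists (fun i => if (i <= k)%N then p i else e (12 - (i - k))%N); split.
- have H : (6 - k <= 12)%N by lia.
  have := nspath_cat np (e_nspath_rev H); rewrite subn0 E6; apply=> //.
  right; right; rewrite (proj2 E) => /cact_inj.
  by rewrite (ap12 F 1); exact: ap_inj.
- exact: p0.
- case: leqP => // k6'; have Ek : k = 6%N by lia.
  by rewrite Ek in pk *; rewrite pk.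
Qed.

(** Both apartment neighbours of an opposite [e i] are joined to [u] by unique, hence fixed, paths
    of length 5. These arrive through different neighbours of [u], for otherwise two paths of length
    5 would join [e i] to the same vertex. *)
Lemma fix_two u : f u = u -> forall w, exists x, [/\ adj u x, f x = x & x <> w].
Proof.
move=> fu w; have [i [i0 D]] := fix_opp u.
have nbr j : j = i.+1 \/ j.+1 = i -> exists2 p, nspath p 5 &
    [/\ p 0%N = e j, p 5%N = u, adj (e i) (e j) & e i <> p 1%N].
  move=> ji; have A : adj (e i) (e j).
    case: ji => [->|<-]; first by apply/adj_cact; exact: adj_ap.
    by apply/adj_sym/adj_cact; exact: adj_ap.
  have [k k6 [p [np p0 pk]]] := dist_ex (e j) u.
  have ok : odd k.
    have Dk : dist k (e j) u by exists p.
    have := isP_dist Dk; have := isP_dist D; have := isP_adj A.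
    by move=> -> ->; case: isP; case: odd.
  have [E|N] := classic (e i = p 1%N).
    case: k k6 ok np pk => [|k] // k6 ok np pk.
    have Dk : dist k (e i) u.
      by exists (fun i => p (1 + i)%N); split=> //; apply: nspath_shift; rewrite addn1.
    by have := dist_uniq Dk (dist_sym D); lia.
  have Dk : dist k.+1 (e i) u by apply: (dist_cons np p0 pk A); right.
  have k5 : (k.+1 <= 6)%N by case: (ltngtP k 6) ok k6 => // ->.
  have E : k = 5%N by have := dist_uniq Dk (dist_sym D) k5 isT; lia.
  by rewrite E in np pk; exists p.
have [p np [p0 p5 Ap np1]] := nbr i.+1 (or_introl erefl).
have [q nq [q0 q5 Aq nq1]] := nbr i.-1 (or_intror (prednK i0)).
have fp : f (p 4%N) = p 4%N by apply: (fix_path np); rewrite ?p0 ?p5.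
have fq : f (q 4%N) = q 4%N by apply: (fix_path nq); rewrite ?q0 ?q5.
have up : adj u (p 4%N) by rewrite -p5; apply/adj_sym; exact: (proj1 np).
have uq : adj u (q 4%N) by rewrite -q5; apply/adj_sym; exact: (proj1 nq).
have pq : p 4%N <> q 4%N.
  move=> E4; have cons r : nspath r 5 -> adj (e i) (r 0%N) -> e i <> r 1%N ->
      nspath (fun j => if j is j'.+1 then r j' else e i) 5.
    by move=> nr Ar r1; apply: nspath_cons => //; [exact: nspath_le nr | right].
  have := path_uniq (cons p np _ np1) (cons q nq _ nq1) isT erefl E4 (i := 1%N).
  rewrite p0 q0 => /(_ Ap Aq isT) /cact_inj; apply: nesym.
  by rewrite -[i in i.+1]prednK //; exact: ap_neq2.
have [E|N] := classic (p 4%N = w); last by exists (p 4%N).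
by exists (q 4%N); split=> //; rewrite -E; exact: nesym.
Qed.

(** Opposite vertices have many joining paths; one that starts with a fixed neighbour of [u] is
    unique from there on, and therefore fixed. *)
Lemma fix_path_ex u v : f u = u -> f v = v -> exists2 k, (k <= 6)%N &
  exists2 p, nspath p k & [/\ p 0%N = u, p k = v & forall i, (i <= k)%N -> f (p i) = p i].
Proof.
move=> fu fv; have [k k6 [p [np p0 pk]]] := dist_ex u v.
have [k5|k5] := leqP k 5.
  exists k => //; exists p => //; split=> //.
  by apply: (fix_path np k5); rewrite ?p0 ?pk.
have Ek : k = 6%N by lia.
rewrite {}Ek {k6 k5} in np pk.
have [x [ux fx xp]] := fix_two fu (p 1%N).
have [m m6 [q [nq q0 qm]]] := dist_ex x v.
have D : dist 6 u v by exists p.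
have om : odd m.
  have Dm : dist m x v by exists q.
  have := isP_dist Dm; have := isP_dist D; have := isP_adj ux.
  by move=> -> -> /=; case: (isP u); case: (odd m).
have m5 : (m <= 5)%N by case: (ltngtP m 6) om m6 => // ->.
exists m.+1; first by [].
exists (fun i => if i is i'.+1 then q i' else u).
  apply: nspath_cons => //; first by rewrite q0.
  case: (m) nq qm m5 => [|m'] nq qm m5; [by left | right=> E].
  have D4 : dist m' u v.
    by rewrite E; exists (fun i => q (1 + i)%N); split=> //; apply: nspath_shift; rewrite addn1.
  by have := dist_uniq D4 D; lia.
split=> // -[|i] Hi //.
by apply: (fix_path nq m5); rewrite ?q0 ?qm.
Qed.

Lemma fix_extend n p : nspath p n -> (forall i, (i <= n)%N -> f (p i) = p i) ->
  forall m, (n <= m)%N -> exists2 q, nspath q m &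
    (forall i, (i <= n)%N -> q i = p i) /\ (forall i, (i <= m)%N -> f (q i) = q i).
Proof.
move=> np fp m; elim: m => [|m IH] nm.
  by move: nm np fp; rewrite leqn0 => /eqP-> np fp; exists p.
have [E|mn] := eqVneq n m.+1; first by exists p; rewrite -?E.
have [|q nq [qp fq]] := IH; first by lia.
have [x [qx fx xq]] := fix_two (fq m (leqnn m)) (q m.-1).
exists (fun i => if i == m.+1 then x else q i).
  by apply: nspath_snoc => //; right.
split=> i Hi; first by rewrite (_ : (i == m.+1) = false) ?qp //; lia.
by case: eqP => // N; apply: fq; lia.
Qed.

Lemma circuit_map (s : nat -> vtx F) :
  (forall i, (i < 11)%N -> adj (s i) (s i.+1)) -> adj (s 11%N) (s 0%N) ->
  circuit [seq s i | i <- iota 0 12].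
Proof. by move=> A A11; split=> //=; do !split; try exact: A. Qed.

Lemma in_map_iota (s : nat -> vtx F) n k : (k < n)%N -> List.In (s k) [seq s i | i <- iota 0 n].
Proof.
move=> kn; have : k \in iota 0 n by rewrite mem_iota.
by elim: (iota 0 n) => //= i l IH; rewrite inE => /orP[/eqP ->|/IH]; auto.
Qed.

Lemma NoDup_map_iota (s : nat -> vtx F) m n :
  (forall i j, (i < j)%N -> (j < m + n)%N -> s i <> s j) ->
  List.NoDup [seq s i | i <- iota m n].
Proof.
elim: n m => [|n IH] m H /=; first exact: List.NoDup_nil.
apply: List.NoDup_cons; last by apply: IH => i j ij jn; apply: H => //; lia.
have : all (fun i => (m < i < m + n.+1)%N) (iota m.+1 n).
  by apply/allP => i; rewrite mem_iota; lia.
elim: (iota m.+1 n) => [_ []|i l IHl /andP[/andP[mi im] al] [E|]]; last exact: (IHl al).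
by case: (H m i mi im).
Qed.

Lemma Forall_map_iota (s : nat -> vtx F) (Y : vtx F -> Prop) n :
  (forall i, (i < n)%N -> Y (s i)) -> List.Forall Y [seq s i | i <- iota 0 n].
Proof.
move=> H; have : all (fun i => (i < n)%N) (iota 0 n).
  by apply/allP => i; rewrite mem_iota.
elim: (iota 0 n) => [_|i l IH /andP[iN al]]; first exact: List.Forall_nil.
by apply: List.Forall_cons; [exact: H | exact: IH].
Qed.

(** A fixed path through both vertices is prolonged to length 7 and placed in a 12-cycle by
    transitivity. The five missing steps form the unique path between two fixed vertices and are
    fixed too. *)
Lemma fix_hexagon u v : f u = u -> f v = v ->
  exists l, ngon_in (fun u => f u = u) 6 l /\ List.In u l /\ List.In v l.
Proof.
move=> fu fv; have [k k6 [p np [p0 pk fp]]] := fix_path_ex fu fv.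
have [q nq [qp fq]] := fix_extend np fp (leqW k6).
have [s [Es s12 Ss Ns]] : exists s : nat -> vtx F, [/\ forall i, (i <= 7)%N -> q i = s i,
    s 12%N = s 0%N, forall m n, (m + n <= 12)%N -> nspath (fun i => s (m + i)%N) n
    & forall i j, (i < j)%N -> (j < 12)%N -> s i <> s j].
  have [h [E|E]] := vtx_rep (q 0%N).
    have [g Eg] := transit_pt nq isT E; exists (fun i => av g (ap F (13 - i)%N)); split=> //.
    - by rewrite (ap12 F 1).
    - move=> m n mn; apply: cact_nspath; have [A B] := nspath_rev (ap_nspath F (13 - m - n) n).
      split=> i Hi; [have := A i Hi | have := B i Hi].
        by rewrite !(_ : forall j, (j <= n)%N -> (13 - m - n + (n - j) = 13 - (m + j))%N) //; lia.
      by rewrite !(_ : forall j, (j <= n)%N -> (13 - m - n + (n - j) = 13 - (m + j))%N) //; lia.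
    - move=> i j ij j12 /av_inj /esym; case: i ij => [|[|i]] ij.
      + rewrite (ap12 F 1); have [->|j1] := eqVneq j 1%N.
          by rewrite (ap12 F 0); apply: ap_inj.
        by move/esym; apply: ap_inj; lia.
      + by rewrite (ap12 F 0) => /esym; apply: ap_inj; lia.
      + by apply: ap_inj; lia.
  have [g Eg] := transit_ln nq isT E; exists (fun i => av g (ap F i)); split=> //.
  - by rewrite (ap12 F 0).
  - by move=> m n _; apply: cact_nspath; exact: ap_nspath.
  - by move=> i j ij j12 /av_inj; exact: ap_inj.
have fs i : (i <= 12)%N -> f (s i) = s i.
  move=> i12; have [i7|i7] := leqP i 7; first by rewrite -Es // fq.
  have f7 : f (s 7%N) = s 7%N by rewrite -Es // fq.
  have f12 : f (s 12%N) = s 12%N by rewrite s12 -Es // fq.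
  have := fix_path (Ss 7%N 5%N isT) isT f7 f12 (i := (i - 7)%N).
  by rewrite subnKC; [apply; lia | lia].
exists [seq s i | i <- iota 0 12]; split; last split.
- split; first by rewrite size_map size_iota.
  split; first by apply: NoDup_map_iota.
  split; first by apply: Forall_map_iota => i Hi; apply: fs; exact: ltnW.
  have [A _] := Ss 0%N 12%N isT.
  apply: circuit_map => [i Hi|]; first by apply: A; lia.
  by rewrite -s12; exact: A.
- by rewrite -p0 -qp // Es //; exact: in_map_iota.
- by rewrite -pk -qp // Es ?(leqW k6) //; apply: in_map_iota; lia.
Qed.

End Fix.
End Subhexagon.

(** * Rigidity and normal forms *)

Section Rigidity.
Variable F : fieldType.
Implicit Types (t a b c d : F) (u v w x y : vtx F) (p q : nat -> vtx F) (th : collineation F).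

Lemma dist_step k u v w : dist k u v -> (k <= 6)%N -> adj v w ->
  (k < 6)%N /\ dist k.+1 u w \/ (0 < k)%N /\ dist k.-1 u w.
Proof.
move=> D k6 vw; have [m m6 D'] := dist_ex u w.
have [p [np p0 pk]] := D.
have [[k0 E]|N] := classic ((0 < k)%N /\ w = p k.-1).
  right; split=> //; exists p; split=> //; apply: nspath_le np; exact: leq_pred.
have np' : nspath (fun i => if i == k.+1 then w else p i) k.+1.
  apply: nspath_snoc => //; first by rewrite pk.
  by case: (k) N => [|k'] N; [left | right=> E; apply: N].
have [k5|k5] := ltnP k 6.
  by left; split=> //; exists (fun i => if i == k.+1 then w else p i); rewrite eqxx; split.
right; split; first by lia.
have Ek : k = 6%N by lia.
have pm : odd m = true.
  by move: (isP_dist D'); rewrite (isP_adj vw) (isP_dist D) Ek /=; case: isP; case: (odd m).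
have m5 : (m <= 5)%N by case: (ltngtP m 6) pm m6 => // ->.
have [q [nq q0 qm]] := dist_sym D'.
have [mE|mE] := eqVneq m 5%N; first by rewrite Ek -mE.
have m3 : (m.+1 < 6)%N by case: (m) mE m5 pm => [|[|[|[|[|[|m']]]]]].
have [E1|N1] := classic (m <> 0%N /\ v = q 1%N).
  have [k' k'6 Dk'] : exists2 k', (k' < 6)%N & dist k' v u.
    exists m.-1; first by lia.
    case: E1 => m0 ->; exists (fun i => q (1 + i)%N); split; rewrite ?addn0 //.
      by apply: nspath_shift; rewrite addn1 prednK //; lia.
    by rewrite add1n prednK //; lia.
  by have := dist_uniq Dk' (dist_sym D); lia.
have Dv : dist m.+1 v u.
  apply: (dist_cons nq q0 qm vw).
  by case: (m) N1 => [|m'] N1; [left | right=> E; apply: N1].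
by have := dist_uniq Dv (dist_sym D); lia.
Qed.

Lemma dist_adj6 u v w : dist 6 u v -> adj v w -> dist 5 u w.
Proof. by move=> D vw; case: (dist_step D isT vw) => -[]. Qed.

Lemma dist4_uniq u v w w' : dist 5 u v -> adj v w -> adj v w' -> dist 4 u w ->
  dist 4 u w' -> w = w'.
Proof.
move=> D vw vw' D4 D4'.
have ext x : adj v x -> dist 4 u x -> exists q, nspath q 5 /\ [/\ q 0%N = u, q 4%N = x & q 5%N = v].
  move=> vx [p [np p0 p4]]; exists (fun i => if i == 5%N then v else p i); split=> //.
  apply: nspath_snoc => //; first by rewrite p4; exact/adj_sym.
  right=> E; have D3 : dist 3 u v by exists p; split=> //; exact: nspath_le np.
  by have := dist_uniq D D3 isT isT.
have [p [np [p0 p4 p5]]] := ext w vw D4; have [q [nq [q0 q4 q5]]] := ext w' vw' D4'.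
by rewrite -p4 -q4; apply: (path_uniq np nq); rewrite ?p0 ?q0 ?p5 ?q5.
Qed.

Lemma connected (R : vtx F -> Prop) u : (forall u v, R u -> adj u v -> R v) ->
  R u -> forall v, R v.
Proof.
move=> RA Ru v; have [k _ [p [[A _] p0 <-]]] := dist_ex u v.
elim: k A => [|k IH] A; first by rewrite p0.
by apply: (RA (p k)); [apply: IH => i Hi; apply: A; exact: ltnW | exact: A].
Qed.

Section Full.
Variable th : collineation F.
Let f := cact th.
Definition full_at u := f u = u /\ forall w, adj u w -> f w = w.

(** Each neighbour of [v] lies on the unique path of length 5 from [v] to some neighbour of [u], and
    both ends of that path are fixed. *)
Lemma full_opp u v : full_at u -> f v = v -> dist 6 u v -> full_at v.
Proof.
move=> [fu Fu] fv D; split=> // w vw.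
have [p [np p0 p5]] := dist_adj6 D vw.
have N : v <> p 4%N.
  move=> E; have D4 : dist 4 u v by exists p; split=> //; exact: nspath_le np.
  by have := dist_uniq D D4 isT isT.
have np' : nspath (fun i => if i == 6%N then v else p i) 6.
  by apply: nspath_snoc => //; [rewrite p5; exact/adj_sym | right].
have ns := nspath_shift (n := 5) (m := 1) np'.
have f1 : f (p 1%N) = p 1%N by apply: Fu; rewrite -p0; exact: (proj1 np).
by rewrite -p5; apply: (fix_path ns isT f1 fv (i := 4%N)).
Qed.

(** Neighbours of [u] and of [v] are opposite unless matched by projection, and [full_opp] carries
    fullness across opposite pairs. From [w] one reaches [x] through [y], or by the zigzag [y],
    [x'], [y5]; three neighbours at each vertex are enough for it. *)
Lemma full_nbrs u w v : full_at u -> adj u w -> full_at w -> f v = v -> dist 6 u v ->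
  forall x, adj u x -> full_at x.
Proof.
move=> Fu uw Fw fv D.
have Fv : full_at v := full_opp Fu fv D.
have D5 x : adj u x -> dist 5 x v by move=> ux; exact/dist_sym/(dist_adj6 (dist_sym D) ux).
have D46 x y : adj u x -> adj v y -> dist 6 x y \/ dist 4 x y.
  by move=> ux vy; case: (dist_step (D5 x ux) isT vy) => -[_ H]; [left | right].
have uq x y y' : adj u x -> adj v y -> adj v y' -> dist 4 x y -> dist 4 x y' -> y = y'.
  by move=> ux; exact: dist4_uniq (D5 x ux).
have uq' x x' y : adj u x -> adj u x' -> adj v y -> dist 4 x y -> dist 4 x' y -> x = x'.
  move=> ux ux' vy /dist_sym H /dist_sym H'.
  exact: (dist4_uniq (dist_sym (dist_adj6 D vy)) ux ux' H H').
have [y [vy Dwy]] : exists y, adj v y /\ dist 6 w y.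
  have [y1 [vy1 _ _]] := thick v v v.
  case: (D46 w y1 uw vy1) => [H|H]; first by exists y1.
  have [y2 [vy2 n12 _]] := thick v y1 y1; exists y2; split=> //.
  by case: (D46 w y2 uw vy2) => // H'; case: n12; exact: (uq w).
have Fy : full_at y by apply: (full_opp Fw _ Dwy); apply: (proj2 Fv).
have F6 x : adj u x -> dist 6 x y -> full_at x.
  by move=> ux Dx; apply: (full_opp Fy _ (dist_sym Dx)); apply: (proj2 Fu).
move=> x ux; case: (D46 x y ux vy) => [|Dx]; first exact: F6.
have [y5 [vy5 n5 _]] := thick v y y.
have Dx5 : dist 6 x y5.
  by case: (D46 x y5 ux vy5) => // H; case: n5; exact: (uq x).
have [x' [ux' xx' D6']] : exists x', [/\ adj u x', x' <> x & dist 6 x' y5].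
  have [x1 [ux1 n1 _]] := thick u x x.
  case: (D46 x1 y5 ux1 vy5) => [H|H]; first by exists x1.
  have [x2 [ux2 n2 n2']] := thick u x x1; exists x2; split=> //.
  by case: (D46 x2 y5 ux2 vy5) => // H'; case: n2'; exact: (uq' x2 x1 y5).
have Fx' : full_at x'.
  by apply: F6 => //; case: (D46 x' y ux' vy) => // H; case: xx'; exact: (uq' x' x y).
have Fy5 : full_at y5 by apply: (full_opp Fx' _ D6'); apply: (proj2 Fv).
by apply: (full_opp Fy5 _ (dist_sym Dx5)); apply: (proj2 Fu).
Qed.

(** Being full, with a full neighbour and a fixed opposite vertex, is a property that passes to
    neighbours, so it spreads over the connected hexagon. *)
Lemma rigid u w v : full_at u -> adj u w -> full_at w -> f v = v -> dist 6 u v ->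
  forall x, f x = x.
Proof.
move=> Fu uw Fw fv D x.
pose R u := [/\ full_at u, exists2 w, adj u w & full_at w & exists2 v, f v = v & dist 6 u v].
suff [[]] : R x by [].
apply: (@connected R u); last by split=> //; [exists w | exists v].
move=> u' x' [Fu' [w' uw' Fw'] [v' fv' D']] ux'.
have Fx' := full_nbrs Fu' uw' Fw' fv' D' ux'.
split=> //; first by exists u' => //; exact/adj_sym.
have Fv' := full_opp Fu' fv' D'.
have D5 : dist 5 x' v' by exact/dist_sym/(dist_adj6 (dist_sym D') ux').
have [y1 [vy1 _ _]] := thick v' v' v'.
case: (dist_step D5 isT vy1) => -[_ H]; first by exists y1 => //; apply: (proj2 Fv').
have [y2 [vy2 n12 _]] := thick v' y1 y1; exists y2; first by apply: (proj2 Fv').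
by case: (dist_step D5 isT vy2) => -[_ H'] //; case: n12; exact: (dist4_uniq D5).
Qed.
End Full.

Lemma cinv_ex th : exists th', cancel (cact th) (cact th') /\ cancel (cact th') (cact th).
Proof.
case: th => cp cl bp bl Hi; case: (bp) (bl) => gp Kp Kp' [gl Kl Kl'].
have bgp : bijective gp by exists cp.
have bgl : bijective gl by exists cl.
have Hg (p : Point F) (L : Line F) : incident p L <-> incident (gp p) (gl L).
  by rewrite -{1}[p]Kp' -{1}[L]Kl' -Hi.
exists (Coll bgp bgl Hg); split=> -[p|L]; rewrite /cact /=.
- by rewrite Kp.
- by rewrite Kl.
- by rewrite Kp'.
- by rewrite Kl'.
Qed.

Lemma ccomp_ex th th' : exists th'', forall u, cact th'' u = cact th (cact th' u).
Proof.
have bp : bijective (cpt th \o cpt th') by apply: bij_comp; exact: cpt_bij.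
have bl : bijective (cln th \o cln th') by apply: bij_comp; exact: cln_bij.
have Hi (p : Point F) (L : Line F) :
    incident p L <-> incident ((cpt th \o cpt th') p) ((cln th \o cln th') L).
  by rewrite /= -!c_inc.
by exists (Coll bp bl Hi) => -[p|L].
Qed.

Lemma rigid_eq th th' i : (forall j, cact th (ap F j) = cact th' (ap F j)) ->
  (forall w, adj (ap F i) w -> cact th w = cact th' w) ->
  (forall w, adj (ap F i.+1) w -> cact th w = cact th' w) ->
  forall u, cact th u = cact th' u.
Proof.
move=> Ea E0 E1 u; have [ti [K K']] := cinv_ex th'; have [tc Ec] := ccomp_ex ti th.
suff H : cact tc u = u by rewrite -(K' (cact th u)) -Ec H.
have fa j : cact tc (ap F j) = ap F j by rewrite Ec Ea K.
apply: (@rigid tc (ap F i) (ap F i.+1) (ap F (i + 6))) => //.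
- by split=> // w Aw; rewrite Ec E0 // K.
- exact: adj_ap.
- by split=> // w Aw; rewrite Ec E1 // K.
- by have := dist_ap F i 6; rewrite addn0.
Qed.

End Rigidity.

(** * Collineations fixing an apartment *)

Section Normal.
Variable F : fieldType.
Implicit Types (t a b c d : F) (u v w x y : vtx F) (p q : nat -> vtx F) (th : collineation F).

Lemma avH_ap c d (c0 : c != 0) (d0 : d != 0) i : av (H c0 d0) (ap F i) = ap F i.
Proof.
elim/ltn_ind: i c d c0 d0 => -[|[|i]] IH c d c0 d0.
- by rewrite ap0 avH_ln1.
- by rewrite ap1 avH_pt1.
- have [c1 [d1 [c10 [d10 E1]]]] := HS1 c0 d0; have [c2 [d2 [c20 [d20 E2]]]] := HS2 c10 d10.
  by rewrite apSS avM /rot gmulA E1 -gmulA E2 gmulA -avM IH.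
Qed.

Lemma vec10 t : X (Pos R12) t *m (rotn F 5 *m e0 F) = vec t 0 1 0 0 0 0.
Proof. by rewrite rot_vecs xr_R12; congr vec; ring. Qed.

Lemma inj12 t t' : av (X (Pos R12) t) (ap F 10) = av (X (Pos R12) t') (ap F 10) -> t = t'.
Proof.
have A : ap F 10 = ln (rotn F 5) by exact: ap_ln.
rewrite A !av_ln => /ln_rep[c _]; rewrite !(gvMv (X _ _)) !vec10 vec_lin1.
by move/vec_inj => [[-> _ + _] _]; rewrite mulr1 => <-; rewrite mul1r.
Qed.

Lemma move1 t : av (X alpha1 t) (ap F 2) = ap F 2 -> t = 0.
Proof.
have A : ap F 2 = ln (rotn F 1) by exact: ap_ln.
rewrite A !av_ln => /ln_rep[c _]; rewrite (gvMv (X _ _)) rot_vecs xr_R1 vec_lin1.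
move/vec_inj => [[E1 E2 _ _] _]; apply/eqP; move/eqP: E1.
by rewrite add0r mulrN1 mulrN eq_sym oppr_eq0 mulf_eq0 => /orP[/eqP c0|//]; move: E2;
  rewrite c0 mul0r => /eqP; rewrite oppr_eq0 oner_eq0.
Qed.

Lemma move2 t : av (X alpha2 t) (ap F 11) = ap F 11 -> t = 0.
Proof.
have A : ap F 11 = pt (rotn F 5) by exact: ap_pt.
rewrite A !av_pt => /esym/pt_rep[a [b [c [d [+ _]]]]].
rewrite (gvMv (X _ _)) !rot_vecs xr_R2 vec_lin => /vec_inj[[_ + _ _] _].
by rewrite !mulr0 addr0 add0r mulr1.
Qed.

Lemma X1_fix0 t w : adj (ap F 0) w -> av (X alpha1 t) w = w.
Proof.
rewrite ap0 => /nbr_ln1[->|[t' ->]]; first exact: avX_pt1.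
exact: avX_ptS2'.
Qed.

(** A root group fixes all neighbours of the inner vertices of its half-apartment. Two adjacent
    inner vertices, here [ap 11] and [ap 12], are what [rigid_eq] asks for. *)
Lemma X1_fix11 t w : adj (ap F 11) w -> av (X alpha1 t) w = w.
Proof.
case/nbrb => [->|[t' ->]]; first by rewrite (ap12 F 0) fixapP.
rewrite (ap12 F 10) -[ap F 10 in LHS](@fixapP F alpha1 10 (- t) isT).
have -> : av (X alpha1 t) (av (X (gb 11) t') (av (X alpha1 (- t)) (ap F 10))) =
  av (X alpha1 t · (X (Pos R12) t' · X alpha1 (- t))) (ap F 10) by rewrite !avM gmulA.
rewrite (_ : X (Pos R12) t' · X alpha1 (- t) = X alpha1 (- t) · X (Pos R12) t'
  · X (Pos R112) (- (2 * - t * t')) · X (Pos R11122) (- (3 * - t * t' ^+ 2))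
  · X (Pos R1112) (3 * (- t) ^+ 2 * t')); last by apply: gext; exact: comm_1_12.
rewrite !gmulA XD subrr X0 gone_mul -!avM.
by rewrite (@fixapP F (Pos R1112)) // (@fixapP F (Pos R11122)) // (@fixapP F (Pos R112)).
Qed.

Lemma X2_fix1 t w : adj (ap F 1) w -> av (X alpha2 t) w = w.
Proof.
rewrite ap1 => /nbr_pt1[->|[t' ->]]; first exact: avX_ln1.
exact: avX_lnS1'.
Qed.

Lemma X2_fix2 t w : adj (ap F 2) w -> av (X alpha2 t) w = w.
Proof.
case/nbrf => [->|[t' ->]]; first by rewrite (ap12 F 1) fixapP.
rewrite -[ap F 3 in LHS](@fixapP F alpha2 3 (- t) isT).
have -> : av (X alpha2 t) (av (X (gf 2) t') (av (X alpha2 (- t)) (ap F 3))) =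
  av (X alpha2 t · (X (Pos R1112) t' · X alpha2 (- t))) (ap F 3) by rewrite !avM gmulA.
rewrite (_ : X (Pos R1112) t' · X alpha2 (- t) = X alpha2 (- t) · X (Pos R1112) t'
  · X (Pos R11122) (- (- t * t'))); last by apply: gext; exact: comm_2_1112.
by rewrite !gmulA XD subrr X0 gone_mul -!avM (@fixapP F (Pos R11122)).
Qed.

Lemma fixap1 j : (7 <= j <= 13)%N -> fixap alpha1 j.
Proof. by do 14?[case: j => [|j]]. Qed.
Lemma fixap2 j : (j <= 6)%N -> fixap alpha2 j.
Proof. by do 7?[case: j => [|j]]. Qed.

Section Fixing.
Variable th : collineation F.
Hypothesis fa : forall i, cact th (ap F i) = ap F i.
Let f := cact th.
Let ffa i : f (ap F i) = ap F i := fa i.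

Lemma ccomp_av g : exists th', forall u, cact th' u = f (av g u).
Proof. exact: ccomp_ex. Qed.
Lemma av_comp g : exists th', forall u, cact th' u = av g (f u).
Proof. exact: ccomp_ex. Qed.

Lemma f_adj i w : adj (ap F i) w -> adj (ap F i) (f w).
Proof. by move=> A; rewrite -(fa i); apply/adj_cact. Qed.

Lemma path_agree m n (g h : vtx F -> vtx F) : (n <= 5)%N ->
  (forall p k, nspath p k -> nspath (fun i => g (p i)) k) ->
  (forall p k, nspath p k -> nspath (fun i => h (p i)) k) ->
  g (ap F m) = h (ap F m) -> g (ap F (m + n)%N) = h (ap F (m + n)%N) ->
  forall i, (i <= n)%N -> g (ap F (m + i)%N) = h (ap F (m + i)%N).
Proof.
move=> n5 gp hp Em En.
by apply: (path_uniq (gp _ _ (ap_nspath F m n)) (hp _ _ (ap_nspath F m n)) n5) => //;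
  rewrite addn0.
Qed.

(** The parameter [s] is read off at [ap 2]. Both sides agree there and on the half-apartment from
    [ap 7] to [ap 13], hence on the apartment, and on the neighbours of [ap 11] and [ap 12];
    rigidity does the rest. *)
Lemma sigma1 t : exists s, forall u, f (av (X alpha1 t) u) = av (X alpha1 s) (f u).
Proof.
have : adj (ap F 1) (f (av (X alpha1 t) (ap F 2))).
  by apply: f_adj; rewrite -(@fixapP F alpha1 1 t isT) adj_av; exact: adj_ap.
case/nbrf => [E|[s E]].
  have : av (X alpha1 t) (ap F 2) = ap F 0 by apply: (@cact_inj _ th); rewrite -/f E (ap12 F 0) ffa.
  rewrite -(@fixapP F alpha1 0 t isT) => /av_inj /esym; case/(ap_inj (isT : 0 < 2)%N isT).
exists s => u.
have [t1 E1] := ccomp_av (X alpha1 t); have [t2 E2] := av_comp (X alpha1 s).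
have E7 j : (7 <= j <= 13)%N -> cact t1 (ap F j) = cact t2 (ap F j).
  by move=> Hj; rewrite E1 E2 /f fa !fixapP ?fa // fixap1.
have E2' : cact t1 (ap F 2) = cact t2 (ap F 2) by rewrite E1 E2 ffa E.
rewrite -E1 -E2; apply: (@rigid_eq F t1 t2 11).
- move=> j; rewrite (divn_eq j 12) addnC; have : (j %% 12 < 12)%N by rewrite ltn_mod.
  have -> : forall m i, ap F (i + m * 12) = ap F i.
    by elim=> [|m IH] i; rewrite ?addn0 // mulSn addnA IH ap12.
  move: (j %% 12)%N => {}j j12.
  have [j7|j7] := leqP 7 j; first by apply: E7; lia.
  have [j2|j2] := leqP 2 j.
    rewrite -(subnKC j2); apply: (path_agree (m := 2) (n := 5)) => //; last by lia.
    - by move=> p k; exact: cact_nspath.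
    - by move=> p k; exact: cact_nspath.
    - exact: E7.
  by rewrite -ap12; apply: E7; lia.
- by move=> w A; rewrite E1 E2 (X1_fix11 _ A) (X1_fix11 _ (f_adj A)).
- move=> w; rewrite (ap12 F 0) => A.
  by rewrite E1 E2 (X1_fix0 _ A) (X1_fix0 _ (f_adj A)).
Qed.

Lemma sigma2 t : exists s, forall u, f (av (X alpha2 t) u) = av (X alpha2 s) (f u).
Proof.
have : adj (ap F 0) (f (av (X alpha2 t) (ap F 11))).
  apply: f_adj; rewrite -(@fixapP F alpha2 0 t isT) adj_av -(ap12 F 0).
  by apply/adj_sym; exact: adj_ap.
case/nbrb => [E|[s E]].
  have : av (X alpha2 t) (ap F 11) = ap F 1 by apply: (@cact_inj _ th); rewrite -/f E ffa.
  rewrite -(@fixapP F alpha2 1 t isT) => /av_inj /esym; case/(ap_inj (isT : 1 < 11)%N isT).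
exists s => u.
have [t1 E1] := ccomp_av (X alpha2 t); have [t2 E2] := av_comp (X alpha2 s).
have E0 j : (j <= 6)%N -> cact t1 (ap F j) = cact t2 (ap F j).
  by move=> Hj; rewrite E1 E2 /f fa !fixapP ?fa // fixap2.
have E11 : cact t1 (ap F 11) = cact t2 (ap F 11) by rewrite E1 E2 ffa E.
rewrite -E1 -E2; apply: (@rigid_eq F t1 t2 1).
- move=> j; rewrite (divn_eq j 12) addnC; have : (j %% 12 < 12)%N by rewrite ltn_mod.
  have -> : forall m i, ap F (i + m * 12) = ap F i.
    by elim=> [|m IH] i; rewrite ?addn0 // mulSn addnA IH ap12.
  move: (j %% 12)%N => {}j j12.
  have [j6|j6] := leqP j 6; first by apply: E0.
  rewrite -(subnKC (ltnW j6)); apply: (path_agree (m := 6) (n := 5)) => //; last by lia.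
  - by move=> p k; exact: cact_nspath.
  - by move=> p k; exact: cact_nspath.
  - exact: E0.
- by move=> w A; rewrite E1 E2 (X2_fix1 _ A) (X2_fix1 _ (f_adj A)).
- by move=> w A; rewrite E1 E2 (X2_fix2 _ A) (X2_fix2 _ (f_adj A)).
Qed.

(* On [ap F 10] the commutator formula reduces to its [R12] term. *)
Lemma comm_ap10 t s : av (X alpha2 (- s)) (av (X alpha1 (- t)) (av (X alpha2 s) (ap F 10))) =
  av (X (Pos R12) (- (t * s))) (ap F 10).
Proof.
have E : X alpha2 s · X alpha1 t = X alpha1 t · X alpha2 s
  · (X (Pos R12) (- (t * s)) · X (Pos R112) (t ^+ 2 * s) · X (Pos R1112) (- (t ^+ 3 * s))
  · X (Pos R11122) (- (t ^+ 3 * s ^+ 2))).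
  by apply: gext; rewrite /= comm_12 -!mulmxA.
have C g : X alpha2 (- s) · (X alpha1 (- t) · (X alpha1 t · X alpha2 s · g)) = g.
  rewrite -(gmulA (X alpha1 t)) (gmulA (X alpha1 (- t))) XD addNr X0 gone_mul.
  by rewrite gmulA XD addNr X0 gone_mul.
have A u : av (X alpha2 (- s)) (av (X alpha1 (- t)) (av (X alpha2 s) (av (X alpha1 t) u))) =
    av (X (Pos R12) (- (t * s))) (av (X (Pos R112) (t ^+ 2 * s))
      (av (X (Pos R1112) (- (t ^+ 3 * s))) (av (X (Pos R11122) (- (t ^+ 3 * s ^+ 2))) u))).
  by rewrite (avM (X alpha2 s)) E (avM (X alpha1 (- t))) (avM (X alpha2 (- s))) C -!avM.
have := A (ap F 10); rewrite (@fixapP F alpha1) // => ->.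
by rewrite (@fixapP F (Pos R11122)) // (@fixapP F (Pos R1112)) // (@fixapP F (Pos R112)).
Qed.

(** The product of the two parameters becomes visible in the commutator on [ap 10], which ties the
    two parameter maps together. *)
Lemma sigma_comm t s t' s' : (forall u, f (av (X alpha1 t) u) = av (X alpha1 t') (f u)) ->
  (forall u, f (av (X alpha2 s) u) = av (X alpha2 s') (f u)) ->
  f (av (X (Pos R12) (- (t * s))) (ap F 10)) = av (X (Pos R12) (- (t' * s'))) (ap F 10).
Proof.
move=> E1 E2.
have inv (a : g2root) r r' : (forall u, f (av (X a r) u) = av (X a r') (f u)) ->
    forall u, f (av (X a (- r)) u) = av (X a (- r')) (f u).
  move=> E u; apply: (@av_inj _ (X a r')).
  by rewrite -E !avM !XD !subrr !X0 !av1.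
by rewrite -!comm_ap10 (inv _ _ _ E2) (inv _ _ _ E1) E2 /f fa.
Qed.

Lemma sigma_neq0 t s : t != 0 ->
  ((forall u, f (av (X alpha1 t) u) = av (X alpha1 s) (f u)) -> s != 0) /\
  ((forall u, f (av (X alpha2 t) u) = av (X alpha2 s) (f u)) -> s != 0).
Proof.
move=> t0; split=> E; apply/eqP => s0; move/eqP: t0; apply.
  by apply: move1; apply: (@cact_inj _ th); rewrite -/f E s0 X0 av1.
by apply: move2; apply: (@cact_inj _ th); rewrite -/f E s0 X0 av1.
Qed.

Lemma sigma_torus c d (c0 : c != 0) (d0 : d != 0) :
  (forall t u, f (av (X alpha1 t) u) = av (X alpha1 (c * t)) (f u)) ->
  (forall t u, f (av (X alpha2 t) u) = av (X alpha2 (d * t)) (f u)) ->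
  forall u, f u = av (H c0 d0) u.
Proof.
move=> E1 E2; apply: (@rigid_eq F th (act (H c0 d0)) 0).
- by move=> j; rewrite fa -/(av _ _) avH_ap.
- move=> w; rewrite -/(av _ _) -/f => /nbrb[->|[t ->]]; first by rewrite /f fa avH_ap.
  by rewrite E2 avM HX -avM /f fa avH_ap.
- move=> w; rewrite -/(av _ _) -/f => /nbrf[->|[t ->]]; first by rewrite /f fa avH_ap.
  by rewrite E1 avM HX -avM /f fa avH_ap.
Qed.

(** Here [c] and [d] are the images of the parameter 1, and the commutator gives [s1 * d = c * s2]
    for the images of any [t]. Fixing all neighbours of [ap 0] or [ap 1] makes one parameter map the
    identity and so the other a multiplication: no field automorphism survives. *)
Lemma sigma_lin : exists c d (c0 : c != 0) (d0 : d != 0),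
  ((forall w, adj (ap F 0) w -> f w = w) -> d = 1) /\
  ((forall w, adj (ap F 1) w -> f w = w) -> c = 1) /\
  ((forall w, adj (ap F 0) w -> f w = w) \/ (forall w, adj (ap F 1) w -> f w = w) ->
   forall u, f u = av (H c0 d0) u).
Proof.
have [c Ec] := sigma1 1; have [d Ed] := sigma2 1.
have c0 := proj1 (sigma_neq0 c (oner_neq0 F)) Ec.
have d0 := proj2 (sigma_neq0 d (oner_neq0 F)) Ed.
have F0 : (forall w, adj (ap F 0) w -> f w = w) ->
    forall t s, (forall u, f (av (X alpha2 t) u) = av (X alpha2 s) (f u)) -> s = t.
  move=> fix0 t s E; apply/eqP; rewrite -subr_eq0; apply/eqP/move2.
  apply: (@av_inj _ (X alpha2 t)); rewrite avM XD addrC subrK.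
  rewrite -{1}[ap F 11]ffa -E fix0 // -(@fixapP F alpha2 0 t isT) adj_av -(ap12 F 0).
  by apply/adj_sym; exact: adj_ap.
have F1 : (forall w, adj (ap F 1) w -> f w = w) ->
    forall t s, (forall u, f (av (X alpha1 t) u) = av (X alpha1 s) (f u)) -> s = t.
  move=> fix1 t s E; apply/eqP; rewrite -subr_eq0; apply/eqP/move1.
  apply: (@av_inj _ (X alpha1 t)); rewrite avM XD addrC subrK.
  rewrite -{1}[ap F 2]ffa -E fix1 // -(@fixapP F alpha1 1 t isT) adj_av.
  exact: adj_ap.
have cross t s1 s2 : (forall u, f (av (X alpha1 t) u) = av (X alpha1 s1) (f u)) ->
    (forall u, f (av (X alpha2 t) u) = av (X alpha2 s2) (f u)) -> s1 * d = c * s2.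
  move=> H1 H2; have := sigma_comm H1 Ed; have := sigma_comm Ec H2.
  by rewrite mulr1 mul1r => -> /inj12 /eqP; rewrite eqr_opp => /eqP ->.
exists c, d, c0, d0; split; first by move/F0; apply.
split; first by move/F1; apply.
move=> Fx; apply: sigma_torus.
  move=> t; have [s1 E1] := sigma1 t; have [s2 E2] := sigma2 t.
  suff -> : c * t = s1 by [].
  have := cross t s1 s2 E1 E2; case: Fx => [/F0|/F1] H.
    by rewrite (H 1 d Ed) (H t s2 E2) mulr1 => ->.
  by rewrite (H 1 c Ec) (H t s1 E1) !mul1r.
move=> t; have [s1 E1] := sigma1 t; have [s2 E2] := sigma2 t.
suff -> : d * t = s2 by [].
have := cross t s1 s2 E1 E2; case: Fx => [/F0|/F1] H.
  by rewrite (H 1 d Ed) (H t s2 E2) mul1r.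
by rewrite (H 1 c Ec) (H t s1 E1) mul1r mulrC.
Qed.
End Fixing.
End Normal.

Arguments cact : simpl never.

(** * Normal forms of domestic collineations *)

Section Reduction.
Variable F : fieldType.
Implicit Types (t a b c d : F) (u v w x y : vtx F) (p q : nat -> vtx F) (th : collineation F)
  (g h : G2F F).

Lemma ap_mod i : ap F i = ap F (i %% 12)%N.
Proof.
rewrite {1}(divn_eq i 12) addnC; elim: (i %/ 12)%N => [|m IH]; first by rewrite addn0.
by rewrite mulSn addnCA addnC ap12.
Qed.

(** Four vertices spaced by 3 cut the 12-cycle into paths short enough to be determined by their
    ends. *)
Lemma agree_all th th' m :
  (forall i, (i < 4)%N -> cact th (ap F (m + 3 * i)%N) = cact th' (ap F (m + 3 * i)%N)) ->
  forall j, cact th (ap F j) = cact th' (ap F j).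
Proof.
move=> H j; pose k := ((j + 11 * m) %% 12)%N; have k12 : (k < 12)%N by rewrite ltn_mod.
have -> : ap F j = ap F (m + 3 * (k %/ 3) + k %% 3)%N.
  by rewrite ap_mod [in RHS]ap_mod /k; congr (ap F _); lia.
have k4 : (k %/ 3 < 4)%N by rewrite ltn_divLR.
have k3 : (k %% 3 <= 3)%N by exact/ltnW/ltn_mod.
apply: (@path_agree F (m + 3 * (k %/ 3))%N 3) => //; try by move=> p n; exact: cact_nspath.
  exact: H.
have [k3'|k3'] := ltnP (k %/ 3)%N 3.
  have := H (k %/ 3).+1 k3'; rewrite (_ : (m + 3 * (k %/ 3).+1 = m + 3 * (k %/ 3) + 3)%N) //; lia.
have -> : (k %/ 3 = 3)%N by lia.
have -> : (m + 3 * 3 + 3 = m + 12)%N by lia.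
by have := H 0%N isT; rewrite muln0 addn0 ap12.
Qed.

Lemma dist_tri j k u v w : dist j u v -> dist k v w -> (j <= 6)%N -> (j + k <= 5)%N ->
  dist 6 u w -> False.
Proof.
move=> Dj [p [[A _] p0 <-]] j6 jk D.
have H i : (i <= k)%N -> exists2 n, (n <= j + i)%N & dist n u (p i).
  elim: i => [|i IH] Hi; first by exists j; rewrite ?addn0 // p0.
  have [n nj Dn] := IH (ltnW Hi).
  have n6 : (n <= 6)%N by lia.
  by case: (dist_step Dn n6 (A i Hi)) => -[_ D']; eexists; try exact: D'; lia.
by have [n nj Dn] := H k (leqnn k); have := dist_uniq D Dn isT; lia.
Qed.

(* A vertex at distance 3 from two opposite vertices is determined by its
   projection onto one of them. *)
Lemma mid_path m0 m1 v : dist 6 m0 m1 -> dist 3 m0 v -> dist 3 m1 v ->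
  exists p, nspath p 5 /\ [/\ adj m0 (p 0%N), p 2%N = v & p 5%N = m1].
Proof.
move=> D [r [nr r0 r3]] /dist_sym[s [ns s0 s3]].
have nr' : nspath (fun i => r (1 + i)%N) 2 by apply: nspath_shift.
exists (fun i => if (i <= 2)%N then r (1 + i)%N else s (i - 2)%N); split; last first.
  by split=> //; rewrite -r0; exact: (proj1 nr).
apply: (nspath_cat nr' ns); first by rewrite s0.
right; right=> /= E.
have D2 : dist 2 m0 (r 2%N) by exists r; split=> //; exact: nspath_le nr.
have D2' : dist 2 (r 2%N) m1.
  exists (fun i => s (1 + i)%N); split=> //.
  by apply: nspath_shift.
exact: (dist_tri D2 D2' isT isT D).
Qed.

Lemma ap_rev m n : (n <= m)%N -> nspath (fun i => ap F (m - i)%N) n.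
Proof.
move=> nm; have [A B] := nspath_rev (ap_nspath F (m - n) n).
by split=> i Hi; [have := A i Hi | have := B i Hi];
  rewrite !(_ : forall j, (j <= n)%N -> (m - n + (n - j) = m - j)%N) //; lia.
Qed.

Lemma dist_ap' i j : (i <= j)%N -> dist (j - i) (ap F i) (ap F j).
Proof. by move=> ij; have := dist_ap F i (j - i); rewrite addn0 subnKC. Qed.

Lemma av_dist g n u v : dist n u v -> dist n (av g u) (av g v).
Proof. exact: dist_cact. Qed.

(** [S1] reflects the apartment in the wall through [ap 1] and [ap 7]. *)
Lemma S1_ap : [/\ av S1 (ap F 1) = ap F 1, av S1 (ap F 7) = ap F 7,
  av S1 (ap F 10) = ap F 4 & av S1 (ap F 4) = ap F 10].
Proof.
have E1 : av S1 (ap F 1) = ap F 1.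
  by rewrite (_ : S1 = X (Pos R1) 1 · X (Neg R1) (-1) · X (Pos R1) 1) -?avM ?fixapP //; exact: gext.
have E7 : av S1 (ap F 7) = ap F 7.
  by rewrite (_ : S1 = X (Pos R1) 1 · X (Neg R1) (-1) · X (Pos R1) 1) -?avM ?fixapP //; exact: gext.
have E10 : av S1 (ap F 10) = ap F 4.
  apply: (path_uniq (p := fun i => av S1 (ap F (7 + i)%N)) (q := fun i => ap F (7 - i)%N)
    (n := 5) _ _ _ _ _ (i := 3)) => //.
  - by apply: cact_nspath; exact: ap_nspath.
  - exact: ap_rev.
  - by rewrite /= (ap12 F 0) ap0 av_ln gmul1 -ap2.
split=> //; by rewrite -E10 avM S1S1 avH_ap.
Qed.

Lemma S2_ap : [/\ av S2 (ap F 0) = ap F 0, av S2 (ap F 6) = ap F 6,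
  av S2 (ap F 9) = ap F 3 & av S2 (ap F 3) = ap F 9].
Proof.
have E0 : av S2 (ap F 0) = ap F 0.
  by rewrite (_ : S2 = X (Pos R2) 1 · X (Neg R2) (-1) · X (Pos R2) 1) -?avM ?fixapP //; exact: gext.
have E6 : av S2 (ap F 6) = ap F 6.
  by rewrite (_ : S2 = X (Pos R2) 1 · X (Neg R2) (-1) · X (Pos R2) 1) -?avM ?fixapP //; exact: gext.
have E9 : av S2 (ap F 9) = ap F 3.
  apply: (path_uniq (p := fun i => av S2 (ap F (6 + i)%N)) (q := fun i => ap F (6 - i)%N)
    (n := 5) _ _ _ _ _ (i := 3)) => //.
  - by apply: cact_nspath; exact: ap_nspath.
  - exact: ap_rev.
  - by rewrite /= ap11 av_pt S2S2 -[H _ _]gmul1 -av_pt avH_pt1 ap1.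
split=> //; by rewrite -E9 avM S2S2 avH_ap.
Qed.

(** The long root 3a1+2a2 is orthogonal to [alpha1]. Its root group moves the neighbours of [ap 10],
    and so transports what is known about one of them to the others. *)
Lemma X1_comm t s : X (Neg R1) t · S1 · X (Pos R11122) s =
  X (Pos R11122) s · (X (Neg R1) t · S1) :> G2F F.
Proof.
rewrite -gmulA S1X /= mul1r !gmulA; congr gmul.
by apply: gext; rewrite /=; mat_tac; congr vec; ring.
Qed.

Lemma X2_comm t s : X (Neg R2) t · S2 · X (Neg R112) s =
  X (Neg R112) s · (X (Neg R2) t · S2) :> G2F F.
Proof.
rewrite -gmulA S2X /= mul1r !gmulA; congr gmul.
by apply: gext; rewrite /=; mat_tac; congr vec; ring.
Qed.

Lemma T1_normal th : domestic true th -> cact th (ap F 10) = ap F 4 ->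
  exists t c (c0 : c ^+ 2 != 0) (c1 : c ^- 3 != 0),
    c != 0 /\ forall u, cact th u = av (X (Neg R1) t · S1 · H c0 c1) u.
Proof.
move=> dom E10; set f := cact th in E10 *.
(* The path from [ap 10] up to [ap 16], which is [ap 4], has its midpoint at [ap 13], the base
   point. *)
have f1 : f (ap F 1) = ap F 1.
  have [_ _] := @dom_path F th true dom (ap F 10) (fun i => ap F (10 + i)%N)
    (isP_ap F 10) (ap_nspath F 10 6) erefl (etrans (ap12 F 4) (esym E10)).
  by rewrite (ap12 F 1).
(* This root group fixes [ap 10] and [ap 4] but moves the path between them through [ap 7]. Every
   translate is reversed as well, and its midpoint is a further fixed point. *)
have fX7 t : f (av (X (Pos R11122) t) (ap F 7)) = av (X (Pos R11122) t) (ap F 7).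
  have [||//] := @dom_path F th true dom (ap F 10)
    (fun i => av (X (Pos R11122) t) (ap F (10 - i)%N)) (isP_ap F 10)
    (cact_nspath (act (X (Pos R11122) t)) (@ap_rev 10 6 isT)).
    exact: fixapP.
  by rewrite -/f E10; exact: fixapP.
have f7 : f (ap F 7) = ap F 7 by have := fX7 0; rewrite X0 av1.
have D6 : dist 6 (ap F 4) (f (ap F 4)).
  by rewrite -{1}E10; apply: dist_cact; exact/dist_sym/(@dist_ap' 4 10).
have D1 : dist 3 (ap F 1) (f (ap F 4)) by rewrite -f1; apply: dist_cact; exact: (@dist_ap' 1 4).
have D7 : dist 3 (ap F 7) (f (ap F 4)).
  by rewrite -f7; apply: dist_cact; exact/dist_sym/(@dist_ap' 4 7).
(* The image of [ap 4] is at distance 3 from the fixed opposite points [ap 1] and [ap 7], so its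
   projection onto [ap 1] determines it; [t] is the coordinate of that projection. *)
have [t Et] : exists t, f (ap F 4) = av (X (Neg R1) t) (ap F 10).
  have [p [np [p0 p2 p5]]] := mid_path (@dist_ap' 1 7 isT) D1 D7.
  case/nbrb: p0 => [p0|[t p0]].
    have E : p 2%N = ap F 4.
      by apply: (path_uniq np (ap_nspath F 2 5) _ _ _ (i := 2)).
    by rewrite -p2 E in D6; have := dist_uniq D6 (dist_refl _) isT isT.
  exists t; rewrite -p2.
  apply: (path_uniq np (q := fun i => av (X (Neg R1) t) (ap F (12 - i)%N)) _ _ _ _ (i := 2)) => //.
    by apply: cact_nspath; exact: ap_rev.
  by rewrite /= p5 fixapP.
set h := X (Neg R1) t · S1.
have [S1_1 S1_7 S1_10 S1_4] := S1_ap.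
have agr j : f (ap F j) = av h (ap F j).
  apply: (@agree_all th (act h) 1) => -[|[|[|[|i]]]] // _; rewrite -/(av h _) -/f /h -avM.
  - by rewrite f1 S1_1 fixapP.
  - by rewrite Et S1_4.
  - by rewrite f7 S1_7 fixapP.
  - by rewrite E10 S1_10 fixapP.
have agr10 w : adj (ap F 10) w -> f w = av h w.
  case/nbrb => [->|[s ->]]; first exact: agr.
  have nX : nspath (fun i => av (X (Pos R11122) s) (ap F (10 - i)%N)) 3.
    by apply: cact_nspath; exact: ap_rev.
  rewrite (ap12 F 9); apply: (path_uniq (cact_nspath th nX) (cact_nspath (act h) nX) _ _ _ (i := 1)) => //.
    by rewrite /= fixapP // agr.
  rewrite -/f -/(av h _) fX7 avM /h X1_comm -avM -(agr 7%N) f7 //.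
(* Dividing by [h] and turning by [rot], which takes [ap 10] to [ap 0], gives a collineation in the
   position that [sigma_lin] treats. *)
have [t1 E1] := ccomp_ex (act (rot F · ginv h)) th; have [th2 E2] := ccomp_ex t1 (act (ginv (rot F))).
have {E1}E2 u : cact th2 u = av (rot F · ginv h) (f (av (ginv (rot F)) u)) by rewrite E2 E1.
have rV j : av (ginv (rot F)) (ap F j) = ap F (j + 10).
  by apply: (@av_inj _ (rot F)); rewrite avVK -apSS -addnS -addnS ap12.
have fa j : cact th2 (ap F j) = ap F j.
  by rewrite E2 rV agr -avM avK -rV avVK.
have f0 w : adj (ap F 0) w -> cact th2 w = w.
  move=> A; rewrite E2 agr10; first by rewrite -avM avK avVK.
  by rewrite -(rV 0%N) adj_av.
have [c [d [c0 [d0 [d1 [_ Eth]]]]]] := sigma_lin fa.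
have {}d1 := d1 f0; subst d.
have {}Eth := Eth (or_introl f0).
have c2 : c ^+ 2 != 0 by rewrite expf_neq0.
have c3 : c ^- 3 != 0 by rewrite invr_eq0 expf_neq0.
exists t, c, c2, c3; split=> // u.
have := Eth (av (rot F) u); rewrite E2 avK -avM => /(congr1 (av (h · ginv (rot F)))).
rewrite -[LHS]avM avK avVK => ->; rewrite -[LHS]avM -[RHS]avM; congr (av h _).
apply: (@av_inj _ (rot F)); rewrite avVK !avM; congr av; apply: gext.
rewrite /= -(mulmxA (s1 F)) s2_torus // (mulmxA (s1 F)) s1_torus ?invr_eq0 ?mulf_neq0 //.
rewrite -(mulmxA (torus _ _)); congr (torus _ _ *m _); field; rewrite ?c0 ?oner_eq0 //.
Qed.

(** Dual to [T1_normal]: the midpoints are now lines, and the short root 2a1+a2, orthogonal to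
    [alpha2], supplies the further reversed paths. *)
Lemma T2_normal th : domestic false th -> cact th (ap F 3) = ap F 9 ->
  exists t d (d0 : d^-1 != 0) (d1 : d ^+ 2 != 0),
    d != 0 /\ forall u, cact th u = av (X (Neg R2) t · S2 · H d0 d1) u.
Proof.
move=> dom E3; set f := cact th in E3 *.
have f6 : f (ap F 6) = ap F 6.
  by have [] := @dom_path F th false dom (ap F 3) (fun i => ap F (3 + i)%N)
    (isP_ap F 3) (ap_nspath F 3 6) erefl (esym E3).
have fX0 t : f (av (X (Neg R112) t) (ap F 0)) = av (X (Neg R112) t) (ap F 0).
  have [||_ _] := @dom_path F th false dom (ap F 3)
    (fun i => av (X (Neg R112) t) (ap F (15 - i)%N)) (isP_ap F 3)
    (cact_nspath (act (X (Neg R112) t)) (@ap_rev 15 6 isT)).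
  - by rewrite (ap12 F 3) fixapP.
  - by rewrite -/f E3; exact: fixapP.
  - by rewrite (ap12 F 0).
have f0 : f (ap F 0) = ap F 0 by have := fX0 0; rewrite X0 av1.
have D6 : dist 6 (ap F 9) (f (ap F 9)).
  by rewrite -{1}E3; apply: dist_cact; exact: (@dist_ap' 3 9).
have D0 : dist 3 (ap F 0) (f (ap F 9)).
  by rewrite -f0; apply: dist_cact; rewrite -(ap12 F 0); exact/dist_sym/(@dist_ap' 9 12).
have D6' : dist 3 (ap F 6) (f (ap F 9)).
  by rewrite -f6; apply: dist_cact; exact: (@dist_ap' 6 9).
have [t Et] : exists t, f (ap F 9) = av (X (Neg R2) t) (ap F 3).
  have [p [np [p0 p2 p5]]] := mid_path (@dist_ap' 0 6 isT) D0 D6'.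
  case/nbrf: p0 => [p0|[t p0]].
    have E : p 2%N = ap F 9.
      by apply: (path_uniq np (@ap_rev 11 5 isT) _ _ _ (i := 2)).
    by rewrite -p2 E in D6; have := dist_uniq D6 (dist_refl _) isT isT.
  exists t; rewrite -p2.
  apply: (path_uniq np (q := fun i => av (X (Neg R2) t) (ap F (1 + i)%N)) _ _ _ _ (i := 2)) => //.
    by apply: cact_nspath; exact: ap_nspath.
  by rewrite /= p5 fixapP.
set h := X (Neg R2) t · S2.
have [S2_0 S2_6 S2_9 S2_3] := S2_ap.
have agr j : f (ap F j) = av h (ap F j).
  apply: (@agree_all th (act h) 0) => -[|[|[|[|i]]]] // _; rewrite -/(av h _) -/f /h -avM.
  - by rewrite f0 S2_0 fixapP.
  - by rewrite E3 S2_3 fixapP.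
  - by rewrite f6 S2_6 fixapP.
  - by rewrite Et S2_9.
have agr3 w : adj (ap F 3) w -> f w = av h w.
  case/nbrb => [->|[s ->]]; first exact: agr.
  have nX : nspath (fun i => av (X (Neg R112) s) (ap F (15 - i)%N)) 3.
    by apply: cact_nspath; exact: ap_rev.
  apply: (path_uniq (cact_nspath th nX) (cact_nspath (act h) nX) _ _ _ (i := 1)) => //.
    by rewrite /= (ap12 F 3) fixapP // agr.
  by rewrite /= (ap12 F 0) -/f -/(av h _) fX0 avM /h X2_comm -avM -(agr 0%N) f0.
have [t1 E1] := ccomp_ex (act (ginv (rot F) · ginv h)) th; have [th2 E2] := ccomp_ex t1 (act (rot F)).
have {E1}E2 u : cact th2 u = av (ginv (rot F) · ginv h) (f (av (rot F) u)) by rewrite E2 E1.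
have fa j : cact th2 (ap F j) = ap F j.
  by rewrite E2 -apSS agr -avM avK apSS avK.
have f1 w : adj (ap F 1) w -> cact th2 w = w.
  move=> A; rewrite E2 agr3; first by rewrite -avM avK avK.
  by rewrite apSS adj_av.
have [c [d [c0 [d0 [_ [c1 Eth]]]]]] := sigma_lin fa.
have {}c1 := c1 f1; subst c.
have {}Eth := Eth (or_intror f1).
have d2 : d ^+ 2 != 0 by rewrite expf_neq0.
have dV : d^-1 != 0 by rewrite invr_eq0.
exists t, d, dV, d2; split=> // u.
have := Eth (av (ginv (rot F)) u); rewrite E2 avVK -avM => /(congr1 (av (h · rot F))).
rewrite -[LHS]avM avVK avVK => ->; rewrite -[LHS]avM -[RHS]avM; congr (av h _).
rewrite -[u in RHS](avVK (rot F)); move: (av (ginv (rot F)) u) => u'.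
rewrite !avM; congr av; apply: gext.
rewrite /= -(mulmxA (s1 F)) s2_torus // (mulmxA (s1 F)) s1_torus ?invr_eq0 ?mulf_neq0 //.
rewrite -(mulmxA (torus _ _)); congr (torus _ _ *m _); field; rewrite ?d0 ?oner_eq0 //.
Qed.

End Reduction.

(** * The two conjugacy classes *)

Section Classes.
Variable F : fieldType.
Implicit Types (t c d : F) (u v w : vtx F) (th : collineation F) (g h k m : G2F F)
  (x y : 'cV[F]_7).

Definition conj_av th m := exists phi, forall u, cact th (cact phi u) = cact phi (av m u).

Lemma conj_toE th m : conj_to th (gv m) <-> conj_av th m.
Proof.
split=> [[th0 [[Ip IL] [phi [Hp HL]]]]|[phi H]].
  exists phi => -[p|L]; rewrite /cact /=; [congr VP | congr VL].
    by rewrite Hp; congr cpt; apply: sub_ext; apply: set_ext => z; exact: Ip.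
  by rewrite HL; congr cln; apply: sub_ext; apply: set_ext => z; exact: IL.
exists (act m); split; first by [].
by exists phi; split=> [p|L]; [have [] := H (VP p) | have [] := H (VL L)].
Qed.

Lemma conj_av_mul th m m' k : conj_av th m -> k · m = m' · k -> conj_av th m'.
Proof.
move=> [phi H] E; have [psi Hpsi] := ccomp_ex phi (act (ginv k)).
exists psi => u; rewrite !Hpsi H -!/(av _ _) !avM; congr (cact phi (av _ u)).
by rewrite -[m' in RHS]gmul1 -(gmulV k) !gmulA -(gmulA _ m') -E gmulA gmulVg gone_mul.
Qed.

Lemma conj_av_conjugate th1 th2 m : conj_av th1 m -> conj_av th2 m -> conjugate th1 th2.
Proof.
move=> [phi1 H1] [phi2 H2]; have [psi2 [K K']] := cinv_ex phi2.
have [chi Hchi] := ccomp_ex phi1 psi2; exists chi.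
have E u : cact th1 (cact chi u) = cact chi (cact th2 u).
  by rewrite !Hchi H1 -[in RHS](K' u) H2 K.
by split=> [p|L]; [have [] := E (VP p) | have [] := E (VL L)].
Qed.

Lemma conj_av_in_Type th m b : conj_av th m ->
  in_Type th (vtype_of b) <-> in_Type (act m) (vtype_of b).
Proof.
move=> [phi H]; rewrite !in_TypeE; have [psi [K K']] := cinv_ex phi.
split=> -[u ub D].
  exists (cact psi u); first by rewrite isP_cact.
  by have := dist_cact psi D; rewrite -{2}(K' u) H K.
exists (cact phi u); first by rewrite isP_cact.
by rewrite H; exact: dist_cact.
Qed.

Lemma conj_av_Type th m (s : vtype) : conj_av th m -> Type_is (act m) s -> Type_is th s.
Proof.
move=> C T r; rewrite -(T r).
by have [b ->] : exists b, r = vtype_of b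
  by [case: (r); [exists false | exists true]]; exact: conj_av_in_Type.
Qed.

Lemma dom_gram th m g : domestic true th -> (forall u, cact th u = av m u) ->
  gram (g *m e0 F) (g *m e1 F) (m *m (g *m e0 F)) (m *m (g *m e1 F)) = 0.
Proof.
move=> dom E; have [k k6 D] := dist_ex (pt g) (pt (m · g)).
rewrite -!gvMv; apply/(dist_pt_gram D k6); rewrite ltn_neqAle k6 andbT; apply/eqP => Ek.
by apply: (dom (pt g)) => //; rewrite E av_pt -Ek.
Qed.

Lemma dom_beta th m g : domestic false th -> (forall u, cact th u = av m u) ->
  beta (g *m e0 F) (m *m (g *m e0 F)) = 0.
Proof.
move=> dom E; have [k k6 D] := dist_ex (ln g) (ln (m · g)).
rewrite -!gvMv; apply/(dist_ln_beta D k6); rewrite ltn_neqAle k6 andbT; apply/eqP => Ek.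
by apply: (dom (ln g)) => //; rewrite E av_ln -Ek.
Qed.

Lemma gram_dist g h : gram (g *m e0 F) (g *m e1 F) (h *m e0 F) (h *m e1 F) != 0 ->
  dist 6 (pt g) (pt h).
Proof.
move=> /eqP N; have [k k6 D] := dist_ex (pt g) (pt h).
case: (ltngtP k 6) k6 => // [k6 _|Ek _]; last by rewrite -Ek.
by case: N; apply/(dist_pt_gram D (ltnW k6)).
Qed.

Lemma gvH c d (c0 : c != 0) (d0 : d != 0) : gv (H c0 d0) = torus c d.
Proof. by []. Qed.
Lemma gvS1 : gv S1 = s1 F. Proof. by []. Qed.
Lemma gvS2 : gv S2 = s2 F. Proof. by []. Qed.

(** On the span of [e0] and [e1] this is the SL2 matrix with rows (-1, 1) and (-1, 0), of trace
    -1. *)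
Definition m1 : G2F F := X alpha1 1 · S1.
Definition m2 : G2F F := X alpha2 1.

(** Writing the middle coordinates as doubles removes the division by 2, so that evaluations of the
    form hold in characteristic 2 as well. *)
Lemma beta_vec2 (x0 x1 x2 x3 x4 x5 x6 y0 y1 y2 y3 y4 y5 y6 : F) :
  beta (vec x0 x1 x2 (2 * x3) x4 x5 x6) (vec y0 y1 y2 (2 * y3) y4 y5 y6) =
  x0 * y6 + x6 * y0 - x1 * y5 - x5 * y1 + x2 * y4 + x4 * y2 - 2 * x3 * y3.
Proof.
have := beta_dbl (vec x0 x1 x2 x3 x4 x5 x6) (vec y0 y1 y2 y3 y4 y5 y6).
by rewrite /dbl /betaL !cc_vec.
Qed.

(** The trace in SL2 is [t / c]. One point shows that its cube is -1, another that [3 * (t / c + 1)]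
    vanishes. Together they kill the cube of [t / c + 1], which settles characteristic 3 and fields
    with further cube roots of -1 at once. *)
Lemma T1_param t c (c0 : c != 0) (c2 : c ^+ 2 != 0) (c3 : c ^- 3 != 0) th :
  domestic true th -> (forall u, cact th u = av (X (Neg R1) t · S1 · H c2 c3) u) -> t = - c.
Proof.
move=> dom E.
have E1 : (t / c) ^+ 3 + 1 = 0.
  rewrite -(dom_gram (X (Pos R2) 1 · rotn F 4) dom E) !(gvMv (X (Pos R2) _)) !rot_vecs.
  rewrite !(gvMv (_ · S1)) !(gvMv (X (Neg R1) _)) !gvX gvH gvS1 !svec.
  by rewrite /gram /beta !cc_vec /= !mul0r; field; rewrite ?c0 ?oner_eq0.
have E2 : 3 * (t / c + 1) = 0.
  have c2' : c ^+ 2 * (3 * (t / c + 1)) = 0.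
    have V0 : (X (Pos R12) 1 · rotn F 4) *m e0 F = vec 0 (-1) 0 (2 * 1) 0 1 0.
      by rewrite (gvMv (X (Pos R12) _)) rot_vecs gvX svec; congr vec; ring.
    have V1 : (X (Pos R12) 1 · rotn F 4) *m e1 F = vec (-1) 0 (-1) (2 * 0) 0 0 0.
      by rewrite (gvMv (X (Pos R12) _)) rot_vecs gvX svec; congr vec; ring.
    have := dom_gram (X (Pos R12) 1 · rotn F 4) dom E; rewrite V0 V1.
    rewrite !(gvMv (_ · S1)) !(gvMv (X (Neg R1) _)) !gvX gvH gvS1 !svec.
    rewrite (_ : vec _ _ _ _ _ _ (- _ + t * _) =
      vec (- c^-1) (- (t / c)) 0 (2 * -1) (- (2 * t)) 0 (- c)); last first.
      by congr vec; field; rewrite ?c0 ?oner_eq0.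
    rewrite (_ : vec _ _ _ _ _ (_ * 0) (- _ + t * _) = vec 0 c 0 (2 * 0) (- c ^+ 2) 0 0); last first.
      by congr vec; field; rewrite ?c0 ?oner_eq0.
    move=> <-; rewrite /gram !beta_vec2.
    by field; rewrite ?c0 ?oner_eq0.
  by apply: (mulfI c2); rewrite mulr0.
have : (t / c + 1) ^+ 3 = 0.
  have -> : (t / c + 1) ^+ 3 = ((t / c) ^+ 3 + 1) + t / c * (3 * (t / c + 1)) by ring.
  by rewrite E1 E2 mulr0 addr0.
move/eqP; rewrite expf_eq0 /= addr_eq0 => /eqP tc.
by rewrite -[t](divfK c0) tc mulN1r.
Qed.

(** The trace in the SL2 of [alpha2] is [t / d]; on the chosen line the form takes the value
    [t / d - 2]. *)
Lemma T2_param t d (d0 : d != 0) (d1 : d^-1 != 0) (d2 : d ^+ 2 != 0) th :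
  domestic false th -> (forall u, cact th u = av (X (Neg R2) t · S2 · H d1 d2) u) -> t = 2 * d.
Proof.
move=> dom E.
have : t / d - 2 = 0.
  have V : (X (Pos R12) 1 · X (Pos R1112) 1 · rotn F 3) *m e0 F = vec (-1) 0 (-1) 0 (-1) 0 1.
    rewrite (gvMv (X (Pos R12) 1 · X (Pos R1112) 1)) (gvMv (X (Pos R12) 1)) rot_vecs !gvX !svec.
    by congr vec; ring.
  have := dom_beta (X (Pos R12) 1 · X (Pos R1112) 1 · rotn F 3) dom E; rewrite V.
  rewrite (gvMv (X (Neg R2) t · S2)) (gvMv (X (Neg R2) t)) !gvX gvH gvS2 !svec => <-.
  by rewrite /beta !cc_vec /= !(mulr0, mul0r, addr0, add0r, subr0, oppr0); field; rewrite ?d0 ?oner_eq0.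
move/eqP; rewrite subr_eq0 => /eqP td.
by rewrite -[t](divfK d0) td.
Qed.

(** Non-scalar matrices of SL2 with equal trace are conjugate in GL2 but not always in SL2. The
    torus element, with value [c] at [alpha1], supplies the missing determinant. *)
Lemma m1_conj c (c0 : c != 0) (c2 : c ^+ 2 != 0) (c3 : c ^- 3 != 0) :
  S1 · H c0 (oner_neq0 F) · (X (Neg R1) (- c) · S1 · H c2 c3) = m1 · (S1 · H c0 (oner_neq0 F)).
Proof.
apply: gext; rewrite /=; apply: mx_ext => x0 x1 x2 x3 x4 x5 x6.
rewrite -!mulmxA !svec.
by congr vec; field; rewrite ?c0 ?oner_eq0.
Qed.

Lemma m2_conj d (d0 : d != 0) (d1 : d^-1 != 0) (d2 : d ^+ 2 != 0) :
  X (Neg R2) 1 · S2 · H (oner_neq0 F) d0 · (X (Neg R2) (2 * d) · S2 · H d1 d2) =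
  m2 · (X (Neg R2) 1 · S2 · H (oner_neq0 F) d0).
Proof.
apply: gext; rewrite /=; apply: mx_ext => x0 x1 x2 x3 x4 x5 x6.
rewrite -!mulmxA !svec.
by congr vec; field; rewrite ?d0 ?oner_eq0.
Qed.

Lemma domestic_translate b th th' k : (forall u, cact th' u = av (ginv k) (cact th (av k u))) ->
  domestic b th -> domestic b th'.
Proof.
move=> E dom u ub; rewrite E => /(av_dist k); rewrite avVK.
by apply: dom; rewrite /av isP_cact.
Qed.

Lemma translate_ex th k : exists th', forall u, cact th' u = av (ginv k) (cact th (av k u)).
Proof.
have [t1 E1] := ccomp_ex th (act k); have [t2 E2] := ccomp_ex (act (ginv k)) t1.
by exists t2 => u; rewrite E2 E1.
Qed.

Lemma translate_conj_av th th' k m : (forall u, cact th' u = av (ginv k) (cact th (av k u))) ->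
  (forall u, cact th' u = av m u) -> conj_av th m.
Proof.
by move=> E Em; exists (act k) => u; rewrite -!/(av _ _) -Em E avVK.
Qed.

Lemma T1_conj th : Type_is th T1 -> conj_av th m1.
Proof.
move=> /(Type_isE th false) [[u ub [p [np p0 p6]]] dom].
have [h Eh] := lnP ub; have [g Eg] := transit_ln np isT (etrans p0 Eh).
(* The turn by [rot] shifts the pair [ap 0], [ap 6] to [ap 10], [ap 4], where [ap 1] and [ap 7] are
   the midpoints. *)
have [th' E'] := translate_ex th (g · rot F).
have dom' := domestic_translate E' dom.
have [|t [c [c2 [c3 [c0 EM]]]]] := T1_normal dom'.
  rewrite E' -avM -apSS (ap12 F 0) -(Eg 0%N isT) p0 -p6 (Eg 6%N isT).
  by rewrite apSS (avM g) avK.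
have Et := T1_param c0 dom' EM; subst t.
exact: conj_av_mul (translate_conj_av E' EM) (m1_conj c0 c2 c3).
Qed.

Lemma T2_conj th : Type_is th T2 -> conj_av th m2.
Proof.
move=> /(Type_isE th true) [[u ub [p [np p0 p6]]] dom].
have [h Eh] := ptP ub; have [g Eg] := transit_pt np isT (etrans p0 Eh).
have [th' E'] := translate_ex th (g · ginv (rot F)).
have dom' := domestic_translate E' dom.
have [|t [d [d1 [d2 [d0 EM]]]]] := T2_normal dom'.
  rewrite E' -avM (apSS F 1) avK -(ap12 F 1) -(Eg 0%N isT) p0 -p6 (Eg 6%N isT).
  by apply: (@av_inj _ (g · ginv (rot F))); rewrite avVK (apSS F 7) -avM avK.
have Et := T2_param d0 dom' EM; subst t.
exact: conj_av_mul (translate_conj_av E' EM) (m2_conj d0 d1 d2).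
Qed.

(** The plane of a point consists of vectors with zero products: this holds for the base point, and
    lifts of group elements preserve it. *)
Lemma prod_e01 g : exists x y, [/\ g *m e0 F = dbl x, g *m e1 F = dbl y &
  [/\ prod0 x x, prod0 x y, prod0 y x & prod0 y y]].
Proof.
have [L [Lm _ Lp]] := lift_G (gvG g); exists (L (e0 F)), (L (e1 F)).
rewrite -!Lm -dbl_e0 -dbl_e1; split=> //.
by split; apply: Lp; rewrite /prod0 /prd0 /prd1 /prd2 /prd3 /prd4 /prd5 /prd6 /prd7
  /e0 /e1 !cc_vec /=; split; split; ring.
Qed.

Lemma m1_dbl y : m1 *m dbl y = dbl (vec (cc 1 y - cc 0 y) (- cc 0 y)
  (cc 2 y - 2 * cc 3 y + cc 4 y) (cc 2 y - cc 3 y) (cc 2 y) (cc 6 y - cc 5 y) (- cc 5 y)).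
Proof.
by rewrite /m1 gvMv gvX gvS1 /dbl !svec !cc_vec /=; congr vec; ring.
Qed.

(* On collinear pairs the form [beta x (m1 y)] has rank one. *)
Lemma m1_beta x y : prod0 x y -> beta (dbl x) (m1 *m dbl y) =
  (cc 2 x - cc 3 x + cc 4 x) * (cc 2 y - cc 3 y + cc 4 y).
Proof.
move=> [[_ _ P2 _] [P4 _ _ P7]]; rewrite m1_dbl beta_dbl.
transitivity ((cc 2 x - cc 3 x + cc 4 x) * (cc 2 y - cc 3 y + cc 4 y)
  - prd7 x y - prd2 x y - prd4 x y); last by rewrite P2 P4 P7; ring.
by rewrite /betaL /prd2 /prd4 /prd7 !cc_vec /=; ring.
Qed.

(** A form of rank one has zero Gram determinant on every plane, so no point goes to an opposite
    one, whereas the line [ap 10] does. *)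
Lemma m1_Type : Type_is (act m1) T1.
Proof.
apply/(Type_isE _ false); split.
  exists (ap F 10); first exact: isP_ap.
  have [_ _ E _] := S1_ap F; rewrite -/(av _ _) -avM E.
  rewrite -{1}(@fixapP F alpha1 10 1 isT); apply: av_dist.
  exact/dist_sym/(@dist_ap' F 4 10).
move=> u /ptP[g ->] D; have := proj1 (dist_pt_gram (h := m1 · g) _ (leqnn 6)).
rewrite -/(av _ _) av_pt in D; move/(_ g D).
rewrite !(gvMv m1); have [x [y [-> -> [Pxx Pxy Pyx Pyy]]]] := prod_e01 g.
by rewrite /gram !m1_beta // => H; suff : (6 < 6)%N by []; apply: H; ring.
Qed.

(** For lines, the form of [x] with its image is [2 * prd7 x x - prd3 x x], a combination of
    components of the square of [x], which is zero. *)
Lemma m2_Type : Type_is (act m2) T2.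
Proof.
apply/(Type_isE _ true); split.
  exists (ap F 9); first exact: isP_ap.
  have A : ap F 9 = pt (rotn F 4) by exact: ap_pt.
  rewrite -/(av _ _) A av_pt; apply: gram_dist.
  rewrite !(gvMv m2) gvX !rot_vecs !svec /gram /beta !cc_vec /=.
  by rewrite [X in X != 0](_ : _ = 1) ?oner_eq0 //; ring.
move=> u /lnP[g ->] D; have := proj1 (dist_ln_beta (h := m2 · g) _ (leqnn 6)).
rewrite -/(av _ _) av_ln in D; move/(_ g D).
rewrite !(gvMv m2); have [x [y [-> _ [[[_ _ _ P3] [_ _ _ P7]] _ _ _]]]] := prod_e01 g.
rewrite gvX (_ : xr alpha2 1 *m dbl x = dbl (vec (cc 0 x) (cc 1 x + cc 2 x) (cc 2 x) (cc 3 x)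
  (cc 4 x + cc 5 x) (cc 5 x) (cc 6 x))); last by rewrite /dbl svec !cc_vec; congr vec; rewrite /=; ring.
rewrite beta_dbl => H; suff : (6 < 6)%N by []; apply: H.
transitivity (2 * prd7 x x - prd3 x x); last by rewrite P3 P7; ring.
by rewrite /betaL /prd7 /prd3 !cc_vec /=; ring.
Qed.

Lemma T1E th : Type_is th T1 <-> conj_av th m1.
Proof. by split=> [/T1_conj //|C]; exact: conj_av_Type C m1_Type. Qed.

Lemma T2E th : Type_is th T2 <-> conj_av th m2.
Proof. by split=> [/T2_conj //|C]; exact: conj_av_Type C m2_Type. Qed.

Lemma conj_av_equiv th m m' k : k · m = m' · k -> conj_av th m <-> conj_av th m'.
Proof.
move=> E; split=> C; first exact: conj_av_mul C E.
apply: (conj_av_mul (k := ginv k) C).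
by rewrite -[m' in LHS]gmul1 -(gmulV k) !gmulA -(gmulA _ m') -E gmulA gmulVg gone_mul.
Qed.

(** The simple reflections are transitive on the long roots, and the torus then scales the parameter
    to 1. *)
Lemma long_conj a t : is_long a -> t != 0 -> exists k, k · X a t = m2 · k.
Proof.
move=> la t0.
have step1 b s : is_long b -> (forall t, t != 0 -> exists k, k · X (w1 b) t = m2 · k) ->
    s != 0 -> exists k, k · X b s = m2 · k.
  move=> _ H s0; have [|k E] := H (sg1 F b * s).
    by rewrite mulf_neq0 //; apply/eqP => z; have /eqP := sg1K F b; rewrite z mul0r eq_sym oner_eq0.
  by exists (k · S1); rewrite -gmulA S1X gmulA E gmulA.
have step2 b s : is_long b -> (forall t, t != 0 -> exists k, k · X (w2 b) t = m2 · k) ->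
    s != 0 -> exists k, k · X b s = m2 · k.
  move=> _ H s0; have [|k E] := H (sg2 F b * s).
    by rewrite mulf_neq0 //; apply/eqP => z; have /eqP := sg2K F b; rewrite z mul0r eq_sym oner_eq0.
  by exists (k · S2); rewrite -gmulA S2X gmulA E gmulA.
have H2 s : s != 0 -> exists k, k · X (Pos R2) s = m2 · k.
  move=> s0; have sV : s^-1 != 0 by rewrite invr_eq0.
  by exists (H (oner_neq0 F) sV); rewrite HX /= mulVf.
have H1112 s : s != 0 -> exists k, k · X (Pos R1112) s = m2 · k by apply: step1.
have H11122 s : s != 0 -> exists k, k · X (Pos R11122) s = m2 · k by apply: step2.
have N2 s : s != 0 -> exists k, k · X (Neg R2) s = m2 · k by apply: step2.
have N1112 s : s != 0 -> exists k, k · X (Neg R1112) s = m2 · k by apply: step1.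
have N11122 s : s != 0 -> exists k, k · X (Neg R11122) s = m2 · k by apply: step2.
by case: a la => -[] // _; auto.
Qed.

Lemma T2_long th : Type_is th T2 <-> long_root_elation th.
Proof.
rewrite T2E; split=> [C|[a [t [la [t0 C]]]]].
  by exists alpha2, 1; split=> //; split; [exact: oner_neq0 | exact/(conj_toE th m2)].
have [k E] := long_conj la t0.
by apply/(conj_av_equiv th E); apply/(conj_toE th (X a t)).
Qed.

(** In characteristic 3 the trace -1 equals 2, so [m1] is unipotent. The identity [E] turns the
    element of trace 2 into a root element of [alpha1] over any field, and [rot] carries [alpha1] to
    [phi']. *)
Lemma char3_conj : (3 : F) = 0 -> exists k, k · m1 = X phi' 1 · k.
Proof.
move=> three; have one : 1 = -2 :> F.
  by apply/eqP; rewrite -subr_eq0 opprK; apply/eqP; rewrite -[RHS]three; ring.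
have E : X (Neg R1) 1 · (X alpha1 (-2) · S1) = X alpha1 1 · X (Neg R1) 1 :> G2F F.
  apply: gext; rewrite /=; apply: mx_ext => x0 x1 x2 x3 x4 x5 x6.
  by rewrite -!mulmxA !svec; congr vec; ring.
rewrite -one in E; exists (rot F · X (Neg R1) 1).
rewrite -gmulA -/m1 E gmulA [RHS]gmulA; congr gmul.
by rewrite /rot -gmulA S2X gmulA S1X -gmulA; congr (X _ _ · _); rewrite /=; ring.
Qed.

(** Diagonalisation in SL2: the eigenvalues are [l] and its inverse, distinct because the square of
    their difference is -3. The coroot of [alpha1] takes at [l] the value [torus (l ^+ 2) (l ^- 3)];
    since [z ^+ 3 = 1], the choice [l = z ^+ 2] makes this [h_w1 z]. *)
Lemma root_conj z (z0 : z != 0) : (3 : F) != 0 -> z ^+ 2 + z + 1 = 0 ->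
  exists k, k · m1 = H z0 (oner_neq0 F) · k.
Proof.
move=> three Ez; have Ez2 : z ^+ 2 = - z - 1 by apply/eqP; rewrite -subr_eq0 -Ez; apply/eqP; ring.
have z3 : z ^+ 3 = 1 by rewrite exprS Ez2 mulrBr mulrN mulr1 -expr2 Ez2; ring.
pose l := z ^+ 2; have l0 : l != 0 by rewrite expf_neq0.
have lV : l^-1 = z by apply: (mulfI l0); rewrite mulfV // /l -exprSr z3.
have ll : l - l^-1 != 0.
  apply/eqP => E; move/eqP: three; apply.
  have : (l - l^-1) ^+ 2 = - 3 by rewrite lV /l; ring: Ez2.
  by rewrite E expr0n /= => /esym/eqP; rewrite oppr_eq0 => /eqP.
have ll1 : l + l^-1 = -1 by rewrite lV /l; ring: Ez2.
have E : X alpha1 ((l - l^-1)^-1) · X (Neg R1) l^-1 · (X alpha1 (- (l + l^-1)) · S1) =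
    H (expf_neq0 2 l0) (invr_neq0 (expf_neq0 3 l0)) ·
    (X alpha1 ((l - l^-1)^-1) · X (Neg R1) l^-1).
  have l2 : l ^+ 2 - 1 != 0.
    by rewrite (_ : _ - 1 = l * (l - l^-1)) ?mulf_neq0 //; field.
  apply: gext; rewrite /=; apply: mx_ext => x0 x1 x2 x3 x4 x5 x6.
  rewrite -!mulmxA !svec.
  by congr vec; field; rewrite ?l0 ?l2 ?oner_eq0.
rewrite ll1 opprK in E.
exists (X alpha1 ((l - l^-1)^-1) · X (Neg R1) l^-1); rewrite -/m1 in E; rewrite E.
congr gmul; apply: gext; rewrite /=; congr torus; rewrite /l.
  by rewrite -exprM (_ : (2 * 2 = 3 + 1)%N) // exprD z3 mul1r.
by rewrite -exprM (_ : (2 * 3 = 3 * 2)%N) // exprM z3 expr1n invr1.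
Qed.

Lemma irreducible_noroot : irreducible_poly ('X^2 + 'X + 1 : {poly F}) ->
  forall z : F, z ^+ 2 + z + 1 <> 0.
Proof.
move=> [_ irr] z Ez; have := irr ('X - z%:P).
have s3 : size ('X^2 + 'X + 1 : {poly F}) = 3%N.
  by rewrite -addrA size_polyDl ?size_polyXn // size_polyDl ?size_polyX ?size_poly1.
rewrite size_XsubC => /(_ isT); rewrite dvdp_XsubCl rootE !hornerE Ez eqxx => /(_ isT).
by move/eqp_size; rewrite size_XsubC s3.
Qed.

(** A fixed line gives an eigenvector. On coordinates 0, 1 and on 5, 6 the characteristic polynomial
    is z^2 + z + 1, so these coordinates vanish. The rest lies on the conic [x2 * x4 = x3 ^+ 2],
    parametrised by [r], where being fixed again yields a root. *)
Lemma m1_no_line u : (forall z : F, z ^+ 2 + z + 1 <> 0) -> isP u = false -> av m1 u <> u.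
Proof.
move=> nr /lnP[g ->]; rewrite av_ln => /esym/ln_rep[c c0]; rewrite (gvMv m1).
have [x [_ [Ex _ [[_ [_ _ _ Q]] _ _ _]]]] := prod_e01 g.
have x_neq0 : g *m e0 F <> 0.
  move=> E; have := mulKmx (inG_unit (gvG g)) (e0 F); rewrite E mulmx0 => /colP/(_ 0).
  by rewrite !mxE /= => /eqP; rewrite eq_sym oner_eq0.
rewrite Ex m1_dbl in x_neq0 *; rewrite {1}/dbl !cc_vec /= /dbl vec_lin1.
move/vec_inj => [[H0 H1 H2 H3] [H4 H5 H6]].
have nrc : c ^+ 2 + c + 1 != 0 by apply/eqP; exact: nr.
have d0 (a b : F) : a = b -> a - b = 0 by move=> ->; rewrite subrr.
have x1 : cc 1 x = 0.
  have E0 : cc 0 x = - (c * cc 1 x) by rewrite -H1 opprK.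
  by apply: (mulfI nrc); rewrite mulr0 -(d0 _ _ H0) E0; ring.
have x0 : cc 0 x = 0 by move: H1; rewrite x1 mulr0 => /eqP; rewrite oppr_eq0 => /eqP.
have x6 : cc 6 x = 0.
  have E5 : cc 5 x = - (c * cc 6 x) by rewrite -H6 opprK.
  by apply: (mulfI nrc); rewrite mulr0 -(d0 _ _ H5) E5; ring.
have x5 : cc 5 x = 0 by move: H6; rewrite x6 mulr0 => /eqP; rewrite oppr_eq0 => /eqP.
move: Q; rewrite /prd7 x0 x1 mulr0 mul0r subr0 add0r => Q.
have [x4|x4] := eqVneq (cc 4 x) 0.
  apply: x_neq0; have x2 : cc 2 x = 0 by rewrite H4 x4 mulr0.
  have x3 : cc 3 x = 0.
    by apply/eqP; rewrite -[_ == 0]orbb -mulf_eq0 -oppr_eq0 -Q x2; apply/eqP; ring.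
  rewrite /dbl x0 x1 x2 x3 x4 x5 x6 mulr0; apply/colP => i; rewrite !mxE.
  by case: i => [[|[|[|[|[|[|[|//]]]]]]] Hi].
have [r E3] : exists r, cc 3 x = r * cc 4 x by exists (cc 3 x / cc 4 x); rewrite divfK.
have Ec : c = r ^+ 2.
  apply: (mulIf x4); apply: (mulIf x4); move: Q; rewrite H4 E3 => Q.
  by apply/eqP; rewrite -subr_eq0 -Q; apply/eqP; ring.
have r0 : r != 0 by apply/eqP => z; move: c0; rewrite Ec z expr0n eqxx.
have P2 : (r ^+ 2 - r + 1) * (r ^+ 2 + r - 1) = 0.
  apply: (mulIf x4); rewrite mul0r.
  by move: H2; rewrite H4 E3 Ec => /d0 H; rewrite -[RHS]oppr0 -H; ring.
(* The middle coordinate is known only doubled. Away from characteristic 2 this already makes [- r]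
   a root; in characteristic 2 the second factor of [P2] makes [r] one. *)
have P3 : 2 * (r ^+ 2 - r + 1) = 0.
  apply: (mulIf x4); apply: (mulIf r0); rewrite !mul0r.
  by move: H3; rewrite H4 E3 Ec => /d0 H; rewrite -[RHS]oppr0 -H; ring.
have N : r ^+ 2 - r + 1 != 0 by apply/eqP => E; apply: (nr (- r)); rewrite sqrrN.
move/eqP: P3; rewrite mulf_eq0 (negbTE N) orbF => /eqP two.
move/eqP: P2; rewrite mulf_eq0 (negbTE N) /= => /eqP E.
apply: (nr r); rewrite -[RHS](addr0 0) -{1}E -two; ring.
Qed.

End Classes.

Theorem theorem8 (F : fieldType) :
  (* unique class C1 with Type = {2} *)
  ((exists th : collineation F, Type_is th T2) /\
   (forall th1 th2 : collineation F,
      Type_is th1 T2 -> Type_is th2 T2 -> conjugate th1 th2)) /\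
  (* unique class C2 with Type = {1} *)
  ((exists th : collineation F, Type_is th T1) /\
   (forall th1 th2 : collineation F,
      Type_is th1 T1 -> Type_is th2 T1 -> conjugate th1 th2)) /\
  (* C1 = long root elations *)
  (forall th : collineation F, Type_is th T2 <-> long_root_elation th) /\
  (* C2, case char 3 *)
  (3%N \in [pchar F] ->
     (forall th : collineation F, Type_is th T1 <-> conj_to th (xr phi' 1)) /\
     (forall th : collineation F, Type_is th T1 -> short_root_elation th)) /\
  (* C2, case char <> 3 and z^2+z+1 has a root *)
  (3%N \notin [pchar F] ->
     forall z : F, z ^+ 2 + z + 1 = 0 ->
     (forall th : collineation F, Type_is th T1 <-> conj_to th (h_w1 z)) /\
     (forall th : collineation F, Type_is th T1 ->
        homology th /\
        (subhexagon (fixed th) /\ full (fixed th) /\ large (fixed th)))) /\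
  (* C2, case z^2+z+1 irreducible *)
  (irreducible_poly ('X^2 + 'X + 1 : {poly F}) ->
     (forall th : collineation F,
        Type_is th T1 <-> conj_to th (xr alpha1 1 *m s1 F)) /\
     (forall th : collineation F, Type_is th T1 ->
        (forall L, ~ fixed th (VL L)) /\
        dist3_ovoid (fun p => fixed th (VP p)))).
Proof.
have ext th1 th2 m := @conj_av_conjugate F th1 th2 m.
have dom (th : collineation F) : Type_is th T1 -> domestic true th.
  by move=> /(Type_isE th false)[].
split; first split; first by exists (act (m2 F)); exact: m2_Type.
  by move=> th1 th2 /T2E C1 /T2E; exact: ext.
split; first split; first by exists (act (m1 F)); exact: m1_Type.
  by move=> th1 th2 /T1E C1 /T1E; exact: ext.
split; first exact: T2_long.
split.
  move=> ch; have [k E] := char3_conj (pcharf0 ch).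
  have T1x (th : collineation F) : Type_is th T1 <-> conj_to th (xr phi' 1).
    by rewrite T1E (conj_av_equiv th E); symmetry; exact: (conj_toE th (X phi' 1)).
  by split=> // th /T1x C; exists phi', 1; split=> //; split; first exact: oner_neq0.
split.
  move=> ch z Ez; have three : (3 : F) != 0 by apply: contraNneq ch => E; rewrite inE E eqxx.
  have z0 : z != 0.
    by apply/eqP => z0; move/eqP: Ez; rewrite z0 expr0n !add0r oner_eq0.
  have [k E] := root_conj z0 three Ez.
  have T1h (th : collineation F) : Type_is th T1 <-> conj_av th (H z0 (oner_neq0 F)).
    by rewrite T1E (conj_av_equiv th E).
  have T1c (th : collineation F) : Type_is th T1 <-> conj_to th (h_w1 z).
    by rewrite T1h; symmetry; exact: (conj_toE th (H z0 (oner_neq0 F))).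
  split=> // th Tth; split.
    exists z, 1; split=> //; split; first exact: oner_neq0.
    split; last exact/T1c.
    apply/eqP => /matrixP/(_ (inord 2) (inord 2)); rewrite !mxE eqxx /= inordK // => E2.
    have z1 : z = 1 by exact: E2.
    by move/eqP: three; apply; rewrite -[RHS]Ez z1; ring.
  have fixedE : fixed th = (fun v => cact th v = v).
    apply: functional_extensionality => -[p|L]; apply: propositional_extensionality;
      by split=> [fx|[]] //; rewrite /cact; congr (_ _).
  have domth := dom _ Tth; rewrite fixedE; split; [split|split].
  - by move=> l n; exact: no_small_ngon.
  (* The torus fixes each vertex of the standard apartment, so [th] fixes each vertex of its image
     under [phi]. *)
  - move=> u v fu fv; have [phi Hphi] := proj1 (T1h th) Tth.
    by apply: (@fix_hexagon F th phi) => // i; rewrite Hphi avH_ap.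
  - by move=> L p fL pL; apply: (dom_full domth (u := VL L)).
  by move=> u; have [v fv uv] := dom_large domth u; exists v.
move=> irr; split=> [th|th Tth].
  by rewrite T1E; symmetry; exact: (conj_toE th (m1 F)).
have [phi Hphi] := proj1 (T1E th) Tth; have [psi [K K']] := cinv_ex phi.
have nofix u : isP u = ~~ true -> cact th u <> u.
  move=> ub fu; apply: (@m1_no_line _ (cact psi u)).
  - exact: irreducible_noroot.
  - by rewrite isP_cact.
  - by apply: (can_inj K); rewrite -Hphi K'.
split; first by move=> L fL; apply: (nofix (VL L)) => //=; rewrite /cact fL.
split=> [p q fp fq pq|u].
  apply/oppositeE; apply: (ovoid_opp (dom _ Tth) nofix) => //; try by rewrite /cact ?fp ?fq.
  by case.
have [[p|L] [// _ [fp] up]] := ovoid_near (dom _ Tth) nofix u.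
by exists p.
Qed.
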